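(* (I) Let $E$ be an infinite dimensional modular Banach space whose modular satisfies the $\Delta_2$ condition, such that: (i) every ultrapower of $E$ is linearly isomodular to $E\oplus_m H$ for some Hilbert space $H$; (ii) for every Hilbert space $H$, every linear isometric operator $E\to E\oplus_m H$ maps $E$ onto $E$ (that is, onto the summand $E\oplus\{0\}$ of $E\oplus_m H$). Then the elementary class of $E$ consists exactly (up to linear isometry) of all modular direct sums $E\oplus_m H$, where $H$ is an arbitrary Hilbert space; hence this class is uncountably categorical, and $E$ is separable. (II) Let $E_0$ be a finite dimensional modular Banach space whose modular satisfies the $\Delta_2$ condition, such that: (ii') for every infinite dimensional Hilbert space $H$, every linear isometric operator $E_0\oplus_m \ell_2\to E_0\oplus_m H$ maps $E_0$ onto $E_0$. Then the elementary class of $E=E_0\oplus_m\ell_2$ consists exactly (up to linear isometry) of all modular direct sums $E_0\oplus_m H$, where $H$ is an arbitrary infinite dimensional Hilbert space; hence this class is $\kappa$-categorical for every infinite cardinal $\kappa$.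
   Context: All Banach spaces are over a fixed scalar field $\mathbb K\in\{\mathbb R,\mathbb C\}$. Hilbert spaces may have any dimension (including finite or $0$) unless stated otherwise. Modulars. A convex modular on a linear space $X$ is a convex function $\Theta:X\to[0,\infty)$ with $\Theta(0)=0$, $\Theta(\lambda x)=\Theta(x)$ for all scalars $|\lambda|=1$, and $\Theta(x)=0\Rightarrow x=0$. Its Luxemburg norm is $\|x\|=\inf\{\lambda>0:\Theta(x/\lambda)\le 1\}$. A modular space $(X,\Theta)$ is always normed by the Luxemburg norm; it is a modular Banach space if complete. $\Theta$ satisfies the $\Delta_2$ condition if there is a constant $C$ with $\Theta(2x)\le C\,\Theta(x)$ for all $x\in X$. The modular direct sum $X_1\oplus_m X_2$ of $(X_1,\Theta_1)$ and $(X_2,\Theta_2)$ is $X_1\oplus X_2$ with modular $\Theta(x_1+x_2)=\Theta_1(x_1)+\Theta_2(x_2)$; the $X_i$ are identified with subspaces of it. Every Hilbert space $H$ is equipped with the modular $\Theta_H(x)=\|x\|^2$. A linear map $T:X_1\to X_2$ is modular preserving if $\Theta_2\circ T=\Theta_1$; $X_1,X_2$ are linearly isomodular if there is a modular preserving linear surjection $X_1\to X_2$. Ultrapowers. For an ultrafilter $\mathcal U$ on a set $I$, $X_{\mathcal U}$ is the Banach space ultrapower $\ell_\infty(I,X)/\{(x_i):\lim_{i,\mathcal U}\|x_i\|=0\}$, with elements $[x_i]_{\mathcal U}$. If $(X,\Theta)$ is a $\Delta_2$ modular space, $X_{\mathcal U}$ is equipped with the (well defined) modular $\Theta_{\mathcal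 U}([x_i]_{\mathcal U})=\lim_{i,\mathcal U}\Theta(x_i)$, whose Luxemburg norm is the ultrapower norm. Elementary classes. Banach spaces $X,Y$ are elementarily equivalent if there are ultrafilters $\mathcal U,\mathcal V$ such that $X_{\mathcal U}$ and $Y_{\mathcal V}$ are linearly isometric (this is an equivalence relation). The elementary class of $X$ is the class of all Banach spaces elementarily equivalent to $X$. For an infinite cardinal $\kappa$, the elementary class of an infinite dimensional Banach space is $\kappa$-categorical if it contains, up to linear isometry, exactly one space of density character $\kappa$; it is uncountably categorical if it is $\kappa$-categorical for some uncountable $\kappa$. *)

(* Defs.v *)
From HB Require Import structures.
From mathcomp Require Import all_boot all_order all_algebra.
From mathcomp Require Import complex.
From mathcomp Require Import boolp classical_sets functions cardinality reals.
From mathcomp Require Import topology normedtype sequences.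
From mathcomp Require Import ring lra.

Set Implicit Arguments.
Unset Strict Implicit.
Unset Printing Implicit Defensive.
Import Order.TTheory GRing.Theory Num.Theory.
Import numFieldNormedType.Exports.
Local Open Scope classical_set_scope.
Local Open Scope ring_scope.
Local Open Scope quotient_scope.

Variant scalar_kind := RealScalars | ComplexScalars.

Definition scalar_field (R : realType) (k : scalar_kind) : numFieldType :=
  match k with RealScalars => R | ComplexScalars => R[i] end.

Section Scalars.
Context {R : realType} {k : scalar_kind}.
Local Notation K := (scalar_field R k).

Definition ofR : R -> K :=
  match k return R -> scalar_field R k with
  | RealScalars => id | ComplexScalars => real_complex R end.

Definition re : K -> R :=
  match k return scalar_field R k -> R with
  | RealScalars => id | ComplexScalars => @complex.Re R end.

Definition conjK : K -> K :=
  match k return scalar_field R k -> scalar_field R k with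
  | RealScalars => id | ComplexScalars => @conjc R end.

(* Norms of MathComp normed modules take their values in the scalar field,
   here among the nonnegative reals of [K]; [rnorm] is the same norm, valued
   in [R]. *)
Definition rnorm {X : normedZmodType K} (x : X) : R := re `|x|.

End Scalars.

Section ScalarTheory.
Context {R : realType} {k : scalar_kind}.
Local Notation K := (scalar_field R k).
Implicit Types (x y : R) (z : K).

Lemma ofRK : cancel (@ofR R k) re. Proof. by rewrite /ofR /re; case: k. Qed.

Lemma reK z : 0 <= z -> ofR (re z) = z.
Proof.
rewrite /ofR /re; case: k z => //= z z0.
by rewrite RRe_real// ger0_real.
Qed.

Lemma ofRD x y : ofR (x + y) = ofR x + ofR y :> K.
Proof. by rewrite /ofR; case: k => //=; exact: rmorphD. Qed.

Lemma ofRM x y : ofR (x * y) = ofR x * ofR y :> K.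
Proof. by rewrite /ofR; case: k => //=; exact: rmorphM. Qed.

Lemma ofR0 : ofR 0 = 0 :> K.
Proof. by rewrite /ofR; case: k. Qed.

Lemma ofR1 : ofR 1 = 1 :> K.
Proof. by rewrite /ofR; case: k. Qed.

Lemma ofR_nat n : ofR n%:R = n%:R :> K.
Proof. by rewrite /ofR; case: k => //=; exact: rmorph_nat. Qed.

Lemma ofRV x : ofR x^-1 = (ofR x)^-1 :> K.
Proof. by rewrite /ofR; case: k => //=; exact: fmorphV. Qed.

Lemma ofR_le x y : (ofR x <= ofR y :> K) = (x <= y).
Proof. by rewrite /ofR; case: k => //=; exact: lecR. Qed.

Lemma ofR_norm x : `|ofR x : K| = ofR `|x|.
Proof.
rewrite /ofR; case: k => //=.
by rewrite normc_def/= expr0n/= addr0 sqrtr_sqr.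
Qed.

Lemma ofR_inj : injective (@ofR R k).
Proof. exact: can_inj ofRK. Qed.

Variable X : normedZmodType K.
Implicit Types u v : X.

Lemma rnormE u : ofR (rnorm u) = `|u|.
Proof. by rewrite reK. Qed.

Lemma rnorm_ge0 u : 0 <= rnorm u.
Proof. by rewrite -(@ofR_le _ _) rnormE ofR0. Qed.

Lemma rnormD u v : rnorm (u + v) <= rnorm u + rnorm v.
Proof. by rewrite -(@ofR_le _ _) ofRD !rnormE ler_normD. Qed.

Lemma rnormN u : rnorm (- u) = rnorm u.
Proof. by rewrite /rnorm normrN. Qed.

Lemma rnorm0 : rnorm (0 : X) = 0.
Proof. by apply: ofR_inj; rewrite rnormE normr0 ofR0. Qed.

Lemma rnorm0_eq0 u : rnorm u = 0 -> u = 0.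
Proof. by move=> u0; apply/normr0_eq0; rewrite -rnormE u0 ofR0. Qed.

End ScalarTheory.

Lemma rnormZ (R : realType) (k : scalar_kind)
    (X : normedModType (scalar_field R k)) (a : scalar_field R k) (x : X) :
  rnorm (a *: x) = rnorm a * rnorm x.
Proof. by apply: (@ofR_inj R k); rewrite ofRM !rnormE normrZ. Qed.

Lemma rnormM (R : realType) (k : scalar_kind) (a b : scalar_field R k) :
  rnorm (a * b) = rnorm a * rnorm b.
Proof. by apply: (@ofR_inj R k); rewrite ofRM !rnormE normrM. Qed.

Lemma rnorm_ofR (R : realType) (k : scalar_kind) (x : R) :
  rnorm (ofR x : scalar_field R k) = `|x|.
Proof. by apply: (@ofR_inj R k); rewrite rnormE ofR_norm. Qed.

Section Modulars.
Context {R : realType} {k : scalar_kind}.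
Local Notation K := (scalar_field R k).

Record modular (V : lmodType K) := Modular {
  modular_fun :> V -> R;
  modular_ge0 : forall x, 0 <= modular_fun x;
  modular_convex : forall (t : R) (x y : V), 0 <= t -> t <= 1 ->
    modular_fun (ofR t *: x + ofR (1 - t) *: y) <=
    t * modular_fun x + (1 - t) * modular_fun y;
  modular0 : modular_fun 0 = 0;
  modular_unim : forall (a : K) (x : V), `|a| = 1 ->
    modular_fun (a *: x) = modular_fun x;
  modular_eq0 : forall x, modular_fun x = 0 -> x = 0 }.

Definition luxemburg_set (V : lmodType K) (Th : V -> R) (x : V) : set R :=
  [set l | 0 < l /\ Th (ofR l^-1 *: x) <= 1].

Definition luxemburg (V : lmodType K) (Th : V -> R) (x : V) : R :=
  inf (luxemburg_set Th x).

(* The linear space [V] normed by the Luxemburg norm of [Th]. *)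
Definition modspace (V : lmodType K) (Th : modular V) : Type := V.

HB.instance Definition _ (V : lmodType K) (Th : modular V) :=
  GRing.Lmodule.on (modspace Th).

Section LuxemburgNorm.
Variables (V : lmodType K) (Th : modular V).
Implicit Types (x y : V) (a : K) (l : R).

Lemma modular_shrink t x : 0 <= t -> t <= 1 -> Th (ofR t *: x) <= t * Th x.
Proof.
move=> t0 t1; have := modular_convex Th x 0 t0 t1.
by rewrite scaler0 addr0 modular0 mulr0 addr0.
Qed.

Lemma luxemburg_has_inf x : has_inf (luxemburg_set Th x).
Proof.
split; last by exists 0 => l [/ltW].
exists (1 + Th x); have l0 : 0 < 1 + Th x by rewrite ltr_pwDl// modular_ge0.
split=> //; apply: le_trans (modular_shrink _ _ _) _.
- by rewrite invr_ge0 ltW.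
- by rewrite invf_le1// lerDl modular_ge0.
- by rewrite mulrC ler_pdivrMr// mul1r lerDr.
Qed.

Lemma luxemburg_ge0 x : 0 <= luxemburg Th x.
Proof.
apply: lb_le_inf; first by case: (luxemburg_has_inf x).
by move=> l [/ltW].
Qed.

Lemma luxemburg_le x l : luxemburg_set Th x l -> luxemburg Th x <= l.
Proof. by apply: ge_inf; case: (luxemburg_has_inf x). Qed.

Lemma luxemburgD x y :
  luxemburg Th (x + y) <= luxemburg Th x + luxemburg Th y.
Proof.
rewrite -lerBlDr; apply: lb_le_inf; first by case: (luxemburg_has_inf x).
move=> l [l0 lx]; rewrite lerBlDr -lerBlDl.
apply: lb_le_inf; first by case: (luxemburg_has_inf y).
move=> m [m0 my]; rewrite lerBlDl; apply: luxemburg_le.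
have lm0 : 0 < l + m by rewrite addr_gt0.
split=> //; pose t := l / (l + m).
have t0 : 0 <= t by rewrite divr_ge0// ltW.
have t1 : t <= 1 by rewrite ler_pdivrMr// mul1r lerDl ltW.
have tE : 1 - t = m / (l + m).
  by rewrite -[1](@divff _ (l + m)) ?gt_eqF// -mulrBl addrC addKr.
have -> : ofR (l + m)^-1 *: (x + y) =
    ofR t *: (ofR l^-1 *: x) + ofR (1 - t) *: (ofR m^-1 *: y).
  rewrite !scalerA -!ofRM tE /t scalerDr; congr (ofR _ *: _ + ofR _ *: _).
    by rewrite mulrAC divff ?mul1r// gt_eqF.
  by rewrite mulrAC divff ?mul1r// gt_eqF.
apply: le_trans (modular_convex _ _ _ t0 t1) _.
rewrite -[leRHS](subrKC t) lerD//.
  by rewrite -[leRHS]mulr1 ler_wpM2l.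
by rewrite -[leRHS]mulr1 ler_wpM2l// subr_ge0.
Qed.

Lemma luxemburg0 : luxemburg Th 0 = 0.
Proof.
apply/le_anti; rewrite luxemburg_ge0 andbT; apply/ler_addgt0Pl => e e0.
rewrite addr0; apply: luxemburg_le; split=> //.
by rewrite scaler0 modular0.
Qed.

Let luxemburgZ_le a x : a != 0 ->
  luxemburg Th (a *: x) <= rnorm a * luxemburg Th x.
Proof.
move=> a0; have na0 : 0 < rnorm a.
  rewrite lt_def rnorm_ge0 andbT; apply: contra_neq a0; exact: rnorm0_eq0.
rewrite -ler_pdivrMl//; apply: lb_le_inf; first by case: (luxemburg_has_inf x).
move=> l [l0 lx]; rewrite ler_pdivrMl//; apply: luxemburg_le.
split; first by rewrite mulr_gt0.
suff -> : ofR (rnorm a * l)^-1 *: (a *: x) =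
    (a / `|a|) *: (ofR l^-1 *: x).
  rewrite modular_unim// normf_div normr_id divff// normr_eq0//.
by rewrite !scalerA invfM ofRM !ofRV rnormE mulrC mulrA.
Qed.

Lemma luxemburgZ a x : luxemburg Th (a *: x) = rnorm a * luxemburg Th x.
Proof.
have [->|a0] := eqVneq a 0; first by rewrite scale0r luxemburg0 rnorm0 mul0r.
apply/le_anti; rewrite luxemburgZ_le//=.
have na0 : 0 < rnorm a.
  rewrite lt_def rnorm_ge0 andbT; apply: contra_neq a0; exact: rnorm0_eq0.
have aV0 : a^-1 != 0 by rewrite invr_eq0.
have := luxemburgZ_le (a *: x) aV0; rewrite scalerA mulVf// scale1r.
have -> : rnorm a^-1 = (rnorm a)^-1.
  by apply: (@ofR_inj R k); rewrite ofRV !rnormE normfV.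
by rewrite ler_pdivlMl.
Qed.

Lemma luxemburg_eq0 x : luxemburg Th x = 0 -> x = 0.
Proof.
move=> x0; apply: (modular_eq0 (m := Th)); apply/le_anti.
rewrite modular_ge0 andbT; apply/ler_addgt0Pl => e e0; rewrite addr0.
pose d := Num.min e 1.
have d0 : 0 < d by rewrite lt_min e0 ltr01.
have [l [l0 lx] ld] : exists2 l, luxemburg_set Th x l & l < d.
  by apply: inf_lt; [case: (luxemburg_has_inf x)|rewrite -/(luxemburg Th x) x0].
have l1 : l <= 1 by rewrite ltW// (lt_le_trans ld)// ge_min lexx orbT.
have -> : x = ofR l *: (ofR l^-1 *: x).
  by rewrite scalerA -ofRM divff ?gt_eqF// ofR1 scale1r.
apply: le_trans (modular_shrink _ (ltW l0) l1) _.
rewrite (@le_trans _ _ l)//; first by rewrite -[leRHS]mulr1 ler_wpM2l// ltW.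
by rewrite ltW// (lt_le_trans ld)// ge_min lexx.
Qed.

End LuxemburgNorm.

Section LuxemburgInstance.
Variables (V : lmodType K) (Th : modular V).
Let nrm (x : modspace Th) : K := ofR (luxemburg Th x).

Let nrmD x y : nrm (x + y) <= nrm x + nrm y.
Proof. by rewrite -ofRD ofR_le luxemburgD. Qed.

Let nrmZ (a : K) x : nrm (a *: x) = `|a| * nrm x.
Proof. by rewrite /nrm luxemburgZ ofRM rnormE. Qed.

Let nrm_eq0 x : nrm x = 0 -> x = 0.
Proof. by rewrite -ofR0 => /ofR_inj/luxemburg_eq0. Qed.

HB.instance Definition _ :=
  @Lmodule_isNormed.Build K (modspace Th) nrm nrmD nrmZ nrm_eq0.

Lemma modspace_rnormE (x : modspace Th) : rnorm x = luxemburg Th x.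
Proof. by apply: (@ofR_inj R k); rewrite rnormE. Qed.

End LuxemburgInstance.

Definition Delta2 (V : lmodType K) (Th : modular V) : Prop :=
  exists C : R, forall x, Th (2 *: x) <= C * Th x.

Section DirectSum.
Variables (V1 V2 : lmodType K) (Th1 : modular V1) (Th2 : modular V2).
Let f (z : V1 * V2) : R := Th1 z.1 + Th2 z.2.

Let f_ge0 z : 0 <= f z.
Proof. by rewrite addr_ge0// modular_ge0. Qed.

Let f_convex (t : R) (x y : V1 * V2) : 0 <= t -> t <= 1 ->
  f (ofR t *: x + ofR (1 - t) *: y) <= t * f x + (1 - t) * f y.
Proof.
move=> t0 t1; rewrite /f/= !mulrDr addrACA lerD//; exact: modular_convex.
Qed.

Let f0 : f 0 = 0. Proof. by rewrite /f/= !modular0 addr0. Qed.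

Let f_unim (a : K) (x : V1 * V2) : `|a| = 1 -> f (a *: x) = f x.
Proof. by move=> a1; rewrite /f/= !modular_unim. Qed.

Let f_eq0 (x : V1 * V2) : f x = 0 -> x = 0.
Proof.
case: x => x1 x2 /eqP; rewrite /f/= paddr_eq0 ?modular_ge0//.
by move=> /andP[/eqP/modular_eq0-> /eqP/modular_eq0->].
Qed.

Definition msum : modular (V1 * V2)%type :=
  Modular f_ge0 f_convex f0 f_unim f_eq0.

(* The copy of [V1] in the direct sum. *)
Definition summand1 : set (modspace msum) := [set z | z.2 = 0].

End DirectSum.

Arguments summand1 {V1 V2} Th1 Th2.

Section SquareNorm.
Variable H : normedModType K.
Let f (x : H) : R := rnorm x ^+ 2.

Let f_ge0 x : 0 <= f x. Proof. by rewrite sqr_ge0. Qed.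

Lemma sqr_convex (t a b : R) : 0 <= t -> t <= 1 ->
  (t * a + (1 - t) * b) ^+ 2 <= t * a ^+ 2 + (1 - t) * b ^+ 2.
Proof.
move=> t0 t1; rewrite -subr_ge0.
have -> : t * a ^+ 2 + (1 - t) * b ^+ 2 - (t * a + (1 - t) * b) ^+ 2 =
  t * (1 - t) * (a - b) ^+ 2 by rewrite !expr2; ring.
by rewrite mulr_ge0 ?sqr_ge0// mulr_ge0// subr_ge0.
Qed.

Let f_convex (t : R) (x y : H) : 0 <= t -> t <= 1 ->
  f (ofR t *: x + ofR (1 - t) *: y) <= t * f x + (1 - t) * f y.
Proof.
move=> t0 t1; apply: le_trans (sqr_convex _ _ t0 t1).
have s0 : 0 <= 1 - t by rewrite subr_ge0.
rewrite /f ler_sqr ?nnegrE ?rnorm_ge0 ?addr_ge0 ?mulr_ge0 ?rnorm_ge0//.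
rewrite (le_trans (rnormD _ _))// !rnormZ !rnorm_ofR.
by rewrite (ger0_norm t0) (ger0_norm s0).
Qed.

Let f0 : f 0 = 0. Proof. by rewrite /f rnorm0 expr0n. Qed.

Let f_unim (a : K) (x : H) : `|a| = 1 -> f (a *: x) = f x.
Proof.
move=> a1; rewrite /f rnormZ; suff -> : rnorm a = 1 by rewrite mul1r.
by apply: (@ofR_inj R k); rewrite rnormE a1 ofR1.
Qed.

Let f_eq0 (x : H) : f x = 0 -> x = 0.
Proof. by move/eqP; rewrite sqrf_eq0 => /eqP/rnorm0_eq0. Qed.

(* When [H] is a Hilbert space, this is its canonical modular. *)
Definition sqnorm : modular H := Modular f_ge0 f_convex f0 f_unim f_eq0.

End SquareNorm.

End Modulars.

Arguments summand1 {R k V1 V2} Th1 Th2 _.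

Record ultrafilter (I : Type) := Ultrafilter {
  ultra_sets : set_system I;
  ultra_sets_ultra : UltraFilter ultra_sets }.

#[global] Existing Instance ultra_sets_ultra.

Lemma ultrafilter_cvg (R : realType) (I : Type) (U : ultrafilter I)
    (f : I -> R) (M : R) :
  (forall i, `|f i| <= M) -> cvg (f i @[i --> ultra_sets U]).
Proof.
move=> fM.
have cpt : compact [set` `[- M, M]] by exact: segment_compact.
have [|l [_ Ul]] := cpt (f @ ultra_sets U) _.
  by apply: (@filterE I) => i; rewrite /= in_itv/= -ler_norml.
apply: (@cvgP _ _ l) => V Vl.
have [//|UV] := in_ultra_setVsetC (f @^-1` V) (ultra_sets_ultra U).
by have [y []] := Ul (~` V) V UV Vl.
Qed.

Section Ultrapower.
Context {R : realType} {k : scalar_kind}.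
Local Notation K := (scalar_field R k).
Variables (X : normedModType K) (I : Type).

Definition bounded_family : {pred I -> X} :=
  fun x => `[< exists M : R, forall i, rnorm (x i) <= M >].

Lemma bounded_family_submod : submod_closed bounded_family.
Proof.
split; first by apply/asboolP; exists 0 => i; rewrite rnorm0.
move=> a x y /asboolP[M xM] /asboolP[N yN]; apply/asboolP.
exists (rnorm a * M + N) => i; apply: le_trans (rnormD _ _) _.
by rewrite lerD// rnormZ ler_wpM2l// rnorm_ge0.
Qed.

HB.instance Definition _ := GRing.isSubmodClosed.Build K (I -> X)
  bounded_family bounded_family_submod.

Record linf := Linf { linf_fun :> I -> X; _ : linf_fun \in bounded_family }.

HB.instance Definition _ := [isSub of linf for linf_fun].
HB.instance Definition _ := [Choice of linf by <:].
HB.instance Definition _ := [SubChoice_isSubLmodule of linf by <:].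

Lemma linf_bounded (x : linf) : exists M : R, forall i, rnorm (x i) <= M.
Proof. exact/asboolP/(valP x). Qed.

Variable U : ultrafilter I.

Definition ultra_norm (x : linf) : R := lim (rnorm (x i) @[i --> ultra_sets U]).

Lemma ultra_norm_cvg (x : linf) : rnorm (x i) @[i --> ultra_sets U] --> ultra_norm x.
Proof.
have [M xM] := linf_bounded x.
by apply: (@ultrafilter_cvg _ _ _ _ M) => i; rewrite ger0_norm ?rnorm_ge0.
Qed.

Lemma ultra_norm_unique (x : linf) (l : R) :
  rnorm (x i) @[i --> ultra_sets U] --> l -> ultra_norm x = l.
Proof. by move=> xl; apply: cvg_lim xl. Qed.

Lemma ultra_normD (x y : linf) :
  ultra_norm (x + y) <= ultra_norm x + ultra_norm y.
Proof.
rewrite -subr_ge0.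
have h : rnorm (x i) + rnorm (y i) - rnorm ((x + y) i) @[i --> ultra_sets U]
    --> ultra_norm x + ultra_norm y - ultra_norm (x + y).
  by apply: cvgB; [apply: cvgD|]; exact: ultra_norm_cvg.
rewrite -(cvg_lim (@Rhausdorff R) h); apply: limr_ge.
  by apply: cvgP h.
by apply: nearW => i; rewrite subr_ge0; exact: rnormD.
Qed.

Lemma ultra_normZ (a : K) (x : linf) :
  ultra_norm (a *: x) = rnorm a * ultra_norm x.
Proof.
apply: ultra_norm_unique.
rewrite (_ : (fun i => _) = (fun i => rnorm a * rnorm (x i))).
  by apply: cvgMl_tmp; exact: ultra_norm_cvg.
by apply/funext => i; rewrite -rnormZ.
Qed.

Lemma ultra_norm_ge0 (x : linf) : 0 <= ultra_norm x.
Proof.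
by apply: limr_ge; [exact: (cvgP _ (@ultra_norm_cvg x)) | apply: nearW => i; exact: rnorm_ge0].
Qed.

Definition null_family : {pred linf} :=
  fun x => `[< rnorm (x i) @[i --> ultra_sets U] --> (0 : R) >].

Lemma null_familyE (x : linf) : (x \in null_family) = (ultra_norm x == 0).
Proof.
apply/asboolP/eqP => [|x0]; first exact: ultra_norm_unique.
by rewrite -x0; exact: ultra_norm_cvg.
Qed.

Lemma null_family_submod : submod_closed null_family.
Proof.
split; first by rewrite null_familyE -(scale0r 0) ultra_normZ rnorm0 mul0r.
move=> a x y; rewrite !null_familyE => /eqP x0 /eqP y0.
rewrite eq_le ultra_norm_ge0 andbT (le_trans (ultra_normD _ _))//.
by rewrite ultra_normZ x0 y0 mulr0 addr0.
Qed.

HB.instance Definition _ :=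
  GRing.isSubmodClosed.Build K linf null_family null_family_submod.

Definition ultrapower : Type := Quotient.quot null_family.

HB.instance Definition _ := EqQuotient.on ultrapower.
HB.instance Definition _ := GRing.Zmodule.on ultrapower.

Definition ultra_class (x : linf) : ultrapower := \pi_ultrapower x.

Definition ultra_repr (z : ultrapower) : linf := repr z.

Lemma ultra_reprK z : ultra_class (ultra_repr z) = z.
Proof. exact: reprK. Qed.

Lemma ultra_class_eqP (x y : linf) :
  ultra_class x = ultra_class y <-> ultra_norm (x - y) = 0.
Proof.
split=> [/eqP|/eqP]; rewrite -?null_familyE.
  by rewrite -Quotient.idealrBE null_familyE => /eqP.
by rewrite Quotient.idealrBE => /eqP.
Qed.

Lemma ultra_classD x y :
  ultra_class (x + y) = ultra_class x + ultra_class y.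
Proof. exact: (Quotient.pi_add null_family). Qed.

Definition ultra_scale (a : K) (z : ultrapower) : ultrapower :=
  ultra_class (a *: ultra_repr z).

Lemma ultra_classZ a x : ultra_class (a *: x) = ultra_scale a (ultra_class x).
Proof.
apply/ultra_class_eqP; rewrite -scalerBr ultra_normZ.
suff -> : ultra_norm (x - ultra_repr (ultra_class x)) = 0 by rewrite mulr0.
by apply/ultra_class_eqP; rewrite ultra_reprK.
Qed.

Let ultra_scaleA a b z :
  ultra_scale a (ultra_scale b z) = ultra_scale (a * b) z.
Proof. by rewrite -[z]ultra_reprK -!ultra_classZ scalerA. Qed.

Let ultra_scale1 : left_id 1 ultra_scale.
Proof. by move=> z; rewrite -[z]ultra_reprK -!ultra_classZ scale1r. Qed.

Let ultra_scaleDr : right_distributive ultra_scale +%R.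
Proof.
move=> a z w; rewrite -[z]ultra_reprK -[w]ultra_reprK.
by rewrite -!(ultra_classZ, ultra_classD) scalerDr.
Qed.

Let ultra_scaleDl z : {morph ultra_scale^~ z : a b / a + b}.
Proof.
move=> a b; rewrite -[z]ultra_reprK.
by rewrite -!(ultra_classZ, ultra_classD) scalerDl.
Qed.

HB.instance Definition _ := GRing.Zmodule_isLmodule.Build K ultrapower
  ultra_scaleA ultra_scale1 ultra_scaleDr ultra_scaleDl.

Let nrm (z : ultrapower) : K := ofR (ultra_norm (ultra_repr z)).

Let nrmE x : nrm (ultra_class x) = ofR (ultra_norm x).
Proof.
have le_norm u v : ultra_norm (u - v) = 0 -> ultra_norm u <= ultra_norm v.
  by move=> uv; rewrite -[u](subrK v) (le_trans (ultra_normD _ _))// uv add0r.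
congr ofR; apply/le_anti; rewrite !le_norm//; apply/ultra_class_eqP;
  by rewrite ultra_reprK.
Qed.

Let nrmD z w : nrm (z + w) <= nrm z + nrm w.
Proof.
rewrite -[z]ultra_reprK -[w]ultra_reprK -ultra_classD !nrmE.
by rewrite -ofRD ofR_le ultra_normD.
Qed.

Let nrmZ (a : K) z : nrm (a *: z) = `|a| * nrm z.
Proof.
rewrite -[z]ultra_reprK -[a *: _]ultra_classZ !nrmE.
by rewrite ultra_normZ ofRM rnormE.
Qed.

Let nrm_eq0 z : nrm z = 0 -> z = 0.
Proof.
rewrite -[z]ultra_reprK nrmE -ofR0 => /ofR_inj z0.
have <- : ultra_class 0 = 0 
  by rewrite -(scale0r 0) ultra_classZ; exact: scale0r.
by apply/ultra_class_eqP; rewrite subr0.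
Qed.

HB.instance Definition _ :=
  @Lmodule_isNormed.Build K ultrapower nrm nrmD nrmZ nrm_eq0.

Lemma ultra_class_rnormE (x : linf) : rnorm (ultra_class x) = ultra_norm x.
Proof. by apply: (@ofR_inj R k); rewrite rnormE; exact: nrmE. Qed.

End Ultrapower.

Section UltraModular.
Context {R : realType} {k : scalar_kind}.
Local Notation K := (scalar_field R k).
Variables (V : lmodType K) (Th : modular V) (I : Type) (U : ultrafilter I).

(* The limit does not depend on the representative when [Th] is [Delta2]: see
   [ultra_modularE] below. *)
Definition ultra_modular (z : ultrapower (modspace Th) U) : R :=
  lim (Th (ultra_repr z i) @[i --> ultra_sets U]).

Section Delta2.
Variable C : R.
Hypothesis C1 : 1 <= C.
Hypothesis C2 : forall x, Th (2 *: x) <= C * Th x.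

Let C0 : 0 <= C. Proof. exact: le_trans ler01 C1. Qed.

Let le1 (x : V) (l : R) : 0 < l -> luxemburg Th x < l ->
  Th (ofR l^-1 *: x) <= 1.
Proof.
move=> l0 xl; have [m [m0 xm] ml] : exists2 m, luxemburg_set Th x m & m < l.
  by apply: inf_lt => //; case: (luxemburg_has_inf Th x).
have -> : ofR l^-1 *: x = ofR (m / l) *: (ofR m^-1 *: x).
  by rewrite scalerA -ofRM mulrAC divff ?mul1r// gt_eqF.
have ml0 : 0 <= m / l by rewrite divr_ge0// ltW.
have ml1 : m / l <= 1 by rewrite ler_pdivrMr// mul1r ltW.
apply: le_trans (modular_shrink _ _ ml0 ml1) _.
by rewrite mulr_ile1// modular_ge0.
Qed.

Let bound (n : nat) (x : V) : luxemburg Th x < 2 ^+ n -> Th x <= C ^+ n.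
Proof.
elim: n x => [|n IH] x xn.
  by rewrite expr0 in xn *; have := le1 ltr01 xn; rewrite invr1 ofR1 scale1r.
have -> : x = 2 *: (2^-1 *: x) by rewrite scalerA divff ?scale1r ?pnatr_eq0.
apply: le_trans (C2 _) _; rewrite exprS ler_wpM2l//; apply: IH.
rewrite luxemburgZ; have -> : rnorm (2^-1 : K) = 2^-1.
  have -> : 2^-1 = ofR 2^-1 :> K by rewrite ofRV ofR_nat.
  by rewrite rnorm_ofR ger0_norm ?invr_ge0 ?ler0n.
by rewrite mulrC ltr_pdivrMr// -exprSr.
Qed.

Let perturb (x d : V) (s : R) : 0 < s -> s <= 2^-1 -> luxemburg Th d < s ->
  Th (x + d) <= Th x + s * (C * Th x + 1).
Proof.
move=> s0 s2 ds; have s1 : 0 < 1 - s by lra.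
have sle1 : s <= 1 by lra.
have -> : x + d = ofR (1 - s) *: (ofR (1 - s)^-1 *: x) +
    ofR (1 - (1 - s)) *: (ofR s^-1 *: d).
  by rewrite subKr !scalerA -!ofRM !divff ?gt_eqF// ofR1 !scale1r.
apply: le_trans (modular_convex _ _ _ (ltW s1) _) _; first by lra.
pose u := s / (1 - s).
have u0 : 0 <= u by rewrite divr_ge0 ?ltW.
have u1 : u <= 1 by rewrite ler_pdivrMr// mul1r; lra.
have su : (1 - s) * u = s by rewrite mulrC divfK// gt_eqF.
have uE : (1 - s)^-1 = (1 - u) + u * 2.
  by apply: (@mulfI _ (1 - s)); rewrite ?gt_eqF// divff ?gt_eqF//; nra.
have -> : ofR (1 - s)^-1 *: x = ofR (1 - u) *: x + ofR (1 - (1 - u)) *: (2 *: x).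
  rewrite subKr uE ofRD scalerDl ofRM scalerA; congr (_ + (_ * _) *: _).
  by rewrite (ofR_nat 2).
have xu : Th (ofR (1 - u) *: x + ofR (1 - (1 - u)) *: (2 *: x)) <=
    (1 - u) * Th x + u * (C * Th x).
  apply: le_trans (modular_convex _ _ _ _ _) _; [lra|lra|].
  by rewrite subKr lerD2l ler_wpM2l.
have dl := le1 s0 ds.
move: xu dl (modular_ge0 Th x); rewrite !(subKr 1).
move: (Th (_ + _)) (Th (ofR s^-1 *: d)) (Th x) => A D T xu dl T0.
have h1 := ler_wpM2l (ltW s1) xu; have h2 := ler_wpM2l (ltW s0) dl.
have h3 := mulr_ge0 (ltW s0) T0.
have h4 : (1 - s) * ((1 - u) * T + u * (C * T)) =
  (1 - s) * T - ((1 - s) * u) * T + ((1 - s) * u) * (C * T) by ring.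
rewrite h4 su in h1; lra.
Qed.

Let linf_bound (x : linf (modspace Th) I) : exists B : R, forall i, Th (x i) <= B.
Proof.
have [M xM] := linf_bounded x; exists (C ^+ (Num.truncn M).+1) => i.
apply: bound; rewrite -modspace_rnormE (le_lt_trans (xM i))//.
have M0 : 0 <= M := le_trans (rnorm_ge0 _) (xM i).
apply: (@lt_trans _ _ (Num.truncn M).+1%:R).
  by have /andP[] := truncn_itv M0.
by rewrite -natrX ltr_nat ltn_expl.
Qed.

Lemma ultra_modular_cvg (x : linf (modspace Th) I) :
  cvg (Th (x i) @[i --> ultra_sets U]).
Proof.
have [B xB] := linf_bound x.
by apply: (@ultrafilter_cvg _ _ _ _ B) => i; rewrite ger0_norm ?modular_ge0.
Qed.

Lemma ultra_modular_le (x y : linf (modspace Th) I) :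
  ultra_norm U (y - x) = 0 ->
  lim (Th (y i) @[i --> ultra_sets U]) <= lim (Th (x i) @[i --> ultra_sets U]).
Proof.
move=> yx0; have [B xB] := linf_bound x.
apply/ler_addgt0Pl => e e0; rewrite addrC.
have [i0 _] := @filter_ex _ (ultra_sets U) _ _ filterT.
have B0 : 0 <= B := le_trans (modular_ge0 _ _) (xB i0).
have D0 : 0 < C * B + 1 by rewrite ltr_wpDl// mulr_ge0.
pose s := Num.min 2^-1 (e / (C * B + 1)).
have s0 : 0 < s by rewrite lt_min invr_gt0 ltr0n divr_gt0.
have yxs : \forall i \near ultra_sets U, Th (y i) <= Th (x i) + e.
  have := @ultra_norm_cvg _ _ _ _ U (y - x); rewrite yx0.
  move=> /cvgr0Pnorm_lt/(_ s s0); apply: filterS => i.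
  rewrite ger0_norm ?rnorm_ge0// modspace_rnormE => yxi.
  have -> : y i = x i + (y - x) i by rewrite addrC subrK.
  apply: le_trans (perturb _ s0 _ yxi) _; first by rewrite ge_min lexx.
  rewrite lerD2l; have : s <= e / (C * B + 1) by rewrite ge_min lexx orbT.
  rewrite ler_pdivlMr//; apply: le_trans; rewrite ler_wpM2l ?(ltW s0)//.
  by rewrite lerD2r ler_wpM2l.
rewrite -subr_ge0.
have h : Th (x i) + e - Th (y i) @[i --> ultra_sets U] -->
    lim (Th (x i) @[i --> ultra_sets U]) + e
    - lim (Th (y i) @[i --> ultra_sets U]).
  by apply: cvgB; [apply: cvgD; [|exact: cvg_cst]|]; exact: ultra_modular_cvg.
rewrite -(cvg_lim (@Rhausdorff R) h); apply: limr_ge; first exact: cvgP h.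
by apply: filterS yxs => i; rewrite subr_ge0.
Qed.

End Delta2.

Lemma ultra_modularE (x : linf (modspace Th) I) : Delta2 Th ->
  ultra_modular (ultra_class U x) = lim (Th (x i) @[i --> ultra_sets U]).
Proof.
move=> [C' C'P]; pose C := Num.max C' 1.
have C1 : 1 <= C by rewrite le_max lexx orbT.
have C2 y : Th (2 *: y) <= C * Th y.
  by apply: le_trans (C'P y) _; rewrite ler_wpM2r ?modular_ge0// le_max lexx.
apply/le_anti/andP; split; apply: (ultra_modular_le C1 C2);
  by apply/ultra_class_eqP; rewrite ultra_reprK.
Qed.

End UltraModular.

Arguments ultra_modular {R k V} Th {I} U z.

Section Ell2.
Context {R : realType} {k : scalar_kind}.
Local Notation K := (scalar_field R k).

Definition sqsummable : {pred nat -> K^o} :=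
  fun x => `[< cvgn (series (fun n => rnorm (x n : K) ^+ 2)) >].

Let sqr_rnorm_le (a : K) (u v : K) :
  rnorm (a * u + v) ^+ 2 <= (2 * rnorm a ^+ 2) * rnorm u ^+ 2 + 2 * rnorm v ^+ 2.
Proof.
have := rnormD (a * u) v; rewrite rnormM.
have := rnorm_ge0 (a * u + v).
move: (rnorm (_ + v)) (rnorm a) (rnorm u) (rnorm v) => p q r s p0 pqr.
apply: (@le_trans _ _ ((q * r + s) ^+ 2)).
  by rewrite ler_sqr ?nnegrE//; apply: le_trans pqr.
by rewrite -subr_ge0 (_ : _ - _ = (q * r - s) ^+ 2) ?sqr_ge0//; ring.
Qed.

Lemma sqsummable_submod : submod_closed sqsummable.
Proof.
split.
  apply/asboolP; rewrite (_ : series _ = fun=> 0); first exact: is_cvg_cst.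
  by apply/funext => n; rewrite /series/= big1// => i _; rewrite rnorm0 expr0n.
move=> a x y /asboolP xs /asboolP ys; apply/asboolP.
have zs := is_cvg_seriesD (@is_cvg_seriesZ R _ (2 * rnorm a ^+ 2) xs)
  (@is_cvg_seriesZ R _ 2 ys).
apply: series_le_cvg zs => n; rewrite ?sqr_ge0//.
  by apply: le_trans (sqr_rnorm_le a (x n) (y n)); exact: sqr_ge0.
exact: (sqr_rnorm_le a (x n) (y n)).
Qed.

HB.instance Definition _ := GRing.isSubmodClosed.Build K (nat -> K^o)
  sqsummable sqsummable_submod.

(* The sequence space l_2 over K, with its modular, the square of its norm. *)
Record ell2 := Ell2 { ell2_seq :> nat -> K^o; _ : ell2_seq \in sqsummable }.

HB.instance Definition _ := [isSub of ell2 for ell2_seq].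
HB.instance Definition _ := [Choice of ell2 by <:].
HB.instance Definition _ := [SubChoice_isSubLmodule of ell2 by <:].

Let sq (x : ell2) : R^nat := fun n => rnorm (x n : K) ^+ 2.

Let sq_cvg (x : ell2) : cvgn (series (sq x)).
Proof. exact/asboolP/(valP x). Qed.

Let f (x : ell2) : R := limn (series (sq x)).

Let f_ge_term (x : ell2) n : sq x n <= f x.
Proof.
have mono : {homo series (sq x) : n m / (n <= m)%N >-> n <= m}.
  by apply: nondecreasing_series => i _ _; exact: sqr_ge0.
apply: le_trans (nondecreasing_cvgn_le mono (@sq_cvg x) n.+1).
by rewrite seriesSr lerDr sumr_ge0// => i _; exact: sqr_ge0.
Qed.

Let f_ge0 x : 0 <= f x.
Proof. by apply: le_trans (f_ge_term x 0); exact: sqr_ge0. Qed.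

Let f_convex (t : R) (x y : ell2) : 0 <= t -> t <= 1 ->
  f (ofR t *: x + ofR (1 - t) *: y) <= t * f x + (1 - t) * f y.
Proof.
move=> t0 t1.
have xs := @is_cvg_seriesZ R _ t (@sq_cvg x).
have ys := @is_cvg_seriesZ R _ (1 - t) (@sq_cvg y).
have zs := is_cvg_seriesD xs ys.
rewrite -[t * f x](lim_seriesZ t (@sq_cvg x)).
rewrite -[(1 - t) * f y](lim_seriesZ (1 - t) (@sq_cvg y)) -lim_seriesD//.
apply: lim_series_le (@sq_cvg _) zs _ => n.
exact: (modular_convex (sqnorm K^o) (x n) (y n) t0 t1).
Qed.

Let f0 : f 0 = 0.
Proof.
rewrite /f (_ : series _ = fun=> 0); first exact: lim_cst.
by apply/funext => n; rewrite /series/= big1// => i _; rewrite /sq rnorm0 expr0n.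
Qed.

Let f_unim (a : K) (x : ell2) : `|a| = 1 -> f (a *: x) = f x.
Proof.
move=> a1; rewrite /f; congr (limn (series _)); apply/funext => n.
exact: (modular_unim (sqnorm K^o) (x n) a1).
Qed.

Let f_eq0 (x : ell2) : f x = 0 -> x = 0.
Proof.
move=> x0; apply/val_inj/funext => n; apply: (@rnorm0_eq0 R k).
apply/eqP; rewrite -sqrf_eq0 eq_le sqr_ge0 andbT.
by have := f_ge_term x n; rewrite x0.
Qed.

Definition ell2_modular : modular ell2 :=
  Modular f_ge0 f_convex f0 f_unim f_eq0.

End Ell2.

Arguments ell2 R k : clear implicits.
Arguments ell2_modular R k : clear implicits.

Section Classes.
Context {R : realType} {k : scalar_kind}.
Local Notation K := (scalar_field R k).

Definition banach (X : normedModType K) : Prop :=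
  forall F : set_system X, ProperFilter F -> cauchy F -> cvg F.

Definition hilbert (H : normedModType K) : Prop :=
  banach H /\ exists ip : H -> H -> K,
    [/\ forall y, scalar (ip ^~ y),
        forall x y, ip y x = conjK (ip x y) &
        forall x, ip x x = `|x| ^+ 2].

Definition finite_dim (V : lmodType K) : Prop :=
  exists n (e : 'I_n -> V), forall x, exists c : 'I_n -> K,
    x = \sum_(i < n) c i *: e i.

Definition is_isometry (X Y : normedModType K) (T : X -> Y) : Prop :=
  forall x, `|T x| = `|x|.

Definition isometric (X Y : normedModType K) : Prop :=
  exists T : {linear X -> Y}, is_isometry T /\ range T = setT.

Definition isomodular (V1 V2 : lmodType K) (Th1 : V1 -> R) (Th2 : V2 -> R) :
    Prop :=
  exists T : {linear V1 -> V2}, (forall x, Th2 (T x) = Th1 x) /\ range T = setT.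

Definition elementarily_equivalent (X Y : normedModType K) : Prop :=
  exists (I J : Type) (U : ultrafilter I) (W : ultrafilter J),
    isometric (ultrapower X U) (ultrapower Y W).

Definition elementary_class (X Y : normedModType K) : Prop :=
  banach Y /\ elementarily_equivalent X Y.

Definition separable (X : topologicalType) : Prop :=
  exists D : set X, countable D /\ dense D.

(* Cardinals are represented by types. *)
Definition has_density_character (X : topologicalType) (kappa : Type) : Prop :=
  (exists D : set X, dense D /\ D #= [set: kappa])%card /\
  (forall D : set X, dense D -> [set: kappa] #<= D)%card.

Definition categorical (kappa : Type) (X : normedModType K) : Prop :=
  exists Y : normedModType K,
    [/\ elementary_class X Y, has_density_character Y kappa &
        forall Z : normedModType K, elementary_class X Z ->
          has_density_character Z kappa -> isometric Z Y].

Definition uncountably_categorical (X : normedModType K) : Prop :=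
  exists kappa : Type, ~ countable [set: kappa] /\ categorical kappa X.

End Classes.

(* Main.v *)
Require Import Defs.
From HB Require Import structures.
From mathcomp Require Import all_boot all_order all_algebra.
From mathcomp Require Import complex.
From mathcomp Require Import boolp classical_sets functions cardinality reals.
From mathcomp Require Import topology normedtype sequences.
From mathcomp Require Import ring lra.

Set Implicit Arguments.
Unset Strict Implicit.
Unset Printing Implicit Defensive.
Import Order.TTheory GRing.Theory Num.Theory.
Import numFieldNormedType.Exports.
Local Open Scope classical_set_scope.
Local Open Scope ring_scope.

(* Let X_U be an ultrapower. The diagonal is an isometric embedding of E into
   E_U = E + H, so by rigidity its range is E + 0; the same holds for every
   isometric embedding of E into E_U.

   If Y_W = E + H isometrically, then (Y_W)_W = E + H' and the two canonical
   embeddings of Y_W into it map E onto the same subspace; hence E lies in the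
   closure of Y, that is in Y, and Y = E + (Y meet H). The same argument applies
   to a finite dimensional E, for which E_U = E, embedded along with l_2.

   Conversely (E + H)_U = E + H1 and E_U = E + H2. For a suitable index set, the
   ultrafilter can be chosen so that both ultrapowers have the largest possible
   cardinality P and contain separated families of size P. As E is separable, H1
   and H2 both have Hilbert dimension P, so the two ultrapowers are isometric.

   Separability of E: given an uncountable separated family (e_a), countably many
   finite rational relations, up to rounding, leave some a such that every finite
   set of vectors containing e_a has almost isometric copies with e_a moved to
   infinitely many e_b. Their ultraproduct is an isometric embedding of E into
   E_U which does not map e_a into the diagonal copy of E.

   Categoricity follows since the density character of E + H is the Hilbert
   dimension of H, as soon as the latter is infinite. *)

(** * Cardinal arithmetic by injections *)

(** Rigidity speaks of isometries because an ultrapower of a space [Y] in the class carries no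
    modular of its own: only the norm is transported. The two embeddings into the iterated
    ultrapower differ in that one applies the diagonal at each coordinate and the other repeats a
    fixed element; that they agree on [E] as ranges says that a constant family is the class of a
    family of diagonal elements, which is precisely approximation by elements of [Y]. For the
    converse the difficulty is that the hypothesis on ultrapowers gives a Hilbert summand of unknown
    dimension. Since a Hilbert space is determined by the size of a basis, it is enough to squeeze
    this size between the separated families that the ultrapower contains and its cardinality.
    Separated families of [E + H] measure [H] only if [E] contributes countably many approximants,
    so separability has to come first. *)

Definition injects (A B : Type) : Prop := exists f : A -> B, injective f.

Lemma injects_refl A : injects A A. Proof. by exists id. Qed.

Lemma injects_trans B A C : injects A B -> injects B C -> injects A C.
Proof. by move=> [f fi] [g gi]; exists (g \o f); exact: inj_comp. Qed.

Lemma injects_prod A B C D : injects A C -> injects B D -> injects (A * B) (C * D).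
Proof.
move=> [f fi] [g gi]; exists (fun p => (f p.1, g p.2)).
by move=> [a b] [a' b'] /= [/fi-> /gi->].
Qed.

Lemma injects_sig A (P : A -> Prop) : injects {x | P x} A.
Proof.
exists sval => x y e; apply: eq_sig_hprop e => z; exact: Prop_irrelevance.
Qed.

Lemma card_le_injects T U (A : set T) (B : set U) : (A #<= B)%card -> injects A B.
Proof.
by move=> /card_leP/injfunPex[f _ fi]; exists f => x y; apply: fi; rewrite inE.
Qed.

Lemma injects_card_le T U (A : set T) (B : set U) (f : T -> U) :
  (forall x, A x -> B (f x)) -> {in A &, injective f} -> (A #<= B)%card.
Proof.
move=> AB fi; have : $|{injfun A >-> B}| by apply/injfunPex; exists f.
by case => g; exact: inj_card_le.
Qed.

Lemma injects_card_leT T U : injects T U <-> ([set: T] #<= [set: U])%card.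
Proof.
split=> [[f fi]|/card_le_injects[f fi]].
  by apply: (@injects_card_le _ _ _ _ f) => // x y _ _ /fi.
exists (fun x => val (f (exist _ x (in_setT x)))) => x y /val_inj /fi.
by move=> /(congr1 val).
Qed.

Lemma injects_antisym A B : injects A B -> injects B A ->
  exists f : A -> B, bijective f.
Proof.
move=> /injects_card_leT AB /injects_card_leT BA.
have /card_bijP[f fb] : ([set: A] #= [set: B])%card by exact: Cantor_Bernstein.
pose i T (x : T) : [set: T] := exist _ x (in_setT x).
have iK T : cancel (@i T) val by [].
have valiK T : cancel val (@i T) by move=> x; apply: val_inj.
case: fb => g fK gK; exists (fun x => val (f (i A x))), (fun y => val (g (i B y))).
- by move=> x; rewrite valiK fK iK.
- by move=> y; rewrite valiK gK iK.
Qed.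

(** Zorn's lemma applies to graphs of partial injections. A maximal one is total or onto, since
    otherwise an unmatched pair [(a0, b0)] could be added. *)
Lemma injects_total A B : injects A B \/ injects B A.
Proof.
pose P (R : set (A * B)) :=
  (forall a b b', R (a, b) -> R (a, b') -> b = b') /\
  (forall a a' b, R (a, b) -> R (a', b) -> a = a').
have [F FP Ftot|R [[Rf Ri] Rmax]] := @Zorn_bigcup _ P.
  have F2 u v : (\bigcup_(X in F) X) u -> (\bigcup_(X in F) X) v ->
      exists X, [/\ F X, X u & X v].
    move=> [X FX Xu] [Y FY Yv]; have [XY|YX] := Ftot _ _ FX FY.
      by exists Y; split=> //; exact: XY.
    by exists X; split=> //; exact: YX.
  by split=> [a b b'|a a' b] /F2/[apply] -[X [/FP[Xf Xi]]]; [apply: Xf|apply: Xi].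
have [dom|/existsNP[a0 a0R]] := pselect (forall a, exists b, R (a, b)).
  left; have [f fP] := choice dom; exists f => a a' e.
  by apply: (Ri _ _ (f a)) => //; rewrite e.
have [ran|/existsNP[b0 b0R]] := pselect (forall b, exists a, R (a, b)).
  right; have [f fP] := choice ran; exists f => b b' e.
  by apply: (Rf (f b)) => //; rewrite e.
exfalso; apply: (Rmax (R `|` [set (a0, b0)])).
  split; first by move=> x; left.
  by move=> /(_ (a0, b0)) h; apply: a0R; exists b0; apply: h; right.
split.
- move=> a b b' [ab|abE] [ab'|ab'E].
  + exact: Rf ab ab'.
  + by case: ab'E ab => -> _ ab; case: a0R; exists b.
  + by case: abE ab' => -> _ ab'; case: a0R; exists b'.
  + by case: abE => _ ->; case: ab'E => _ ->.
- move=> a a' b [ab|abE] [ab'|ab'E].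
  + exact: Ri ab ab'.
  + by case: ab'E ab => _ -> ab; case: b0R; exists a.
  + by case: abE ab' => _ -> ab'; case: b0R; exists a'.
  + by case: abE => -> _; case: ab'E => -> _.
Qed.

(* Zorn gives a maximal injection of [A * A] into [A], with [A] containing an
   infinite sequence. Either [A] is as large as its complement, hence as [X], or
   the complement contains a copy [C] of [A], and the injection extends to
   [A `|` C], the new pairs being sent into [C]. *)
Lemma injects_square X : injects nat X -> injects (X * X) X.
Proof.
move=> [f fi].
pose dom (R : set (X * X * X)) a := exists c, R (a, a, c).
pose good (R : set (X * X * X)) :=
  [/\ forall p c c', R (p, c) -> R (p, c') -> c = c',
      forall p p' c, R (p, c) -> R (p', c) -> p = p',
      forall a b, dom R a -> dom R b -> exists c, R (a, b, c) &
      forall a b c, R (a, b, c) -> [/\ dom R a, dom R b & dom R c]].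
pose R0 : set (X * X * X) :=
  [set z | exists m n, z = (f m, f n, f (pickle (m, n)))].
have R0dom m : dom R0 (f m) by exists (f (pickle (m, m))), m, m.
have R0good : good R0.
  split.
  - by move=> p c c' [m [n [-> ->]]] [m' [n' [/fi<- /fi<- ->]]].
  - move=> p p' c [m [n [-> ->]]] [m' [n' [-> /fi]]].
    by move=> /(pcan_inj pickleK)[<- <-].
  - by move=> a b [c [m [n [-> _ _]]]] [c' [m' [n' [-> _ _]]]]; exists (f (pickle (m, m'))), m, m'.
  - by move=> a b c [m [n [-> -> ->]]].
(* The seed [R0], a pairing on the infinite sequence [f], is built into the property so that it
   holds for the empty chain and the maximal relation has an infinite domain. *)
pose P (R : set (X * X * X)) := good (R `|` R0).
have [F FP Ftot|R [Rgood Rmax]] := @Zorn_bigcup _ P.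
  have [->|/set0P[X0 FX0]] := eqVneq F set0.
    by rewrite /P bigcup_set0 set0U.
  have F2 u v : (\bigcup_(X in F) X `|` R0) u -> (\bigcup_(X in F) X `|` R0) v ->
      exists X, [/\ F X, (X `|` R0) u & (X `|` R0) v].
    move=> [[Y FY Yu]|uR] [[Z FZ Zv]|vR].
    - have [YZ|ZY] := Ftot _ _ FY FZ.
        by exists Z; split=> //; left => //; exact: YZ.
      by exists Y; split=> //; left => //; exact: ZY.
    - by exists Y; split=> //; [left|right].
    - by exists Z; split=> //; [right|left].
    - by exists X0; split=> //; right.
  have sub Y u : F Y -> (Y `|` R0) u -> (\bigcup_(X in F) X `|` R0) u.
    by move=> FY [Yu|]; [left; exists Y|right].
  split.
  - by move=> p c c' /F2/[apply] -[X' [/FP[+ _ _ _]]]; apply.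
  - by move=> p p' c /F2/[apply] -[X' [/FP[_ + _ _]]]; apply.
  - move=> a b [c ac] [d bd]; have [X' [FX' ac' bd']] := F2 _ _ ac bd.
    have [_ _ h _] := FP _ FX'.
    have [c'' abc] := h a b (ex_intro _ c ac') (ex_intro _ d bd').
    by exists c''; apply: sub FX' abc.
  - move=> a b c abc; have [X' [FX' abc' _]] := F2 _ _ abc abc.
    have [_ _ _ h] := FP _ FX'.
    have [[x xP] [y yP] [z zP]] := h _ _ _ abc'.
    by split; [exists x|exists y|exists z]; apply: sub FX' _.
pose S := R `|` R0.
have [Sf Si Sc Sd] : good S by [].
pose TA := {x | dom S x}; pose TC := {x | ~ dom S x}.
have natA : injects nat TA.
  have h m : dom S (f m) by have [c Rc] := R0dom m; exists c; right.
  by exists (fun m => exist _ (f m) (h m)) => m n /(congr1 sval)/= /fi.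
have sqA : injects (TA * TA) TA.
  have /choice[g gP] : forall p : TA * TA, exists c : TA,
      S (sval p.1, sval p.2, sval c).
    move=> [[a aP] [b bP]] /=; have [c abc] := Sc _ _ aP bP.
    by have [_ _ cP] := Sd _ _ _ abc; exists (exist _ c cP).
  exists g => p q e; have := gP q; rewrite -e => /(Si _ _ _ (gP p)) [].
  case: p q {e} => [x y] [x' y'] /= e1 e2.
  by congr pair; [apply: eq_sig_hprop e1|apply: eq_sig_hprop e2] => ?; exact: Prop_irrelevance.
have boolA : injects bool TA.
  apply: injects_trans (natA); exists nat_of_bool; by case; case.
have bA : injects (bool * bool * (TA * TA)) TA.
  apply: injects_trans (sqA); apply: (injects_prod _ sqA).
  by apply: injects_trans (sqA); exact: injects_prod.
have [[h hi]|[j ji]] := injects_total TC TA.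
  have XA : injects X TA.
    apply: injects_trans (sqA).
    have [b bi] := boolA.
    exists (fun x => match pselect (dom S x) with
      | left p => (b true, exist _ x p) | right p => (b false, h (exist _ x p)) end).
    move=> x y; case: pselect => p; case: pselect => q; case.
    - by [].
    - by move=> /bi.
    - by move=> /bi.
    - by move=> /hi /(congr1 sval).
  apply: injects_trans (injects_prod XA XA) _; apply: injects_trans (sqA) _.
  exact: injects_sig.
exfalso; have [h hi] := bA.
(* [kk false] enumerates the domain and [kk true] its copy in the complement. [R'] adds the pairs
   with at least one coordinate in the copy; [h] labels the blocks by two booleans, so that the new
   values, pushed through [j], never collide. *)
pose kk (s : bool) (a : TA) : X := if s then sval (j a) else sval a.
have kki s a t b : kk s a = kk t b -> s = t /\ a = b.
  have e1 (Q : X -> Prop) (u v : {x | Q x}) : sval u = sval v -> u = v.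
    by move=> e; apply: eq_sig_hprop e => ?; exact: Prop_irrelevance.
  case: s; case: t => /= e.
  - by split=> //; apply: ji; apply: e1.
  - by have := svalP (j a); rewrite e; case: b {e}.
  - by have := svalP (j b); rewrite -e; case: a {e}.
  - by split=> //; apply: e1.
pose R' : set (X * X * X) := S `|` [set z | exists s t a b,
  s || t /\ z = (kk s a, kk t b, sval (j (h (s, t, (a, b)))))].
have Sdom a : dom S a -> exists a', a = kk false a' by move=> da; exists (exist _ a da).
have RS : S `<=` R' by move=> z; left.
have R'dom u : dom R' u <-> exists s a, u = kk s a.
  split=> [[c [/Sd[/Sdom[a ->] _ _]|[s [t [a [b [_ [-> _ _]]]]]]]]|].
  - by exists false, a.
  - by exists s, a.
  - case=> -[] [a ->].
    + exists (sval (j (h (true, true, (a, a))))).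
      by right; exists true, true, a, a.
    + by case: a => a [c ac] /=; exists c; left.
have R'E : R' `|` R0 = R'.
  by apply/seteqP; split=> [z [//|zR]|z]; left => //; right.
apply: (Rmax R'); first split.
- by move=> z Rz; left; left.
- have [f' f'i] := natA; pose a0 := f' 0%N.
  move=> /(_ (kk true a0, kk true a0, sval (j (h (true, true, (a0, a0)))))) H.
  suff : dom S (kk true a0) by apply: (svalP (j a0)).
  eexists; left; apply: H; right; by exists true, true, a0, a0.
rewrite /P R'E; split.
- move=> p c c' [pc|[s [t [a [b [st zE]]]]]] [pc'|[s' [t' [a' [b' [st' zE']]]]]].
  + exact: Sf pc pc'.
  + case: zE' pc => -> _ /Sd[/Sdom[x /kki[e1 _]] /Sdom[y /kki[e2 _]] _].
    by move: st'; rewrite e1 e2.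
  + case: zE pc' => -> _ /Sd[/Sdom[x /kki[e1 _]] /Sdom[y /kki[e2 _]] _].
    by move: st; rewrite e1 e2.
  + by case: zE zE' => -> -> [/kki[-> ->] /kki[-> ->] ->].
- move=> [u v] [u' v'] c [pc|[s [t [a [b [st zE]]]]]] [pc'|[s' [t' [a' [b' [st' zE']]]]]].
  + exact: Si pc pc'.
  + by case: zE' pc => _ _ -> /Sd[_ _ H]; case: (svalP (j (h (s', t', (a', b'))))).
  + by case: zE pc' => _ _ -> /Sd[_ _ H]; case: (svalP (j (h (s, t, (a, b))))).
  + case: zE zE' => -> -> -> [-> -> e].
    have /ji/hi[-> -> -> ->] // : j (h (s, t, (a, b))) = j (h (s', t', (a', b'))).
    by apply: eq_sig_hprop e => ?; exact: Prop_irrelevance.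
- move=> u v /R'dom[s [a ->]] /R'dom[t [b ->]].
  case: (boolP (s || t)) => [st|].
    by exists (sval (j (h (s, t, (a, b))))); right; exists s, t, a, b.
  rewrite negb_or => /andP[/negbTE-> /negbTE->] /=.
  by have [c abc] := Sc _ _ (svalP a) (svalP b); exists c; left.
- move=> u v c [/Sd[/Sdom[x ->] /Sdom[y ->] /Sdom[z ->]]|[s [t [a [b [_ [-> -> ->]]]]]]].
    by split; apply/R'dom; [exists false, x|exists false, y|exists false, z].
  split; apply/R'dom; [by exists s, a|by exists t, b|].
  by exists true, (h (s, t, (a, b))).
Qed.

(** Lists are encoded by iterated pairing together with their length, without which the value [f 0]
    of the empty list might coincide with that of a longer one. *)
Lemma injects_seq X : injects nat X -> injects (seq X) X.
Proof.
move=> natX; have [p pi] := injects_square natX.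
apply: injects_trans (injects_square natX); have [f fi] := natX.
pose enc := fix enc (s : seq X) : X := if s is x :: s' then p (x, enc s') else f 0%N.
exists (fun s => (f (size s), enc s)) => s t [/fi st e].
elim: s t st e => [|x s IH] [|y t] //= [st] /pi[-> /(IH _ st)->//].
Qed.

Lemma injects_nat_or B : injects nat B \/ injects B nat.
Proof. exact: injects_total. Qed.

Lemma injects_code B : injects nat B -> injects (nat * seq (nat * B)) B.
Proof.
move=> natB; apply: injects_trans (injects_square natB).
apply: (injects_prod natB); apply: injects_trans (injects_seq natB).
have [f fi] : injects (nat * B) B.
  by apply: injects_trans (injects_square natB); exact: injects_prod (injects_refl _).
by exists (map f); exact: inj_map.
Qed.

Lemma injects_code_nat B : injects B nat -> injects (nat * seq (nat * B)) nat.
Proof.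
move=> [f fi]; exists (fun z => pickle (z.1, map (fun y => (y.1, f y.2)) z.2)).
move=> [m s] [n t] /(pcan_inj pickleK)/= [->] /inj_map-> // [a b] [c d] /=.
by move=> [-> /fi->].
Qed.

Lemma cantor_nat : ~ injects (nat -> bool) nat.
Proof.
move=> [f fi].
pose D n := `[< exists g, f g = n /\ g n = false >].
have : D (f D) = false <-> D (f D) = true.
  split=> [h|/asboolP[g [/fi-> //]]]; apply/asboolP; by exists D.
by case: (D _) => -[] //; [move=> _ /(_ erefl)|move=> /(_ erefl)].
Qed.

(** * Real-valued norms and completeness *)

Section RealNorm.
Context {R : realType} {k : scalar_kind}.
Local Notation K := (scalar_field R k).

Definition mklin (X Y : lmodType K) (f : X -> Y) (fl : linear f) : {linear X -> Y} :=
  HB.pack f (GRing.isLinear.Build K X Y *:%R f fl).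

Lemma mklinE (X Y : lmodType K) (f : X -> Y) (fl : linear f) x : mklin fl x = f x.
Proof. by []. Qed.

Lemma ofR_lt (x y : R) : (ofR x < ofR y :> K) = (x < y).
Proof. by rewrite !lt_def ofR_le (inj_eq (@ofR_inj R k)). Qed.

Lemma ofR_gt0 (x : R) : (0 < ofR x :> K) = (0 < x).
Proof. by rewrite -(@ofR0 R k) ofR_lt. Qed.

Lemma re_gt0 (e : K) : 0 < e -> 0 < re e.
Proof. by move=> e0; rewrite -ofR_gt0 reK// ltW. Qed.

Section Normed.
Variable X : normedModType K.
Implicit Types x y z : X.

Lemma rnormBC x y : rnorm (x - y) = rnorm (y - x).
Proof. by rewrite -rnormN opprB. Qed.

Lemma rnorm_triangle y x z : rnorm (x - z) <= rnorm (x - y) + rnorm (y - z).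
Proof. by rewrite -[x - z](subrKA y) rnormD. Qed.

Lemma rnormB_le x y : rnorm x <= rnorm y + rnorm (x - y).
Proof. by rewrite -[X in rnorm X <= _](subrKC y x) rnormD. Qed.

Lemma ler_rnorm_dist x y : `|rnorm x - rnorm y| <= rnorm (x - y).
Proof.
rewrite ler_norml lerBlDl lerBrDl; apply/andP; split.
  by rewrite lerBlDr [rnorm (x - y)]rnormBC rnormB_le.
by rewrite rnormB_le.
Qed.

Lemma ballE x y (e : K) : 0 < e -> ball x e y = (rnorm (x - y) < re e) :> Prop.
Proof. by move=> e0; rewrite -ball_normE /= -[in LHS](reK (ltW e0)) -rnormE ofR_lt. Qed.

Lemma cvg_rnormP (T : Type) (F : set_system T) (FF : Filter F) (f : T -> X) l :
  f x @[x --> F] --> l <-> forall e : R, 0 < e -> \forall x \near F, rnorm (f x - l) < e.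
Proof.
split=> [/cvg_ballP h e e0|h].
  have e0' : 0 < (ofR e : K) by rewrite ofR_gt0.
  by have := h _ e0'; apply: filterS => x; rewrite ballE// ofRK rnormBC.
apply/cvg_ballP => e e0; have := h _ (re_gt0 e0); apply: filterS => x.
by rewrite ballE// rnormBC.
Qed.

End Normed.

Lemma rnorm_nat (n : nat) : rnorm (n%:R : K) = n%:R.
Proof. by rewrite -ofR_nat rnorm_ofR ger0_norm. Qed.

Lemma isometryP (X Y : normedModType K) (T : X -> Y) :
  is_isometry T <-> forall x, rnorm (T x) = rnorm x.
Proof.
split=> h x; first by rewrite /rnorm h.
by rewrite -!rnormE h.
Qed.

(** Unbundled, so that compositions, inverses and functions obtained by choice qualify without being
    packed as linear maps. *)
Definition lin_isometry (X Y : normedModType K) (f : X -> Y) : Prop :=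
  linear f /\ forall x, rnorm (f x) = rnorm x.

Lemma lin_isometry_dist (X Y : normedModType K) (f : X -> Y) : lin_isometry f ->
  forall x y, rnorm (f x - f y) = rnorm (x - y).
Proof.
move=> [fl fn] x y; rewrite -fn; congr rnorm.
by rewrite -!(mklinE fl) linearB.
Qed.

Lemma dist_inj (X Y : normedModType K) (f : X -> Y) :
  (forall x y, rnorm (f x - f y) = rnorm (x - y)) -> injective f.
Proof.
move=> h x y e; apply/subr0_eq/rnorm0_eq0.
by rewrite -h e subrr rnorm0.
Qed.

Lemma lin_isometry_comp (X Y Z : normedModType K) (g : Y -> Z) (f : X -> Y) :
  lin_isometry g -> lin_isometry f -> lin_isometry (g \o f).
Proof.
by move=> [gl gn] [fl fn]; split=> [a x y|x] /=; rewrite ?fl ?gl// gn fn.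
Qed.

Lemma isometricP (X Y : normedModType K) :
  isometric X Y <-> exists f : X -> Y, lin_isometry f /\ forall y, exists x, f x = y.
Proof.
split=> [[T [/isometryP Tn Tr]]|[f [[fl fn] fs]]].
  exists T; split; first by split=> // a x y; rewrite linearP.
  move=> y; have [x _ <-] : range T y by rewrite Tr.
  by exists x.
  exists (mklin fl); split; first exact/isometryP.
by apply/seteqP; split=> // y _; have [x <-] := fs y; exists x.
Qed.

Lemma isometric_refl (X : normedModType K) : isometric X X.
Proof. by apply/isometricP; exists id; split; [split|move=> y; exists y]. Qed.

Lemma isometric_inv (X Y : normedModType K) : isometric X Y ->
  exists (f : X -> Y) (g : Y -> X),
    [/\ lin_isometry f, lin_isometry g, cancel f g & cancel g f].
Proof.
move=> /isometricP[f [fi /choice[g gP]]].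
have gK : cancel f g.
  by move=> x; apply: (dist_inj (lin_isometry_dist fi)); rewrite gP.
exists f, g; split=> //; split=> [a x y|x].
  by rewrite -[x in LHS]gP -[y in LHS]gP -fi.1 gK.
by rewrite -fi.2 gP.
Qed.

Lemma isometric_sym (X Y : normedModType K) : isometric X Y -> isometric Y X.
Proof.
move=> /isometric_inv[f [g [fi gi fK gK]]]; apply/isometricP; exists g; split=> //.
by move=> x; exists (f x).
Qed.

Lemma isometric_trans (Y X Z : normedModType K) :
  isometric X Y -> isometric Y Z -> isometric X Z.
Proof.
move=> /isometricP[f [fi fs]] /isometricP[g [gi gs]]; apply/isometricP.
exists (g \o f); split; first exact: lin_isometry_comp.
by move=> z; have [y <-] := gs z; have [x <-] := fs y; exists x.
Qed.

End RealNorm.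

(** * Completeness tested on geometrically convergent sequences *)

Section Halves.
Context {R : realType}.

Lemma half_small (C e : R) : 0 < e -> exists n : nat, C * 2^-1 ^+ n < e.
Proof.
move=> e0; pose n := (Num.truncn (`|C| / e)).+1; exists n.
rewrite exprVn ltr_pdivrMr ?exprn_gt0//.
apply: (@lt_trans _ _ (e * n%:R)); last first.
  by rewrite ltr_pM2l// -natrX ltr_nat ltn_expl.
have : `|C| / e < n%:R.
  by have /andP[] := @truncn_itv _ (`|C| / e) (divr_ge0 (normr_ge0 _) (ltW e0)).
by rewrite ltr_pdivrMr// mulrC; apply: le_lt_trans; exact: ler_norm.
Qed.

Lemma half_gt0 n : 0 < 2^-1 ^+ n :> R.
Proof. by rewrite exprn_gt0// invr_gt0. Qed.

Lemma halfS n : 2^-1 ^+ n = 2 * 2^-1 ^+ n.+1 :> R.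
Proof. by rewrite exprS mulrA divff ?mul1r// pnatr_eq0. Qed.

Lemma half_le m n : (m <= n)%N -> 2^-1 ^+ n <= 2^-1 ^+ m :> R.
Proof.
move=> mn; apply: ler_wiXn2l => //.
- by rewrite invr_ge0.
- by rewrite invf_le1// ler1n.
Qed.

End Halves.

Section Banach.
Context {R : realType} {k : scalar_kind}.
Local Notation K := (scalar_field R k).

(** Limits of such sequences come with explicit errors, and Cauchy filters need handling only in
    [banachP]. *)
Definition fast (X : normedModType K) (u : nat -> X) : Prop :=
  forall n, rnorm (u n.+1 - u n) <= 2^-1 ^+ n.

Lemma fast_dist (X : normedModType K) (u : nat -> X) : fast u ->
  forall m n, (m <= n)%N -> rnorm (u n - u m) <= 2 * 2^-1 ^+ m.
Proof.
move=> uf m n mn; have h : rnorm (u n - u m) <= 2 * (2^-1 ^+ m - 2^-1 ^+ n).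
  elim: n mn => [|n IH]; first by rewrite leqn0 => /eqP->; rewrite !subrr rnorm0 mulr0.
  rewrite leq_eqVlt => /predU1P[<-|/IH h]; first by rewrite !subrr rnorm0 mulr0.
  apply: le_trans (rnorm_triangle (u n) _ _) _.
  by have := uf n; move: h; rewrite (halfS n); lra.
apply: le_trans h _; have := @half_gt0 R n; lra.
Qed.

Lemma banachP (X : normedModType K) : banach X <->
  forall u : nat -> X, fast u -> exists l, forall n, rnorm (u n - l) <= 2 * 2^-1 ^+ n.
Proof.
split=> [Xb u uf|h F PF Fc].
  have : cauchy (u @ \oo).
    apply: cauchy_exP => e e0.
    have [N NP] := half_small 2 (re_gt0 e0); exists (u N).
    exists N => //= n /= Nn; rewrite ballE// rnormBC.
    exact: le_lt_trans (fast_dist uf Nn) NP.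
  move=> /Xb /cvg_ex[l /cvg_rnormP ul]; exists l => n.
  apply/ler_addgt0Pl => e e0.
  have [N _ NP] := ul _ e0.
  have := NP (maxn N n) (leq_maxl _ _) => /= lt.
  apply: le_trans (rnorm_triangle (u (maxn N n)) _ _) _.
  have := fast_dist uf (leq_maxr N n); rewrite rnormBC; lra.
(* Two consecutive balls meet, both being members of a proper filter; the radius [2^-1 ^+ n.+2]
   keeps their centres within [2^-1 ^+ n]. *)
have /choice[x xP] : forall n : nat, exists x : X, F (ball x (ofR (2^-1 ^+ n.+2))).
  by move=> n; move/cauchyP: Fc; apply; rewrite ofR_gt0 half_gt0.
have bE n y : ball (x n) (ofR (2^-1 ^+ n.+2)) y -> rnorm (x n - y) < 2^-1 ^+ n.+2.
  by rewrite ballE ?ofRK// ofR_gt0 half_gt0.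
have xf : fast x.
  move=> n; have [y [/bE h1 /bE h2]] := filter_ex (filterI (xP n) (xP n.+1)).
  apply: le_trans (rnorm_triangle y _ _) _; rewrite [rnorm (y - _)]rnormBC.
  have := @half_gt0 R n.+3; have := @halfS R n; have := @halfS R n.+1.
  have := @halfS R n.+2; lra.
have [l lP] := h x xf.
apply/cvg_ex; exists l; apply/cvg_ballP => e e0.
have [n nP] := half_small 3 (re_gt0 e0).
apply: filterS (xP n) => y /bE; rewrite ballE// => yn.
apply: le_lt_trans (rnorm_triangle (x n) _ _) _.
rewrite rnormBC; have := lP n; have := @half_gt0 R n.+2.
have := @halfS R n; have := @halfS R n.+1; lra.
Qed.

(** The sequence can be followed arbitrarily far, so any constant [C] improves to [2]; candidate
    limits may thus be found with crude bounds. *)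
Lemma fast_limit (X : normedModType K) (u : nat -> X) (l : X) (C : R) : fast u ->
  (forall n, rnorm (u n - l) <= C * 2^-1 ^+ n) ->
  forall n, rnorm (u n - l) <= 2 * 2^-1 ^+ n.
Proof.
move=> uf h n; apply/ler_addgt0Pl => e e0.
have [N NP] := half_small `|C| e0.
apply: le_trans (rnorm_triangle (u (maxn N n)) _ _) _.
have := fast_dist uf (leq_maxr N n); rewrite rnormBC.
have : rnorm (u (maxn N n) - l) <= e; last lra.
apply: le_trans (h _) (le_trans _ (ltW NP)).
apply: (le_trans (ler_wpM2r (ltW (half_gt0 _)) (ler_norm C))).
by rewrite ler_wpM2l// half_le// leq_maxl.
Qed.

Definition adherent (X : normedModType K) (A : X -> Prop) (x : X) : Prop :=
  forall e : R, 0 < e -> exists2 a, A a & rnorm (x - a) < e.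

Lemma banach_embed (X Y : normedModType K) (f : X -> Y) :
  (forall x y, rnorm (f x - f y) = rnorm (x - y)) ->
  (forall y, adherent (range f) y -> range f y) -> banach Y -> banach X.
Proof.
move=> fd fc /banachP Yb; apply/banachP => u uf.
have [|l lP] := Yb (f \o u); first by move=> n; rewrite /= fd.
have [x _ xl] : range f l.
  apply: fc => e e0; have [n nP] := half_small 2 e0.
  by exists (f (u n)); [exists (u n)|rewrite rnormBC; apply: le_lt_trans (lP n) nP].
by exists x => n; rewrite -fd xl; exact: lP.
Qed.

Lemma adherent_range (X Y : normedModType K) (f : X -> Y) : banach X ->
  (forall x y, rnorm (f x - f y) = rnorm (x - y)) ->
  forall y, adherent (range f) y -> range f y.
Proof.
move=> /banachP Xb fd y yP.
have /choice[u uP] : forall n, exists x, rnorm (y - f x) < 2^-1 ^+ n.+1.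
  by move=> n; have [_ [x _ <-] h] := yP _ (@half_gt0 R n.+1); exists x.
have uf : fast u.
  move=> n; rewrite -fd; apply: le_trans (rnorm_triangle y _ _) _.
  rewrite rnormBC; have := uP n; have := uP n.+1.
  have := @halfS R n.+1; have := @halfS R n; have := @half_gt0 R n.+2; lra.
have [l lP] := Xb u uf; exists l => //; apply/subr0_eq/rnorm0_eq0.
apply/le_anti; rewrite rnorm_ge0 andbT; apply/ler_addgt0Pl => e e0; rewrite addr0.
have [n nP] := half_small 3 e0.
apply: le_trans (rnorm_triangle (f (u n)) _ _) _.
rewrite fd [rnorm (l - _)]rnormBC [rnorm (_ - y)]rnormBC.
have := lP n; have := uP n; have := @half_gt0 R n.+1; have := @halfS R n; lra.
Qed.

Lemma isometric_banach (X Y : normedModType K) : isometric X Y -> banach Y -> banach X.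
Proof.
move=> /isometricP[f [fi fs]]; apply: banach_embed; first exact: lin_isometry_dist fi.
by move=> y _; have [x <-] := fs y; exists x.
Qed.

Lemma denseP (X : normedModType K) (D : set X) : dense D <-> forall x, adherent D x.
Proof.
split=> [dD x e e0|h O [x Ox] Oo].
  have e0' : 0 < (ofR e : K) by rewrite ofR_gt0.
  have [||y [yb yD]] := dD (ball x (ofR e))°.
  - by exists x; apply: nbhsx_ballx.
  - exact: open_interior.
  by exists y => //; have := interior_subset yb; rewrite ballE// ofRK.
have /nbhs_ballP[e /= e0 eO] : nbhs x O by apply: open_nbhs_nbhs.
have [y yD xy] := h x _ (re_gt0 e0).
by exists y; split=> //; apply: eO; rewrite ballE.
Qed.

End Banach.

(** * Ultrapowers and Luxemburg norms *)

Section Ultra.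
Context {R : realType} {k : scalar_kind}.
Local Notation K := (scalar_field R k).

Section OneUltrapower.
Variables (X : normedModType K) (I : Type) (U : ultrafilter I).
Implicit Types (x y : linf X I) (z : ultrapower X U).

Lemma bounded_familyP (f : I -> X) :
  (exists M : R, forall i, rnorm (f i) <= M) -> f \in @bounded_family R k X I.
Proof. by move=> h; apply/asboolP. Qed.

Definition mklinf (f : I -> X) (h : exists M : R, forall i, rnorm (f i) <= M) :
  linf X I := Linf (bounded_familyP h).

Lemma ultra_near_lt x c : ultra_norm U x < c ->
  \forall i \near ultra_sets U, rnorm (x i) < c.
Proof. by move=> xc; apply: cvgr_lt (@ultra_norm_cvg _ _ _ _ U x) _ xc. Qed.

Lemma ultra_near_gt x c : c < ultra_norm U x ->
  \forall i \near ultra_sets U, c < rnorm (x i).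
Proof. by move=> xc; apply: cvgr_gt (@ultra_norm_cvg _ _ _ _ U x) _ xc. Qed.

Lemma ultra_norm_le x c : (\forall i \near ultra_sets U, rnorm (x i) <= c) ->
  ultra_norm U x <= c.
Proof.
move=> xc; rewrite leNgt; apply/negP => /ultra_near_gt h.
by have [i [/le_lt_trans/[apply]]] := filter_ex (filterI xc h); rewrite ltxx.
Qed.

Lemma ultra_norm_ge x c : (\forall i \near ultra_sets U, c <= rnorm (x i)) ->
  c <= ultra_norm U x.
Proof.
move=> xc; rewrite leNgt; apply/negP => /ultra_near_lt h.
by have [i [/le_lt_trans/[apply]]] := filter_ex (filterI xc h); rewrite ltxx.
Qed.

Lemma ultra_class_near x y : (\forall i \near ultra_sets U, x i = y i) ->
  ultra_class U x = ultra_class U y.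
Proof.
move=> xy; apply/ultra_class_eqP/le_anti; rewrite ultra_norm_ge0 andbT.
apply: ultra_norm_le; apply: filterS xy => i e.
by rewrite (_ : (x - y) i = x i - y i)// e subrr rnorm0.
Qed.

Lemma ultra_classP z : exists x, z = ultra_class U x.
Proof. by exists (ultra_repr z); rewrite ultra_reprK. Qed.

Lemma ultra_classB x y : ultra_class U (x - y) = ultra_class U x - ultra_class U y.
Proof.
by apply/eqP; rewrite eq_sym subr_eq -ultra_classD subrK.
Qed.

Lemma ultra_classZE a x : a *: ultra_class U x = ultra_class U (a *: x).
Proof. by rewrite ultra_classZ. Qed.

Lemma const_bounded (v : X) : exists M : R, forall i : I, rnorm ((fun=> v) i) <= M.
Proof. by exists (rnorm v). Qed.

Definition diag (v : X) : ultrapower X U :=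
  ultra_class U (mklinf (const_bounded v)).

Lemma diag_isometry : lin_isometry diag.
Proof.
split=> [a v w|v].
  by rewrite /diag ultra_classZE -ultra_classD; apply: ultra_class_near; apply: nearW.
rewrite /diag ultra_class_rnormE; apply/le_anti/andP; split.
  by apply: ultra_norm_le; apply: nearW => i /=.
by apply: ultra_norm_ge; apply: nearW => i /=.
Qed.

Lemma diag_dist x v c : rnorm (ultra_class U x - diag v) < c ->
  \forall i \near ultra_sets U, rnorm (x i - v) < c.
Proof. by rewrite -ultra_classB ultra_class_rnormE => /ultra_near_lt. Qed.

(** Each difference is lifted to a family bounded by [2 * 2^-1 ^+ n] at every coordinate, by
    replacing coordinates that are too large with [0]. The lifts are summed coordinatewise, and the
    coordinates converge uniformly. *)
Lemma banach_ultrapower : banach X -> banach (ultrapower X U).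
Proof.
move=> /banachP Xb; apply/banachP => u uf.
have /choice[y yP] : forall n, exists y : linf X I,
    ultra_class U y = u n.+1 - u n /\ forall i, rnorm (y i) <= 2 * 2^-1 ^+ n.
  move=> n; have := uf n; rewrite -[u n.+1 - u n]ultra_reprK ultra_class_rnormE.
  move: (ultra_repr _) => x xn.
  have h i : rnorm (if rnorm (x i) <= 2 * 2^-1 ^+ n then x i else 0) <= 2 * 2^-1 ^+ n.
    by case: ifP => // _; rewrite rnorm0 mulr_ge0// ltW// half_gt0.
  exists (mklinf (ex_intro _ _ h)); split=> //; apply: ultra_class_near.
  have : ultra_norm U x < 2 * 2^-1 ^+ n.
    by apply: le_lt_trans xn _; have := @half_gt0 R n; lra.
  by move=> /ultra_near_lt; apply: filterS => i /ltW /= ->.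
pose s := fix s n := if n is m.+1 then s m + y m else ultra_repr (u 0%N).
have sE n : ultra_class U (s n) = u n.
  elim: n => [|n IH] /=; first exact: ultra_reprK.
  by rewrite ultra_classD IH (yP n).1 subrKC.
(* The steps of [s] are bounded by [2 * 2^-1 ^+ n]; starting at index [1] absorbs the factor [2]. *)
have /choice[l lP] : forall i, exists l : X,
    forall n, rnorm (s n.+1 i - l) <= 2 * 2^-1 ^+ n.
  move=> i; apply: (Xb (fun n => s n.+1 i)) => n.
  rewrite (_ : _ - _ = y n.+1 i); first by rewrite halfS; exact: (yP n.+1).2.
  by rewrite (_ : s n.+2 i = s n.+1 i + y n.+1 i)// addrC addKr.
have lb : exists M : R, forall i, rnorm (l i) <= M.
  have [M MP] := linf_bounded (s 1%N); exists (M + 2) => i.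
  apply: le_trans (rnormB_le _ (s 1%N i)) _; rewrite rnormBC.
  by have := MP i; have := lP i 0%N; rewrite expr0; lra.
exists (ultra_class U (mklinf lb)); apply: (@fast_limit _ _ _ _ _ 3) => // n.
apply: le_trans (rnorm_triangle (u n.+1) _ _) _.
have : rnorm (u n.+1 - ultra_class U (mklinf lb)) <= 2 * 2^-1 ^+ n.
  rewrite -sE -ultra_classB ultra_class_rnormE; apply: ultra_norm_le.
  by apply: nearW => i; apply: lP.
have := uf n; rewrite rnormBC; lra.
Qed.

End OneUltrapower.

Definition contraction (X Y : normedModType K) (f : X -> Y) : Prop :=
  linear f /\ forall x, rnorm (f x) <= rnorm x.

Lemma lin_isometry_contraction (X Y : normedModType K) (f : X -> Y) :
  lin_isometry f -> contraction f.
Proof. by move=> [fl fn]; split=> // x; rewrite fn. Qed.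

Section UltraMap.
Variables (X Y : normedModType K) (f : X -> Y) (fc : contraction f).
Variables (I : Type) (U : ultrafilter I).

Let f_bounded (x : linf X I) : exists M : R, forall i, rnorm (f (x i)) <= M.
Proof. by have [M MP] := linf_bounded x; exists M => i; apply: le_trans (fc.2 _) (MP i). Qed.

Definition ultra_map (z : ultrapower X U) : ultrapower Y U :=
  ultra_class U (mklinf (f_bounded (ultra_repr z))).

Lemma ultra_map_class (x : linf X I) (fx : linf Y I) : (forall i, fx i = f (x i)) ->
  ultra_map (ultra_class U x) = ultra_class U fx.
Proof.
move=> fxE; apply/ultra_class_eqP/le_anti; rewrite ultra_norm_ge0 andbT.
have : ultra_norm U (ultra_repr (ultra_class U x) - x) = 0.
  by apply/ultra_class_eqP; rewrite ultra_reprK.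
move=> e; apply/ler_addgt0Pl => d d0; rewrite addr0.
apply: ultra_norm_le.
have : ultra_norm U (ultra_repr (ultra_class U x) - x) < d by rewrite e.
move=> /ultra_near_lt; apply: filterS => i /ltW; apply: le_trans.
rewrite (_ : _ i = f (ultra_repr (ultra_class U x) i) - fx i)// fxE.
by rewrite -!(mklinE fc.1) -linearB; exact: fc.2.
Qed.

Lemma ultra_mapE (x : linf X I) :
  ultra_map (ultra_class U x) = ultra_class U (mklinf (f_bounded x)).
Proof. exact: ultra_map_class. Qed.

Lemma ultra_map_linear : linear ultra_map.
Proof.
move=> a z w; have [[x ->] [y ->]] := (ultra_classP z, ultra_classP w).
rewrite ultra_classZE -ultra_classD !ultra_mapE ultra_classZE -ultra_classD.
by apply: ultra_class_near; apply: nearW => i; exact: fc.1.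
Qed.

Lemma ultra_map_isometry : (forall x, rnorm (f x) = rnorm x) -> lin_isometry ultra_map.
Proof.
move=> fn; split=> [|z]; first exact: ultra_map_linear.
have [x ->] := ultra_classP z.
rewrite ultra_mapE !ultra_class_rnormE; apply/le_anti/andP; split.
  apply/ler_addgt0Pl => d d0; apply: ultra_norm_le.
  have : ultra_norm U x < d + ultra_norm U x by rewrite ltrDr.
  by move=> /ultra_near_lt; apply: filterS => i /ltW; rewrite -fn.
apply/ler_addgt0Pl => d d0.
have : ultra_norm U (mklinf (f_bounded x)) < d + ultra_norm U (mklinf (f_bounded x)).
  by rewrite ltrDr.
by move=> /ultra_near_lt h; apply: ultra_norm_le; apply: filterS h => i /ltW /=; rewrite fn.
Qed.

Lemma ultra_map_surj : (forall x, rnorm (f x) = rnorm x) ->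
  (forall y, exists x, f x = y) -> forall z, exists w, ultra_map w = z.
Proof.
move=> fn /choice[g gP] z; have [y ->] := ultra_classP z.
have gb : exists M : R, forall i, rnorm (g (y i)) <= M.
  by have [M MP] := linf_bounded y; exists M => i; rewrite -fn gP.
exists (ultra_class U (mklinf gb)); apply: ultra_map_class => i /=.
by rewrite gP.
Qed.

End UltraMap.

Lemma isometric_ultrapower (X Y : normedModType K) (I : Type) (U : ultrafilter I) :
  isometric X Y -> isometric (ultrapower X U) (ultrapower Y U).
Proof.
move=> /isometricP[f [fi fs]]; apply/isometricP; exists (ultra_map (lin_isometry_contraction fi) (U := U)).
by split; [exact: ultra_map_isometry fi.2|exact: ultra_map_surj fi.2 fs].
Qed.

End Ultra.

Section Luxemburg.
Context {R : realType} {k : scalar_kind}.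
Local Notation K := (scalar_field R k).

(** Stated for bare functions so that it applies to [ultra_modular], which is not packaged as a
    [modular]. *)
Lemma luxemburg_morph (V1 V2 : lmodType K) (Th1 : V1 -> R) (Th2 : V2 -> R)
    (T : V1 -> V2) : (forall a x, T (a *: x) = a *: T x) ->
  (forall x, Th2 (T x) = Th1 x) ->
  forall x, luxemburg Th2 (T x) = luxemburg Th1 x.
Proof.
move=> Tl Tm x; congr inf; apply/seteqP.
by split=> l [l0 h]; split=> //; move: h; rewrite -Tl Tm.
Qed.

Lemma isomodular_isometric (V1 V2 : lmodType K) (Th1 : modular V1) (Th2 : modular V2) :
  isomodular Th1 Th2 -> isometric (modspace Th1) (modspace Th2).
Proof.
move=> [T [Tm Tr]]; exists T; split=> //; apply/isometryP => x.
rewrite !modspace_rnormE; apply: luxemburg_morph => // a y; exact: linearZ.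
Qed.

Lemma isomodularP (V1 V2 : lmodType K) (Th1 : V1 -> R) (Th2 : V2 -> R) :
  isomodular Th1 Th2 <-> exists f : V1 -> V2,
    [/\ linear f, forall x, Th2 (f x) = Th1 x & forall y, exists x, f x = y].
Proof.
split=> [[T [Tm Tr]]|[f [fl fm fs]]].
  exists T; split=> // [a x y|y]; first by rewrite linearP.
  by have [x _ <-] : range T y by [rewrite Tr]; exists x.
exists (mklin fl); split=> //; apply/seteqP; split=> // y _.
by have [x <-] := fs y; exists x.
Qed.

Section Modular.
Variables (V : lmodType K) (Th : modular V).

Lemma luxemburg_lt_le1 (x : V) (l : R) : 0 < l -> luxemburg Th x < l ->
  Th (ofR l^-1 *: x) <= 1.
Proof.
move=> l0 xl; have [m [m0 xm] ml] : exists2 m, luxemburg_set Th x m & m < l.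
  by apply: inf_lt => //; case: (luxemburg_has_inf Th x).
have -> : ofR l^-1 *: x = ofR (m / l) *: (ofR m^-1 *: x).
  by rewrite scalerA -ofRM mulrAC divff ?mul1r// gt_eqF.
have ml0 : 0 <= m / l by rewrite divr_ge0// ltW.
have ml1 : m / l <= 1 by rewrite ler_pdivrMr// mul1r ltW.
apply: le_trans (modular_shrink _ _ ml0 ml1) _.
by rewrite mulr_ile1// modular_ge0.
Qed.

Lemma luxemburg_gt_modular (x : V) (l : R) : 1 <= l -> l < luxemburg Th x -> l < Th x.
Proof.
move=> l1 lx; have l0 : 0 < l by apply: lt_le_trans l1.
rewrite ltNge; apply/negP => Thx; move: lx; rewrite ltNge => /negP; apply.
apply: luxemburg_le; split=> //.
apply: le_trans (modular_shrink _ _ _ _) _.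
- by rewrite invr_ge0 ltW.
- by rewrite invf_le1.
- by rewrite mulrC ler_pdivrMr// mul1r.
Qed.

Lemma ultra_modular_lim (I : Type) (U : ultrafilter I) (x : linf (modspace Th) I) :
  Delta2 Th -> Th (x i) @[i --> ultra_sets U] --> ultra_modular Th U (ultra_class U x).
Proof.
move=> D2; rewrite ultra_modularE//.
have [C CP] := D2; have C1 : 1 <= Num.max C 1 by rewrite le_max lexx orbT.
apply: (@ultra_modular_cvg _ _ _ Th I U (Num.max C 1) C1) => y.
by apply: le_trans (CP y) _; rewrite ler_wpM2r ?modular_ge0// le_max lexx.
Qed.

(** If [l] exceeds the ultrapower norm, then [Th (x i / l) <= 1] for almost all [i], and this closed
    condition passes to the limit. If [l] is smaller, convexity keeps [Th (x i / l)] above a fixed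
    [r > 1] for almost all [i]. *)
Lemma luxemburg_ultra (I : Type) (U : ultrafilter I) (z : ultrapower (modspace Th) U) :
  Delta2 Th -> luxemburg (ultra_modular Th U) z = rnorm z.
Proof.
move=> D2; have [x ->] := ultra_classP z; rewrite ultra_class_rnormE.
pose M (l : R) := ultra_modular Th U (ofR l^-1 *: ultra_class U x).
have ME l : Th (ofR l^-1 *: x i) @[i --> ultra_sets U] --> M l.
  by rewrite /M ultra_classZE; apply: ultra_modular_lim.
have Lset l : ultra_norm U x < l -> luxemburg_set (ultra_modular Th U) (ultra_class U x) l.
  move=> xl; have l0 : 0 < l by apply: le_lt_trans xl; exact: ultra_norm_ge0.
  split=> //; rewrite -/(M l) leNgt; apply/negP => /(cvgr_gt _ (ME l)) h.
  have [i [h1 h2]] := filter_ex (filterI h (ultra_near_lt xl)).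
  rewrite modspace_rnormE in h2.
  by have := luxemburg_lt_le1 l0 h2; rewrite leNgt h1.
have lb : has_lbound (luxemburg_set (ultra_modular Th U) (ultra_class U x)).
  by exists 0 => l [/ltW].
apply/le_anti/andP; split.
  by apply/ler_addgt0Pl => e e0; apply: ge_inf => //; apply: Lset; rewrite ltrDr.
apply: lb_le_inf; first by exists (1 + ultra_norm U x); apply: Lset; rewrite ltrDr.
move=> l [l0]; rewrite -/(M l) => Ml; rewrite leNgt; apply/negP => lx.
pose r := (1 + ultra_norm U x / l) / 2.
have q1 : 1 < ultra_norm U x / l by rewrite ltr_pdivlMr// mul1r.
have r1 : 1 < r by rewrite /r; lra.
have rl : r * l < ultra_norm U x by rewrite -ltr_pdivlMr// /r; lra.
have : \forall i \near ultra_sets U, r < Th (ofR l^-1 *: x i).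
  apply: filterS (ultra_near_gt rl) => i h; apply: luxemburg_gt_modular (ltW r1) _.
  rewrite luxemburgZ rnorm_ofR ger0_norm ?invr_ge0 ?(ltW l0)// mulrC.
  by rewrite ltr_pdivlMr// -modspace_rnormE.
move=> h; have rM : M l < r by apply: le_lt_trans r1.
have [i [h1 h2]] := filter_ex (filterI h (cvgr_lt _ (ME l) _ rM)).
by have := lt_trans h1 h2; rewrite ltxx.
Qed.

(** Homogeneity turns [Th (x / l) <= 1] into [Th x <= l ^ 2], so the infimum is a square root. *)
Lemma luxemburg_quadratic (x : V) : (forall (a : R) y, Th (ofR a *: y) = a ^+ 2 * Th y) ->
  luxemburg Th x ^+ 2 = Th x.
Proof.
move=> q; have s0 := sqrtr_ge0 (Th x).
rewrite -[RHS]sqr_sqrtr ?modular_ge0//; congr (_ ^+ 2); apply/le_anti/andP; split.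
  apply/ler_addgt0Pl => e e0; have l0 : 0 < e + Num.sqrt (Th x) by rewrite ltr_pwDl.
  apply: luxemburg_le; split=> //; rewrite q exprVn mulrC ler_pdivrMr ?exprn_gt0//.
  rewrite mul1r -[leLHS]sqr_sqrtr ?modular_ge0// ler_sqr ?nnegrE// ?lerDr ltW//.
apply: lb_le_inf; first by case: (luxemburg_has_inf Th x).
move=> l [l0]; rewrite q exprVn mulrC ler_pdivrMr ?exprn_gt0// mul1r.
by rewrite -[leLHS]sqr_sqrtr ?modular_ge0// ler_sqr ?nnegrE// ltW.
Qed.

End Modular.

Lemma isomodular_ultra_isometric (V V' : lmodType K) (Th : modular V) (Th' : modular V')
    (I : Type) (U : ultrafilter I) : Delta2 Th ->
  isomodular (ultra_modular Th U) Th' ->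
  isometric (ultrapower (modspace Th) U) (modspace Th').
Proof.
move=> D2 [T [Tm Tr]]; exists T; split=> //; apply/isometryP => x.
rewrite modspace_rnormE -(luxemburg_ultra _ D2).
by apply: luxemburg_morph => // a y; exact: linearZ.
Qed.

Lemma luxemburg_sqnorm (H : normedModType K) (h : H) : luxemburg (sqnorm H) h = rnorm h.
Proof.
apply/eqP; rewrite -(@eqrXn2 _ 2)//; [|exact: luxemburg_ge0|exact: rnorm_ge0].
rewrite luxemburg_quadratic// => a y /=.
by rewrite rnormZ rnorm_ofR exprMn real_normK// num_real.
Qed.

Lemma Delta2_sqnorm (H : normedModType K) : Delta2 (sqnorm H).
Proof.
exists 4 => h /=; rewrite rnormZ exprMn.
have -> : rnorm (2 : K) = 2 by exact: rnorm_nat.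
by rewrite (_ : 2 ^+ 2 = 4 :> R)// -natrX.
Qed.

Section Sum.
Variables (V1 V2 : lmodType K) (Th1 : modular V1) (Th2 : modular V2).
Local Notation M := (modspace (msum Th1 Th2)).

Lemma Delta2_msum : Delta2 Th1 -> Delta2 Th2 -> Delta2 (msum Th1 Th2).
Proof.
move=> [C1 h1] [C2 h2]; exists (Num.max C1 C2) => -[x y] /=.
rewrite mulrDr lerD//.
  by apply: le_trans (h1 x) _; rewrite ler_wpM2r ?modular_ge0// le_max lexx.
by apply: le_trans (h2 y) _; rewrite ler_wpM2r ?modular_ge0// le_max lexx orbT.
Qed.

Lemma msum_norm_inl (x : V1) : rnorm ((x, 0) : M) = luxemburg Th1 x.
Proof.
rewrite modspace_rnormE; apply: (luxemburg_morph (T := fun x => (x, 0) : V1 * V2)).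
  by move=> a y; rewrite [RHS]surjective_pairing /= scaler0.
by move=> y /=; rewrite modular0 addr0.
Qed.

Lemma msum_norm_inr (y : V2) : rnorm ((0, y) : M) = luxemburg Th2 y.
Proof.
rewrite modspace_rnormE; apply: (luxemburg_morph (T := fun y => (0, y) : V1 * V2)).
  by move=> a z; rewrite [RHS]surjective_pairing /= scaler0.
by move=> z /=; rewrite modular0 add0r.
Qed.

Lemma msum_norm_ge1 (z : M) : luxemburg Th1 z.1 <= rnorm z.
Proof.
rewrite modspace_rnormE; apply: lb_le_inf; first by case: (luxemburg_has_inf (msum Th1 Th2) z).
move=> l [l0 /= h]; apply: luxemburg_le; split=> //.
by apply: le_trans h; rewrite lerDl modular_ge0.
Qed.

Lemma msum_norm_ge2 (z : M) : luxemburg Th2 z.2 <= rnorm z.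
Proof.
rewrite modspace_rnormE; apply: lb_le_inf; first by case: (luxemburg_has_inf (msum Th1 Th2) z).
move=> l [l0 /= h]; apply: luxemburg_le; split=> //.
by apply: le_trans h; rewrite lerDr modular_ge0.
Qed.

Lemma msum_norm_le (z : M) : rnorm z <= luxemburg Th1 z.1 + luxemburg Th2 z.2.
Proof.
rewrite -msum_norm_inl -msum_norm_inr; apply: le_trans (rnormD _ _).
by rewrite (_ : _ + _ = z)// [LHS]surjective_pairing /= addr0 add0r -surjective_pairing.
Qed.

Lemma banach_msum : banach (modspace Th1) -> banach (modspace Th2) -> banach M.
Proof.
move=> /banachP b1 /banachP b2; apply/banachP => u uf.
have [|l1 l1P] := b1 (fun n => (u n).1 : modspace Th1).
  move=> n; rewrite modspace_rnormE; apply: le_trans (uf n).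
  exact: (msum_norm_ge1 (u n.+1 - u n)).
have [|l2 l2P] := b2 (fun n => (u n).2 : modspace Th2).
  move=> n; rewrite modspace_rnormE; apply: le_trans (uf n).
  exact: (msum_norm_ge2 (u n.+1 - u n)).
exists ((l1, l2) : M); apply: (@fast_limit _ _ _ _ _ 4) => // n.
apply: le_trans (msum_norm_le _) _.
have := l1P n; have := l2P n; rewrite !modspace_rnormE /=; lra.
Qed.

End Sum.

Lemma modspace_sqnorm_isometric (H : normedModType K) : isometric (modspace (sqnorm H)) H.
Proof.
apply/isometricP; exists id; split; last by move=> y; exists y.
by split=> // x; rewrite modspace_rnormE luxemburg_sqnorm.
Qed.

Lemma banach_sum_hilbert (V : lmodType K) (E : modular V) (H : normedModType K) :
  banach (modspace E) -> banach H -> banach (modspace (msum E (sqnorm H))).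
Proof.
move=> Eb Hb; apply: banach_msum => //.
exact: isometric_banach (modspace_sqnorm_isometric H) Hb.
Qed.

End Luxemburg.

(** * The Jordan-von Neumann theorem *)

Section ComplexParts.
Context {R : realType} {k : scalar_kind}.
Local Notation K := (scalar_field R k).

(* [iK] is [0] over the reals, so that [z = re z + iK * imK z] over both fields. *)
Definition iK : K :=
  match k return scalar_field R k with
  | RealScalars => 0 | ComplexScalars => Complex 0 1 end.

Definition imK : K -> R :=
  match k return scalar_field R k -> R with
  | RealScalars => fun=> 0 | ComplexScalars => @complex.Im R end.

Lemma ofRN (x : R) : ofR (- x) = - ofR x :> K.
Proof. by apply/eqP; rewrite -subr_eq0 opprK -ofRD addNr ofR0. Qed.

Lemma re_imK (z : K) : z = ofR (re z) + iK * ofR (imK z).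
Proof.
rewrite /ofR /re /iK /imK; case: k z => /= z; first by rewrite mul0r addr0.
by case: z => a b; apply/eqP; rewrite eq_complex /=; apply/andP; split; apply/eqP; ring.
Qed.

Lemma re_additive (x y : K) : re (x + y) = re x + re y.
Proof. by rewrite /re; case: k x y => //= x y; exact: raddfD. Qed.

Lemma conjK_ofRi (a b : R) : conjK (ofR a + iK * ofR b : K) = ofR a - iK * ofR b.
Proof.
rewrite /ofR /iK /conjK; case: k => /=; first by rewrite !mul0r addr0 subr0.
by apply/eqP; rewrite eq_complex /=; apply/andP; split; apply/eqP; ring.
Qed.

Lemma iKP : (iK = 0 /\ (forall z : K, imK z = 0)) \/ iK * iK = -1.
Proof.
rewrite /iK /imK; case: k => /=; [by left|right].
by apply/eqP; rewrite eq_complex /=; apply/andP; split; apply/eqP; ring.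
Qed.

Lemma conjKD (x y : K) : conjK (x + y) = conjK x + conjK y.
Proof. by rewrite /conjK; case: k x y => //= x y; exact: raddfD. Qed.

Lemma conjKM (x y : K) : conjK (x * y) = conjK x * conjK y.
Proof. by rewrite /conjK; case: k x y => //= x y; exact: rmorphM. Qed.

Lemma conjK0 : conjK (0 : K) = 0.
Proof. by rewrite /conjK; case: k => //=; exact: conjc0. Qed.

Lemma conjK1 : conjK (1 : K) = 1.
Proof. by rewrite /conjK; case: k => //=; exact: conjc1. Qed.

Lemma mul_conjK (z : K) : z * conjK z = `|z| ^+ 2.
Proof.
rewrite /conjK; case: k z => /= z.
  by rewrite -expr2 real_normK// num_real.
case: z => a b; rewrite normc_def /= -rmorphXn /= sqr_sqrtr ?addr_ge0 ?sqr_ge0//.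
by apply/eqP; rewrite eq_complex /=; apply/andP; split; apply/eqP; ring.
Qed.

End ComplexParts.
Arguments iK {R k}.

Section JordanVonNeumann.
Context {R : realType} {k : scalar_kind}.
Local Notation K := (scalar_field R k).

(** Hilbert spaces are handled through this law, which mentions the norm alone and so passes easily
    to subspaces, sums and ultrapowers; [hilbertP] recovers the inner product. *)
Definition parallelogram (X : normedModType K) : Prop := forall x y : X,
  rnorm (x + y) ^+ 2 + rnorm (x - y) ^+ 2 = 2 * (rnorm x ^+ 2 + rnorm y ^+ 2).

Variable X : normedModType K.
Implicit Types x y z : X.

Definition polar x y : R := (rnorm (x + y) ^+ 2 - rnorm (x - y) ^+ 2) / 4.

Lemma polarC x y : polar x y = polar y x.
Proof. by rewrite /polar [x + y]addrC rnormBC. Qed.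

Lemma polarZ (a : K) x y : polar (a *: x) (a *: y) = rnorm a ^+ 2 * polar x y.
Proof. by rewrite /polar -scalerDr -scalerBr !rnormZ !exprMn -mulrBr mulrA. Qed.

Lemma polarN x y : polar (- x) y = - polar x y.
Proof.
have e1 : rnorm (- x + y) = rnorm (x - y) by rewrite -rnormN opprD opprK.
have e2 : rnorm (- x - y) = rnorm (x + y) by rewrite -rnormN opprB opprK addrC.
by rewrite /polar e1 e2; lra.
Qed.

Lemma polar0 y : polar 0 y = 0.
Proof. by rewrite /polar add0r sub0r rnormN subrr mul0r. Qed.

Lemma polarxx x : polar x x = rnorm x ^+ 2.
Proof.
rewrite /polar subrr rnorm0 -mulr2n -scaler_nat rnormZ (rnorm_nat 2) exprMn.
by rewrite expr0n /= subr0 (_ : 2 ^+ 2 = 4 :> R) -?natrX// mulrC mulKf// pnatr_eq0.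
Qed.

Hypothesis PL : parallelogram X.

Lemma polarD x x' y : polar (x + x') y = polar x y + polar x' y.
Proof.
have h u u' : polar u y + polar u' y = 2^-1 * polar (u + u') (y + y).
  have := PL (u + y) (u' + y); have := PL (u - y) (u' - y).
  rewrite [u + y + _]addrACA [u - y + _]addrACA -opprD.
  have -> : u + y - (u' + y) = u - u' by rewrite opprD addrACA subrr addr0.
  have -> : u - y - (u' - y) = u - u' by rewrite opprB addrA subrK.
  by rewrite /polar; lra.
(* The case [u' = 0] of [h] identifies its right-hand side with [polar (x + x') y]. *)
have h0 := h (x + x') 0; rewrite polar0 !addr0 in h0.
by rewrite h0 -h.
Qed.

Let g x y t := polar (ofR t *: x) y - t * polar x y.

Let gD x y s t : g x y (s + t) = g x y s + g x y t.
Proof. by rewrite /g ofRD scalerDl polarD; ring. Qed.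

(* [g] is additive and [g 1 = 0], so doubling modulo [1] halves its bound on [0, 1]. *)
Let g01 x y n t : 0 <= t -> t <= 1 ->
  `|g x y t| <= ((rnorm x + rnorm y) ^+ 2 + `|polar x y|) * 2^-1 ^+ n.
Proof.
elim: n t => [|n IH] t t0 t1.
  rewrite expr0 mulr1 /g; apply: le_trans (ler_normB _ _) _; apply: lerD; last first.
    by rewrite normrM ger0_norm// ler_piMl.
  have b z : rnorm z <= rnorm x + rnorm y -> rnorm z ^+ 2 <= (rnorm x + rnorm y) ^+ 2.
    by move=> zxy; rewrite ler_sqr ?nnegrE ?rnorm_ge0// addr_ge0 ?rnorm_ge0.
  have tx : rnorm (ofR t *: x) <= rnorm x.
    by rewrite rnormZ rnorm_ofR ger0_norm// ler_piMl// rnorm_ge0.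
  have := b (ofR t *: x + y) (le_trans (rnormD _ _) (lerD tx (lexx _))).
  have h2 : rnorm (ofR t *: x - y) <= rnorm x + rnorm y.
    by apply: le_trans (rnormD _ _) _; rewrite rnormN lerD.
  have := b _ h2.
  have := sqr_ge0 (rnorm (ofR t *: x + y)); have := sqr_ge0 (rnorm (ofR t *: x - y)).
  rewrite /polar ler_norml; move: (_ ^+ 2) (_ ^+ 2) (_ ^+ 2) => a c d *.
  by apply/andP; split; lra.
have g1 : g x y 1 = 0 by rewrite /g ofR1 scale1r mul1r subrr.
have dbl s : 0 <= s -> s <= 1 -> g x y s = 2 * g x y t ->
    `|g x y t| <= ((rnorm x + rnorm y) ^+ 2 + `|polar x y|) * 2^-1 ^+ n.+1.
  move=> s0 s1 e; have := IH s s0 s1.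
  rewrite e normrM [`|2|]ger0_norm// halfS mulrCA; lra.
have [tle|tgt] := leP t 2^-1.
  by apply: (dbl (t + t)); rewrite ?gD; lra.
apply: (dbl (t + t - 1)); [lra|lra|].
by have := gD x y (t + t - 1) 1; rewrite g1 addr0 subrK gD => <-; lra.
Qed.

(** The defect [g] vanishes on [[0, 1]] by [g01]; additivity extends this to nonnegative reals by
    repeated halving, then to all reals because [g] is odd. *)
Lemma polarZl t x y : polar (ofR t *: x) y = t * polar x y.
Proof.
apply/subr0_eq; rewrite -/(g x y t).
have z s : 0 <= s -> s <= 1 -> g x y s = 0.
  move=> s0 s1; apply/normr0_eq0/le_anti; rewrite normr_ge0 andbT.
  apply/ler_addgt0Pl => e e0; rewrite addr0.
  have [n /ltW nP] := half_small ((rnorm x + rnorm y) ^+ 2 + `|polar x y|) e0.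
  exact: le_trans (g01 x y n s0 s1) nP.
have gN s : g x y (- s) = - g x y s.
  apply/eqP; rewrite -subr_eq0 opprK -gD addNr /g ofR0 scale0r polar0 mul0r subrr //.
have pos s : 0 <= s -> g x y s = 0.
  move=> s0; have [n nP] := half_small s ltr01.
  elim: n s s0 nP => [|n IH] s s0 nP.
    by apply: z => //; move: nP; rewrite expr0 mulr1 => /ltW.
  have -> : s = s / 2 + s / 2 by lra.
  rewrite gD IH ?addr0 ?divr_ge0// -mulrA -exprS //.
have [/pos//|/ltW t0] := leP 0 t.
by rewrite -[t]opprK gN pos ?oppr0// oppr_ge0.
Qed.

(** [polar] is the real part of the inner product. Over the reals [iK] is [0], which removes the
    second term. *)
Definition ip_of x y : K := ofR (polar x y) + iK * ofR (polar x (iK *: y)).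

Lemma polar_iK : iK * iK = -1 :> K -> forall x y, polar (iK *: x) y = - polar x (iK *: y).
Proof.
move=> i2 x y; have i1 : rnorm (iK : K) = 1.
  apply/eqP; rewrite -(@eqrXn2 _ 2)//; [|exact: rnorm_ge0].
  by rewrite expr2 -rnormM i2 rnormN (rnorm_nat 1) expr1n.
have := polarZ iK (iK *: x) y; rewrite scalerA i2 scaleN1r polarN i1 expr1n mul1r.
by move=> <-.
Qed.

Let ip_ofZ s t u y : ip_of (ofR s *: u + (iK * ofR t) *: u) y =
  (ofR s + iK * ofR t) * ip_of u y.
Proof.
rewrite /ip_of !polarD !polarZl -!scalerA.
have [[i0 _]|i2] := iKP (R := R) (k := k).
  by rewrite i0 !scale0r !mul0r !polar0 !addr0 ofRM.
rewrite (polar_iK i2 (ofR t *: u) y) (polarZ iK) !polarZl.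
have -> : rnorm (iK : K) = 1.
  apply/eqP; rewrite -(@eqrXn2 _ 2)//; [|exact: rnorm_ge0].
  by rewrite expr2 -rnormM i2 rnormN (rnorm_nat 1) expr1n.
rewrite expr1n mul1r -mulNr !ofRD !ofRM.
rewrite ofRN; ring: i2.
Qed.

Lemma ip_of_scalar y : scalar (ip_of ^~ y).
Proof.
move=> a u v; have e := ip_ofZ (re a) (imK a) u y.
rewrite -scalerDl -re_imK in e; rewrite /= -e /ip_of !polarD !ofRD; ring.
Qed.

Lemma ip_ofC x y : ip_of y x = conjK (ip_of x y).
Proof.
rewrite /ip_of conjK_ofRi (polarC y x).
have [[i0 _]|i2] := iKP (R := R) (k := k); first by rewrite i0 !mul0r addr0 subr0.
by rewrite (polarC y) (polar_iK i2) ofRN mulrN.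
Qed.

Lemma ip_ofxx x : ip_of x x = `|x| ^+ 2.
Proof.
rewrite /ip_of polarxx -rnormE [RHS]expr2 -ofRM -expr2.
have [[i0 _]|i2] := iKP (R := R) (k := k); first by rewrite i0 mul0r addr0.
have := polar_iK i2 x x; rewrite polarC => h.
have -> : polar x (iK *: x) = 0 by lra.
by rewrite ofR0 mulr0 addr0.
Qed.

End JordanVonNeumann.

Section HilbertCriterion.
Context {R : realType} {k : scalar_kind}.
Local Notation K := (scalar_field R k).

Lemma hilbertP (H : normedModType K) : hilbert H <-> banach H /\ parallelogram H.
Proof.
split=> [[Hb [ip [ipl ipc ipn]]]|[Hb PL]]; last first.
  split=> //; exists (@ip_of R k H); split.
  - exact: ip_of_scalar.
  - exact: ip_ofC.
  - exact: ip_ofxx.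
split=> // x y.
have ipD u v z : ip (u + v) z = ip u z + ip v z.
  by have := ipl z 1 u v; rewrite /= scale1r mul1r.
have ipN u z : ip (- u) z = - ip u z.
  have e := ipD u (- u) z; rewrite subrr in e.
  have e0 : ip 0 z = 0 by have := ipD 0 0 z; rewrite addr0 => /esym/eqP; rewrite -subr_eq0 addrK => /eqP.
  by apply/eqP; rewrite -addr_eq0 addrC -e e0.
have ipDr u v z : ip z (u + v) = ip z u + ip z v.
  by rewrite ipc ipD conjKD -!ipc.
have ipNr u z : ip z (- u) = - ip z u.
  apply/eqP; rewrite -addr_eq0 -ipDr addNr ipc.
  by have := ipN 0 z; rewrite oppr0 => /eqP; rewrite -addr_eq0 -mulr2n mulrn_eq0 /= => /eqP->; rewrite conjK0.
apply: (@ofR_inj R k).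
rewrite ofRM (ofR_nat 2) !ofRD !expr2 !ofRM !rnormE -!expr2 -!ipn.
by rewrite !(ipD, ipDr, ipN, ipNr); ring.
Qed.

Lemma parallelogram_embed (X Y : normedModType K) (f : X -> Y) :
  lin_isometry f -> parallelogram Y -> parallelogram X.
Proof.
move=> [fl fn] PL x y; have := PL (f x) (f y).
have fD u v : f (u + v) = f u + f v by rewrite -!(mklinE fl) linearD.
have fB u v : f (u - v) = f u - f v by rewrite -!(mklinE fl) linearB.
by rewrite -fD -fB !fn.
Qed.

Lemma hilbert_embed (X Y : normedModType K) (f : X -> Y) : lin_isometry f ->
  (forall y, adherent (range f) y -> range f y) -> hilbert Y -> hilbert X.
Proof.
move=> fi fc /hilbertP[Yb PL]; apply/hilbertP; split.
  exact: banach_embed (lin_isometry_dist fi) fc Yb.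
exact: parallelogram_embed fi PL.
Qed.

Lemma hilbert_ultrapower (H : normedModType K) (I : Type) (U : ultrafilter I) :
  hilbert H -> hilbert (ultrapower H U).
Proof.
move=> /hilbertP[Hb PL]; apply/hilbertP; split; first exact: banach_ultrapower.
move=> z w; have [[x ->] [y ->]] := (ultra_classP z, ultra_classP w).
rewrite -ultra_classB -ultra_classD !ultra_class_rnormE.
have sq (v : linf H I) : rnorm (v i) ^+ 2 @[i --> ultra_sets U] --> ultra_norm U v ^+ 2.
  by rewrite expr2; under eq_fun do rewrite expr2; apply: cvgM; exact: ultra_norm_cvg.
have h1 : rnorm ((x + y) i) ^+ 2 + rnorm ((x - y) i) ^+ 2 @[i --> ultra_sets U] -->
    ultra_norm U (x + y) ^+ 2 + ultra_norm U (x - y) ^+ 2.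
  by apply: cvgD; exact: sq.
have h2 : 2 * (rnorm (x i) ^+ 2 + rnorm (y i) ^+ 2) @[i --> ultra_sets U] -->
    2 * (ultra_norm U x ^+ 2 + ultra_norm U y ^+ 2).
  by apply: cvgM; [exact: cvg_cst|apply: cvgD; exact: sq].
have e : (fun i => rnorm ((x + y) i) ^+ 2 + rnorm ((x - y) i) ^+ 2) =
    (fun i => 2 * (rnorm (x i) ^+ 2 + rnorm (y i) ^+ 2)).
  by apply/funext => i; exact: PL.
by rewrite e in h1; exact: (cvg_unique (@Rhausdorff R) h1 h2).
Qed.

Lemma parallelogram_modspace (V : lmodType K) (q : modular V) :
  (forall (a : R) y, q (ofR a *: y) = a ^+ 2 * q y) ->
  (forall x y : V, q (x + y) + q (x - y) = 2 * (q x + q y)) ->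
  parallelogram (modspace q).
Proof.
by move=> qZ qP x y; rewrite !modspace_rnormE !luxemburg_quadratic.
Qed.

Definition hsum (H1 H2 : normedModType K) : normedModType K :=
  modspace (msum (sqnorm H1) (sqnorm H2)).

Lemma hsum_quadratic (H1 H2 : normedModType K) a z :
  msum (sqnorm H1) (sqnorm H2) (ofR a *: z) = a ^+ 2 * msum (sqnorm H1) (sqnorm H2) z.
Proof. by case: z => x y; rewrite /= !rnormZ !rnorm_ofR !exprMn mulrDr real_normK// num_real. Qed.

Lemma hsum_norm (H1 H2 : normedModType K) (z : hsum H1 H2) :
  rnorm z ^+ 2 = rnorm z.1 ^+ 2 + rnorm z.2 ^+ 2.
Proof. by rewrite modspace_rnormE luxemburg_quadratic//; exact: hsum_quadratic. Qed.

Lemma hilbert_sum (H1 H2 : normedModType K) : hilbert H1 -> hilbert H2 -> hilbert (hsum H1 H2).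
Proof.
move=> /hilbertP[b1 p1] /hilbertP[b2 p2]; apply/hilbertP; split.
  apply: banach_sum_hilbert => //.
  exact: isometric_banach (modspace_sqnorm_isometric H1) b1.
apply: parallelogram_modspace; first exact: hsum_quadratic.
by move=> [x1 x2] [y1 y2] /=; have := p1 x1 y1; have := p2 x2 y2; lra.
Qed.

End HilbertCriterion.

(** * Finite dimension and separated sequences *)

Section ScalarLimits.
Context {R : realType} {k : scalar_kind}.
Local Notation K := (scalar_field R k).

Lemma rnorm_re_im (z : K) : rnorm z ^+ 2 = re z ^+ 2 + imK z ^+ 2.
Proof.
rewrite /rnorm /re /imK; case: k z => /= z.
  by rewrite expr0n addr0 real_normK// num_real.
by case: z => a b; rewrite /= sqr_sqrtr// addr_ge0 ?sqr_ge0.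
Qed.

Lemma re_le_rnorm (z : K) : `|re z| <= rnorm z.
Proof.
rewrite -ler_sqr ?nnegrE ?rnorm_ge0// rnorm_re_im real_normK ?num_real//.
by rewrite lerDl sqr_ge0.
Qed.

Lemma im_le_rnorm (z : K) : `|imK z| <= rnorm z.
Proof.
rewrite -ler_sqr ?nnegrE ?rnorm_ge0// rnorm_re_im real_normK ?num_real//.
by rewrite lerDr sqr_ge0.
Qed.

Lemma rnorm_iK_le1 : rnorm (iK : K) <= 1.
Proof.
have [[-> _]|i2] := iKP (R := R) (k := k); first by rewrite rnorm0.
rewrite -ler_sqr ?nnegrE ?rnorm_ge0// expr2 -rnormM i2 rnormN (rnorm_nat 1).
by rewrite expr1n.
Qed.

Lemma re_imB (z w : K) : re (z - w) = re z - re w /\ imK (z - w) = imK z - imK w.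
Proof. by rewrite /re /imK; case: k z w => //= z w; rewrite ?subr0// !raddfB. Qed.

Lemma ultralimit_scalar (I : Type) (U : ultrafilter I) (c : I -> K) (M : R) :
  (forall i, rnorm (c i) <= M) ->
  exists l, forall e : R, 0 < e -> \forall i \near ultra_sets U, rnorm (c i - l) < e.
Proof.
move=> cM.
have /cvg_ex[a aP] := @ultrafilter_cvg R I U (fun i => re (c i)) M (fun i => le_trans (re_le_rnorm _) (cM i)).
have /cvg_ex[b bP] := @ultrafilter_cvg R I U (fun i => imK (c i)) M (fun i => le_trans (im_le_rnorm _) (cM i)).
exists (ofR a + iK * ofR b) => e e0.
have e2 : 0 < e / 2 by rewrite divr_gt0.
move/cvgrPdist_lt/(_ _ e2): aP; move/cvgrPdist_lt/(_ _ e2): bP.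
apply: filterS2 => i bi ai.
have -> : c i - (ofR a + iK * ofR b) = ofR (re (c i) - a) + iK * ofR (imK (c i) - b).
  by rewrite {1}(re_imK (c i)) !ofRD !ofRN; ring.
apply: le_lt_trans (rnormD _ _) _; rewrite rnormM !rnorm_ofR.
have : rnorm (iK : K) * `|imK (c i) - b| <= `|imK (c i) - b|.
  by rewrite ler_piMl//; exact: rnorm_iK_le1.
rewrite distrC in ai; rewrite distrC in bi; move: ai bi => /=; lra.
Qed.

End ScalarLimits.

Section FiniteDim.
Context {R : realType} {k : scalar_kind}.
Local Notation K := (scalar_field R k).

Lemma free_ultrafilter : exists U : ultrafilter nat, forall N,
  \forall n \near ultra_sets U, (N <= n)%N.
Proof.
have [G [Gu Gf]] := ultraFilterLemma (F := \oo) _.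
by exists (Ultrafilter Gu) => N; apply: Gf; exists N.
Qed.

Section Span.
Variable X : normedModType K.
Implicit Types (e : nat -> X) (x y : X).

Definition spanned e n x : Prop := exists c : nat -> K, x = \sum_(i < n) c i *: e i.

Lemma spannedD e n a x y : spanned e n x -> spanned e n y -> spanned e n (a *: x + y).
Proof.
move=> [c ->] [d ->]; exists (fun i => a * c i + d i).
rewrite scaler_sumr -big_split; apply: eq_bigr => i _ /=.
by rewrite scalerDl scalerA.
Qed.

Lemma spanned0 e n : spanned e n 0.
Proof. by exists (fun=> 0); rewrite big1// => i _; rewrite scale0r. Qed.

Lemma spanned_gen e n i : (i < n)%N -> spanned e n (e i).
Proof.
move=> ilt; exists (fun j => (j == i)%:R); rewrite (bigD1 (Ordinal ilt))//= eqxx scale1r.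
rewrite big1 ?addr0// => j; rewrite -val_eqE /= => /negbTE->; exact: scale0r.
Qed.

(** An approximating sequence is read as an element of an ultrapower over [nat]; if it lies on the
    diagonal, its value there is the limit. The property of ultrapowers is a hypothesis so that
    [ultralimit_spanned] can use this result inside its own induction. *)
Lemma spanned_closed_of e n :
  (forall (I : Type) (U : ultrafilter I) (x : linf X I), (forall i, spanned e n (x i)) ->
    exists2 y, spanned e n y & ultra_class U x = diag U y) ->
  forall x, adherent (spanned e n) x -> spanned e n x.
Proof.
move=> lim x xA.
have /choice[f fP] : forall m : nat, exists f, spanned e n f /\ rnorm (x - f) < 2^-1 ^+ m.
  by move=> m; have [f fs h] := xA _ (half_gt0 m); exists f.
have [W Wfree] := free_ultrafilter.
have fb : exists M : R, forall m, rnorm (f m) <= M.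
  exists (rnorm x + 1) => m; apply: le_trans (rnormB_le _ x) _.
  rewrite lerD2l rnormBC (le_trans (ltW (fP m).2))// exprn_ile1 ?invr_ge0//.
  by rewrite invf_le1// ler1n.
have [y ys fy] := lim nat W (mklinf fb) (fun m => (fP m).1).
suff -> : x = y by [].
apply: (dist_inj (lin_isometry_dist (diag_isometry X W))); rewrite -fy.
apply/esym/ultra_class_eqP/le_anti; rewrite ultra_norm_ge0 andbT.
apply/ler_addgt0Pl => t t0; rewrite addr0; apply: ultra_norm_le.
have [N NP] := half_small 1 t0; rewrite mul1r in NP.
apply: filterS (Wfree N) => m Nm; rewrite (_ : _ m = f m - x)// rnormBC.
by apply: le_trans (ltW (fP m).2) (le_trans (half_le Nm) (ltW NP)).
Qed.

(** By induction on the number of generators. Unless [e n] is spanned by the preceding ones, it lies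
    at a distance [d > 0] from their span, which is closed by induction; the coefficients along
    [e n] are then bounded by the norms divided by [d] and have an ultralimit. *)
Lemma ultralimit_spanned e n (I : Type) (U : ultrafilter I) (x : linf X I) :
  (forall i, spanned e n (x i)) -> exists2 y, spanned e n y & ultra_class U x = diag U y.
Proof.
elim: n I U x => [|n IH] I U x xs.
  exists 0; first exact: spanned0.
  apply: ultra_class_near; apply: nearW => i /=.
  by have [c ->] := xs i; rewrite big_ord0.
have wid y : spanned e n y -> spanned e n.+1 y.
  move=> [c ->]; exists (fun i => if (i < n)%N then c i else 0).
  rewrite big_ord_recr /= ltnn scale0r addr0.
  by apply: eq_bigr => i _; rewrite ltn_ord.
have [een|een] := pselect (spanned e n (e n)).
  have [|y ys xy] := IH I U x; last by exists y => //; exact: wid.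
  move=> i; have [c ->] := xs i; rewrite big_ord_recr /= addrC.
  by apply: spannedD => //; exists c.
have [d d0 dP] : exists2 d : R, 0 < d & forall f, spanned e n f -> d <= rnorm (e n - f).
  apply: contrapT => h; apply: een; apply: spanned_closed_of IH _ _ => r r0.
  apply: contrapT => nf; apply: h; exists r => // f fs.
  by rewrite leNgt; apply/negP => lt; apply: nf; exists f.
have /choice[c cP] : forall i, exists c : K, spanned e n (x i - c *: e n).
  move=> i; have [c ->] := xs i; exists (c n); rewrite big_ord_recr /= addrK.
  by exists c.
have cd i : rnorm (c i) * d <= rnorm (x i).
  have [->|c0] := eqVneq (c i) 0; first by rewrite rnorm0 mul0r rnorm_ge0.
  have -> : x i = c i *: (e n - (- (c i)^-1) *: (x i - c i *: e n)).
    by rewrite scalerBr scalerA mulrN mulfV// scaleN1r opprK addrC subrK.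
  rewrite rnormZ ler_wpM2l ?rnorm_ge0//; apply: dP.
  by rewrite -[_ *: _]addr0; apply: spannedD => //; exact: spanned0.
have [M MP] := linf_bounded x.
have cb i : rnorm (c i) <= M / d by rewrite ler_pdivlMr// (le_trans (cd i)).
have [l lP] := ultralimit_scalar U cb.
have fb : exists M : R, forall i, rnorm (x i - c i *: e n) <= M.
  exists (M + M / d * rnorm (e n)) => i; apply: le_trans (rnormD _ _) _.
  by rewrite rnormN rnormZ lerD// ler_wpM2r// rnorm_ge0.
have [y ys fy] := IH I U (mklinf fb) cP.
exists (l *: e n + y); first by apply: spannedD; [exact: spanned_gen|exact: wid].
apply/ultra_class_eqP/le_anti; rewrite ultra_norm_ge0 andbT.
apply/ler_addgt0Pl => t t0; rewrite addr0; apply: ultra_norm_le.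
have fy0 : rnorm (ultra_class U (mklinf fb) - diag U y) < t / 2.
  by rewrite fy subrr rnorm0 divr_gt0.
have s0 : 0 < t / 2 / (rnorm (e n) + 1).
  by rewrite !divr_gt0// ltr_wpDl// rnorm_ge0.
apply: filterS2 (diag_dist fy0) (lP _ s0) => i /= h1 h2.
rewrite (_ : _ i = x i - (l *: e n + y))//.
have -> : x i - (l *: e n + y) = (x i - c i *: e n - y) + (c i - l) *: e n.
  by rewrite scalerBl [x i - _ - y]addrAC subrKA [l *: _ + y]addrC opprD addrA.
apply: le_trans (rnormD _ _) _; rewrite rnormZ.
have : rnorm (c i - l) * rnorm (e n) <= t / 2; last lra.
move: h2; rewrite ltr_pdivlMr ?ltr_wpDl ?rnorm_ge0// => /ltW; apply: le_trans.
by rewrite ler_wpM2l ?rnorm_ge0// lerDl.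
Qed.

Lemma spanned_closed e n x : adherent (spanned e n) x -> spanned e n x.
Proof. by apply: spanned_closed_of => I U; exact: ultralimit_spanned. Qed.

End Span.

(** Infinite dimension in a form preserved by isometric embeddings and usable coordinatewise in
    ultrapowers; [2^-1] is the gap that Riesz's lemma provides. *)
Definition separated_sequence (X : normedModType K) : Prop := exists x : nat -> X,
  (forall n, rnorm (x n) <= 1) /\ forall m n, (m < n)%N -> 2^-1 <= rnorm (x n - x m).

Lemma separated_embed (X Y : normedModType K) (f : X -> Y) : lin_isometry f ->
  separated_sequence X -> separated_sequence Y.
Proof.
move=> fi [x [x1 xs]]; exists (f \o x); split=> [n|m n mn] /=; first by rewrite fi.2.
by rewrite (lin_isometry_dist fi); exact: xs.
Qed.

Lemma separated_isometric (X Y : normedModType K) : isometric X Y ->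
  separated_sequence Y -> separated_sequence X.
Proof. by move=> /isometric_inv[f [g [_ gi _ _]]]; exact: separated_embed gi. Qed.

Lemma finite_dim_spanned (X : normedModType K) :
  finite_dim X <-> exists n (e : nat -> X), forall x, spanned e n x.
Proof.
split=> [[n [e eP]]|[n [e eP]]].
  exists n, (fun i => if insub i is Some j then e j else 0) => x; have [c ->] := eP x.
  exists (fun i => if insub i is Some j then c j else 0).
  by apply: eq_bigr => i _; rewrite valK.
by exists n, e => x; have [c ->] := eP x; exists c.
Qed.

Lemma finite_dim_diag (X : normedModType K) (I : Type) (U : ultrafilter I) :
  finite_dim X -> forall z, exists x, z = diag U x :> ultrapower X U.
Proof.
move=> /finite_dim_spanned[n [e eP]] z; have [x ->] := ultra_classP z.
by have [y _ ->] := @ultralimit_spanned X e n I U x (fun i => eP _); exists y.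
Qed.

(** The span is closed, so [z] has a positive distance to it. With [f] in the span at less than
    twice this distance from [z], the normalised [z - f] stays at distance at least one half from
    the span. *)
Lemma riesz (X : normedModType K) (e : nat -> X) n : ~ finite_dim X ->
  exists x, rnorm x <= 1 /\ forall f, spanned e n f -> 2^-1 <= rnorm (x - f).
Proof.
move=> Xinf; have [z zP] : exists z, ~ spanned e n z.
  by apply: contrapT => h; apply: Xinf; apply/finite_dim_spanned; exists n, e => z;
    apply: contrapT => zP; apply: h; exists z.
pose D := [set rnorm (z - f) | f in [set f | spanned e n f]].
have Dinf : has_inf D.
  split; first by exists (rnorm (z - 0)), 0 => //; exact: spanned0.
  by exists 0 => _ [f _ <-]; exact: rnorm_ge0.
have Dle f : spanned e n f -> inf D <= rnorm (z - f).
  by move=> fs; apply: ge_inf; [case: Dinf|exists f].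
have D0 : 0 < inf D.
  rewrite ltNge; apply/negP => D0; apply: zP; apply: spanned_closed => r r0.
  by have [_ [f fs <-] fr] := inf_lt Dinf.1 (le_lt_trans D0 r0); exists f.
have [_ [f fs <-] fD] : exists2 d, D d & d < 2 * inf D by apply: inf_lt; [case: Dinf|lra].
have nf : 0 < rnorm (z - f) by apply: lt_le_trans D0 (Dle _ fs).
exists (ofR (rnorm (z - f))^-1 *: (z - f)).
have nV : rnorm (ofR (rnorm (z - f))^-1 : K) = (rnorm (z - f))^-1.
  by rewrite rnorm_ofR ger0_norm// invr_ge0 ltW.
split; first by rewrite rnormZ nV mulVf// gt_eqF.
move=> g gs.
have -> : ofR (rnorm (z - f))^-1 *: (z - f) - g =
    ofR (rnorm (z - f))^-1 *: (z - (ofR (rnorm (z - f)) *: g + f)).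
  rewrite opprD [- _ - f]addrC addrA [in RHS]scalerBr scalerA -ofRM mulVf ?gt_eqF//.
  by rewrite ofR1 scale1r.
rewrite rnormZ nV ler_pdivlMl//; have := Dle _ (spannedD (ofR (rnorm (z - f))) gs fs).
by lra.
Qed.

(** In finite dimension a bounded sequence is diagonal in an ultrapower over [nat], so infinitely
    many of its terms lie within [4^-1] of one point and cannot be separated. Otherwise Riesz's
    lemma, applied to the list of vectors already chosen, builds the sequence. *)
Lemma finite_dimP (X : normedModType K) : finite_dim X <-> ~ separated_sequence X.
Proof.
split=> [Xfin [x [x1 xs]]|nsep].
  have [W Wfree] := free_ultrafilter.
  have xb : exists M : R, forall n, rnorm (x n) <= M by exists 1.
  have [y yP] := finite_dim_diag (U := W) Xfin (ultra_class W (mklinf xb)).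
  have : rnorm (ultra_class W (mklinf xb) - diag W y) < 4^-1.
    by rewrite yP subrr rnorm0 invr_gt0.
  move=> /diag_dist h; have [m /= mP] := filter_ex h.
  have [n [/= nP mn]] := filter_ex (filterI h (Wfree m.+1)).
  have := xs m n mn; have := rnorm_triangle y (x n) (x m).
  rewrite [rnorm (y - _)]rnormBC; lra.
apply: contrapT => Xinf; apply: nsep.
have /choice[g gP] : forall s : seq X, exists x, rnorm x <= 1 /\
    forall f, spanned (nth 0 s) (size s) f -> 2^-1 <= rnorm (x - f).
  by move=> s; exact: riesz.
pose L := fix L n := if n is m.+1 then g (L m) :: L m else [::].
have Lm m n : (m < n)%N -> g (L m) \in L n.
  elim: n => // n IH; rewrite ltnS leq_eqVlt => /predU1P[->|/IH] /=.
    by rewrite mem_head.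
  by rewrite in_cons => ->; rewrite orbT.
exists (fun n => g (L n)); split=> [n|m n mn]; first by have [] := gP (L n).
apply: (gP _).2; rewrite -(nth_index 0 (Lm _ _ mn)).
by apply: spanned_gen; rewrite index_mem Lm.
Qed.

Lemma finite_dim_embed (X Y : normedModType K) (f : X -> Y) : lin_isometry f ->
  finite_dim Y -> finite_dim X.
Proof.
by move=> fi /finite_dimP Yf; apply/finite_dimP => /(separated_embed fi).
Qed.

End FiniteDim.

(** * Orthonormal bases and isometries *)

Section Subspace.
Context {R : realType} {k : scalar_kind}.
Local Notation K := (scalar_field R k).
Variable X : normedModType K.

Record subspace := Subspace {
  subspace_set :> X -> Prop;
  subspace0 : subspace_set 0;
  subspaceP : forall a x y, subspace_set x -> subspace_set y -> subspace_set (a *: x + y) }.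

Variable A : subspace.

Definition in_subspace : {pred X} := fun x => `[< A x >].

Lemma in_subspace_submod : submod_closed in_subspace.
Proof.
split; first by apply/asboolP; exact: subspace0.
by move=> a x y /asboolP xA /asboolP yA; apply/asboolP; exact: subspaceP.
Qed.

HB.instance Definition _ := GRing.isSubmodClosed.Build K X in_subspace in_subspace_submod.

Record subspace_type := SubspaceElt { subspace_val :> X; _ : subspace_val \in in_subspace }.

HB.instance Definition _ := [isSub of subspace_type for subspace_val].
HB.instance Definition _ := [Choice of subspace_type by <:].
HB.instance Definition _ := [SubChoice_isSubLmodule of subspace_type by <:].

Let nrm (x : subspace_type) : K := `|subspace_val x|.

Let nrmD x y : nrm (x + y) <= nrm x + nrm y.
Proof. exact: ler_normD. Qed.

Let nrmZ (a : K) x : nrm (a *: x) = `|a| * nrm x.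
Proof. exact: normrZ. Qed.

Let nrm_eq0 x : nrm x = 0 -> x = 0.
Proof. by move=> /normr0_eq0 x0; apply/val_inj. Qed.

HB.instance Definition _ :=
  @Lmodule_isNormed.Build K subspace_type nrm nrmD nrmZ nrm_eq0.

Lemma subspace_val_isometry : lin_isometry subspace_val.
Proof. by split. Qed.

Lemma subspace_valP (x : subspace_type) : A x.
Proof. exact/asboolP/(valP x). Qed.

Definition in_sub x (h : A x) : subspace_type := SubspaceElt (introT (asboolP _) h).

Lemma hilbert_subspace : hilbert X -> (forall x, adherent A x -> A x) ->
  hilbert subspace_type.
Proof.
move=> Xh Acl; apply: (hilbert_embed subspace_val_isometry) => // y yA.
have yA' : A y.
  apply: Acl => e e0; have [_ [x _ <-] h] := yA e e0.
  by exists (subspace_val x) => //; exact: subspace_valP.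
by exists (in_sub yA').
Qed.

End Subspace.

(** * Extension of isometries from dense families *)

Section DenseExtension.
Context {R : realType} {k : scalar_kind}.
Local Notation K := (scalar_field R k).

Section OneWay.
Variables (X Y : normedModType K) (J : Type) (p : J -> X) (q : J -> Y).
Hypothesis pq : forall i j, rnorm (p i - p j) = rnorm (q i - q j).

(** The continuous extension of the correspondence between [p j] and [q j], as a relation: it is
    symmetric in the two families, so exchanging them yields surjectivity. *)
Definition extends x y : Prop := forall e : R, 0 < e ->
  exists2 j, rnorm (x - p j) < e & rnorm (y - q j) < e.

Lemma extends_exists : banach Y -> (forall x, adherent (range p) x) ->
  forall x, exists y, extends x y.
Proof.
move=> /banachP Yb pd x.
have /choice[j jP] : forall n, exists j, rnorm (x - p j) < 2^-1 ^+ n.+1.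
  by move=> n; have [_ [j _ <-] h] := pd x _ (@half_gt0 R n.+1); exists j.
have [|y yP] := Yb (q \o j).
  move=> n; rewrite /= -pq; apply: le_trans (rnorm_triangle x _ _) _.
  rewrite rnormBC; have := jP n; have := jP n.+1.
  have := @halfS R n.+1; have := @halfS R n; have := @half_gt0 R n.+2; lra.
exists y => e e0; have [n nP] := half_small 2 e0; exists (j n).
  apply: lt_trans (jP n) _; have := @halfS R n; have := @half_gt0 R n; lra.
by rewrite rnormBC; apply: le_lt_trans (yP n) nP.
Qed.

Lemma extends_dist x y x' y' : extends x y -> extends x' y' ->
  rnorm (x - x') = rnorm (y - y').
Proof.
move=> xy xy'; apply/eqP; rewrite -subr_eq0 -normr_eq0 eq_le normr_ge0 andbT.
apply/ler_addgt0Pl => e e0; rewrite addr0.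
have e4 : 0 < e / 4 by rewrite divr_gt0.
have [j h1 h2] := xy _ e4; have [i h3 h4] := xy' _ e4.
have d (Z : normedModType K) (a b c d : Z) : rnorm (a - c) < e / 4 -> rnorm (b - d) < e / 4 ->
    `|rnorm (a - b) - rnorm (c - d)| <= e / 2.
  move=> ac bd; apply: le_trans (ler_rnorm_dist _ _) _.
  rewrite (_ : a - b - (c - d) = (a - c) - (b - d)).
    by apply: le_trans (rnormD _ _) _; rewrite rnormN; lra.
  by rewrite !opprB addrACA [RHS]addrACA [- b - c]addrC.
have := d _ _ _ _ _ h1 h3; have := d _ _ _ _ _ h2 h4; rewrite pq.
by rewrite !ler_norml; move=> /andP[? ?] /andP[? ?]; apply/andP; split; lra.
Qed.

Lemma extends_linear : (forall a i j, exists2 l, p l = a *: p i + p j & q l = a *: q i + q j) ->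
  forall a x y x' y', extends x y -> extends x' y' -> extends (a *: x + x') (a *: y + y').
Proof.
move=> lin a x y x' y' xy xy' e e0.
have a1 : 0 < rnorm a + 1 by rewrite ltr_wpDl// rnorm_ge0.
have e2 : 0 < e / 2 / (rnorm a + 1) by rewrite !divr_gt0.
have e2' : 0 < e / 2 by rewrite divr_gt0.
have [i h1 h2] := xy _ e2; have [j h3 h4] := xy' _ e2'; have [l pl ql] := lin a i j.
have d (Z : normedModType K) (u v u' v' : Z) : rnorm (u - v) < e / 2 / (rnorm a + 1) ->
    rnorm (u' - v') < e / 2 -> rnorm (a *: u + u' - (a *: v + v')) < e.
  move=> uv uv'; rewrite opprD addrACA -scalerBr; apply: le_lt_trans (rnormD _ _) _.
  rewrite rnormZ; move: uv; rewrite ltr_pdivlMr// => uv.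
  have : rnorm a * rnorm (u - v) <= rnorm (u - v) * (rnorm a + 1).
    by rewrite mulrC ler_wpM2l ?rnorm_ge0// lerDl.
  lra.
by exists l; rewrite ?pl ?ql; exact: d.
Qed.

End OneWay.

Lemma dense_isometric (X Y : normedModType K) (J : Type) (p : J -> X) (q : J -> Y) :
  banach X -> banach Y -> (forall i j, rnorm (p i - p j) = rnorm (q i - q j)) ->
  (forall x, adherent (range p) x) -> (forall y, adherent (range q) y) ->
  (forall a i j, exists2 l, p l = a *: p i + p j & q l = a *: q i + q j) ->
  isometric X Y.
Proof.
move=> Xb Yb pq pd qd lin.
have [f fP] := choice (extends_exists pq Yb pd).
have uniq x y y' : extends p q x y -> extends p q x y' -> y = y'.
  move=> h h'; apply/subr0_eq/rnorm0_eq0.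
  by rewrite -(extends_dist pq h h') subrr rnorm0.
have ext0 : extends p q 0 0.
  have [f0 f0P] : exists y, extends p q 0 y by exists (f 0).
  have := extends_linear lin (-1) f0P f0P.
  by rewrite !scaleN1r addNr addNr.
apply/isometricP; exists f; split.
  split=> [a x y|x]; first by apply: uniq (fP _) _; apply: extends_linear.
  by have := extends_dist pq (fP x) ext0; rewrite !subr0.
move=> y; have qp i j : rnorm (q i - q j) = rnorm (p i - p j) by rewrite pq.
have [x xP] := extends_exists qp Xb qd y; exists x.
by apply: uniq (fP x) _ => e /xP[j h1 h2]; exists j.
Qed.

End DenseExtension.

Section Orthonormal.
Context {R : realType} {k : scalar_kind}.
Local Notation K := (scalar_field R k).

Definition comb (B : Type) (X : lmodType K) (e : B -> X) (l : seq (K * B)) : X :=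
  \sum_(p <- l) p.1 *: e p.2.

Lemma comb_lin (B : Type) (X : lmodType K) (e : B -> X) a l l' :
  comb e ([seq (a * p.1, p.2) | p <- l] ++ l') = a *: comb e l + comb e l'.
Proof.
rewrite /comb big_cat big_map scaler_sumr; congr (_ + _).
by apply: eq_bigr => p _; rewrite scalerA.
Qed.

(** The squared norm of a combination of orthonormal vectors, where indices may repeat in the list.
    It depends on the list alone, so spaces with bases indexed by one type are isometric by
    comparison of norms. *)
Definition gram (B : Type) (l : seq (K * B)) : R :=
  re (\sum_(p <- l) \sum_(q <- l) p.1 * conjK q.1 * (`[< p.2 = q.2 >])%:R).

Definition orthonormal (B : Type) (H : normedModType K) (e : B -> H) : Prop :=
  forall l, rnorm (comb e l) ^+ 2 = gram l.

Definition hbasis (B : Type) (H : normedModType K) (e : B -> H) : Prop :=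
  orthonormal e /\ forall x, adherent (range (comb e)) x.

Lemma orthonormal_inj (B B' : Type) (H : normedModType K) (e : B -> H) (f : B' -> B) :
  injective f -> orthonormal e -> orthonormal (e \o f).
Proof.
move=> fi eo l; have := eo [seq (p.1, f p.2) | p <- l].
rewrite /comb /gram big_map => ->; rewrite big_map; congr re.
apply: eq_bigr => p _; rewrite big_map; apply: eq_bigr => q _ /=.
congr (_ * (_ : bool)%:R); apply/asboolP/asboolP => [/fi//|->//].
Qed.

Lemma orthonormal_norm (B : Type) (H : normedModType K) (e : B -> H) b :
  orthonormal e -> rnorm (e b) = 1.
Proof.
move=> /(_ [:: (1, b)]); rewrite /comb /gram !big_seq1 /= conjK1 !mulr1 scale1r.
have re1 : re (1 : K) = 1 by rewrite -(@ofR1 R k) ofRK.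
rewrite asboolT// mulr1 re1 => /eqP; rewrite -[X in _ == X](expr1n _ 2).
by rewrite eqrXn2// ?rnorm_ge0// => /eqP.
Qed.

Lemma orthonormal_dist (B : Type) (H : normedModType K) (e : B -> H) b b' :
  orthonormal e -> b <> b' -> 1 <= rnorm (e b - e b').
Proof.
move=> /(_ [:: (1, b); (-1, b')]) + bb'.
rewrite /comb /gram !(big_cons, big_nil) /= !addr0 scale1r scaleN1r.
rewrite !(asboolT erefl) !asboolF//; last by move=> /esym.
rewrite !mulr0 !add0r addr0 !mulr1 !mul_conjK normrN normr1 expr1n.
have -> : 1 + 1 = ofR 2 :> K by rewrite ofR_nat.
rewrite ofRK => h; rewrite -(@ler_pXn2r _ 2)// ?nnegrE ?rnorm_ge0// h expr1n; lra.
Qed.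

Lemma hbasis_bij (B B' : Type) (H : normedModType K) (e : B -> H) (f : B' -> B) :
  bijective f -> hbasis e -> hbasis (e \o f).
Proof.
move=> [g fK gK] [eo ed]; split; first exact: orthonormal_inj (can_inj fK) eo.
move=> x r r0; have [_ [l _ <-] h] := ed x r r0.
exists (comb e l) => //; exists [seq (p.1, g p.2) | p <- l] => //.
by rewrite /comb big_map; apply: eq_bigr => p _; rewrite /= gK.
Qed.

Lemma hbasis_isometric (B : Type) (H1 H2 : normedModType K) (e1 : B -> H1) (e2 : B -> H2) :
  hilbert H1 -> hilbert H2 -> hbasis e1 -> hbasis e2 -> isometric H1 H2.
Proof.
move=> [b1 _] [b2 _] [o1 d1] [o2 d2].
have sub (H : normedModType K) (e : B -> H) l l' :
    comb e l - comb e l' = comb e ([seq (-1 * p.1, p.2) | p <- l'] ++ l).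
  by rewrite comb_lin scaleN1r addrC.
apply: (dense_isometric b1 b2 _ d1 d2).
  move=> l l'; rewrite !sub; apply/eqP; rewrite -(@eqrXn2 _ 2)// ?rnorm_ge0//.
  by rewrite o1 o2.
by move=> a l l'; eexists; rewrite -comb_lin; reflexivity.
Qed.

Lemma adherent_comb_closed (B : Type) (X : normedModType K) (e : B -> X) x :
  adherent (adherent (range (comb e))) x -> adherent (range (comb e)) x.
Proof.
move=> h r r0; have r2 : 0 < r / 2 by rewrite divr_gt0.
have [y yP xy] := h _ r2; have [z zP yz] := yP _ r2; exists z => //.
by apply: le_lt_trans (rnorm_triangle y _ _) _; lra.
Qed.

Lemma comb_closure_lin (B : Type) (X : normedModType K) (e : B -> X) a x y :
  adherent (range (comb e)) x -> adherent (range (comb e)) y ->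
  adherent (range (comb e)) (a *: x + y).
Proof.
move=> xP yP r r0.
have a1 : 0 < rnorm a + 1 by rewrite ltr_wpDl// rnorm_ge0.
have r2 : 0 < r / 2 / (rnorm a + 1) by rewrite !divr_gt0.
have r2' : 0 < r / 2 by rewrite divr_gt0.
have [_ [l _ <-] xl] := xP _ r2; have [_ [l' _ <-] yl] := yP _ r2'.
exists (a *: comb e l + comb e l'); first by rewrite -comb_lin; eexists.
rewrite opprD addrACA -scalerBr; apply: le_lt_trans (rnormD _ _) _.
rewrite rnormZ; move: xl; rewrite ltr_pdivlMr// => xl.
have : rnorm a * rnorm (x - comb e l) <= rnorm (x - comb e l) * (rnorm a + 1).
  by rewrite mulrC ler_wpM2l ?rnorm_ge0// lerDl.
lra.
Qed.

Lemma adherent_self (X : normedModType K) (A : X -> Prop) x : A x -> adherent A x.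
Proof. by move=> xA r r0; exists x => //; rewrite subrr rnorm0. Qed.

Lemma comb_closure0 (B : Type) (X : normedModType K) (e : B -> X) :
  adherent (range (comb e)) 0.
Proof. by apply: adherent_self; exists [::] => //; rewrite /comb big_nil. Qed.

Lemma orthonormal_closure (B : Type) (H : normedModType K) (e : B -> H) :
  hilbert H -> orthonormal e ->
  exists2 H' : normedModType K, hilbert H' & exists e' : B -> H', hbasis e'.
Proof.
move=> Hh eo.
pose A := Subspace (@comb_closure0 B H e) (@comb_closure_lin B H e).
exists (subspace_type A).
  apply: hilbert_subspace => // x; exact: adherent_comb_closed.
have eA b : A (e b).
  by apply: adherent_self; exists [:: (1, b)] => //; rewrite /comb big_seq1 scale1r.
pose e' b : subspace_type A := in_sub (eA b); exists e'.
have combE l : subspace_val (comb e' l) = comb e l.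
  by rewrite /comb; elim/big_rec2: _ => // p x y _ <-.
split=> [l|x r r0]; first by rewrite -eo -combE.
have xA : adherent (range (comb e)) (subspace_val x) := subspace_valP x.
have [_ [l _ <-] h] := xA r r0; exists (comb e' l); first by exists l.
by rewrite -combE in h.
Qed.

End Orthonormal.

(** * Existence of orthonormal bases, dense sets *)

Section BasisExistence.
Context {R : realType} {k : scalar_kind}.
Local Notation K := (scalar_field R k).
Variable H : normedModType K.
Variable ip : H -> H -> K.
Hypothesis ip_scalar : forall y, scalar (ip ^~ y).
Hypothesis ipC : forall x y, ip y x = conjK (ip x y).
Hypothesis ipxx : forall x, ip x x = `|x| ^+ 2.

Let ipD u v z : ip (u + v) z = ip u z + ip v z.
Proof. by have := ip_scalar z 1 u v; rewrite /= scale1r mul1r. Qed.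

Let ip0 z : ip 0 z = 0.
Proof. by have /eqP := ipD 0 0 z; rewrite addr0 eq_sym -subr_eq0 addrK => /eqP. Qed.

Let ipZ a u z : ip (a *: u) z = a * ip u z.
Proof. by have := ip_scalar z a u 0; rewrite /= addr0 ip0 addr0. Qed.

Let ipDr u v z : ip z (u + v) = ip z u + ip z v.
Proof. by rewrite ipC ipD conjKD -!ipC. Qed.

Let ipZr a u z : ip z (a *: u) = conjK a * ip z u.
Proof. by rewrite ipC ipZ conjKM -ipC. Qed.

Let ip0r z : ip z 0 = 0.
Proof. by rewrite ipC ip0 conjK0. Qed.

Lemma orthonormal_ip (B : Type) (e : B -> H) :
  (forall b b', ip (e b) (e b') = (`[< b = b' >])%:R) -> orthonormal e.
Proof.
move=> eo l; apply: (@ofR_inj R k); rewrite /gram.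
have ipl z : ip (comb e l) z = \sum_(p <- l) p.1 * ip (e p.2) z.
  rewrite /comb; elim/big_rec2: _ => [|p x y _ <-]; first exact: ip0.
  by rewrite ipD ipZ.
have ipr z : ip z (comb e l) = \sum_(p <- l) conjK p.1 * ip z (e p.2).
  rewrite /comb; elim/big_rec2: _ => [|p x y _ <-]; first exact: ip0r.
  by rewrite ipDr ipZr.
have -> : \sum_(p <- l) \sum_(q <- l) p.1 * conjK q.1 * (`[< p.2 = q.2 >])%:R =
    ip (comb e l) (comb e l).
  rewrite ipl; apply: eq_bigr => p _; rewrite ipr mulr_sumr.
  by apply: eq_bigr => q _; rewrite eo mulrA.
by rewrite ipxx -rnormE !expr2 -!ofRM ofRK.
Qed.

(** A minimising sequence of combinations converges by the parallelogram law, as the midpoint of two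
    of its terms is again a combination. *)
Lemma nearest_point (B : Type) (e : B -> H) x : banach H -> parallelogram H ->
  ~ adherent (range (comb e)) x ->
  exists m, [/\ adherent (range (comb e)) m, 0 < rnorm (x - m) &
    forall y, adherent (range (comb e)) y -> rnorm (x - m) <= rnorm (x - y)].
Proof.
move=> /banachP Hb PL xna.
have [r r0 rP] : exists2 r : R, 0 < r & forall l, r <= rnorm (x - comb e l).
  apply: contrapT => h; apply: xna => r r0; apply: contrapT => h'; apply: h.
  exists r => // l; rewrite leNgt; apply/negP => lt; apply: h'.
  by exists (comb e l) => //; exists l.
pose D := [set rnorm (x - comb e l) ^+ 2 | l in setT].
have Dne : D !=set0 by exists (rnorm (x - comb e [::]) ^+ 2), [::].
have Dlb : has_lbound D by exists 0 => _ [l _ <-]; exact: sqr_ge0.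
have Dle l : inf D <= rnorm (x - comb e l) ^+ 2 by apply: ge_inf => //; exists l.
have D0 : r ^+ 2 <= inf D.
  by apply: lb_le_inf => // _ [l _ <-]; rewrite ler_sqr ?nnegrE ?rnorm_ge0 ?(ltW r0).
pose d := Num.sqrt (inf D).
have dd : d ^+ 2 = inf D by rewrite sqr_sqrtr// (le_trans _ D0)// sqr_ge0.
have d0 : 0 < d.
  by rewrite sqrtr_gt0 (lt_le_trans _ D0)// exprn_gt0.
have dle l : d <= rnorm (x - comb e l).
  by rewrite -ler_sqr ?nnegrE ?rnorm_ge0 ?(ltW d0)// dd.
(* With errors [4^-(n+1)] above the infimum, the squared step is less than
   [2 (4^-(n+1) + 4^-(n+2))], hence than [4^-n], so that [m] is fast. *)
have /choice[l lP] : forall n, exists l,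
    rnorm (x - comb e l) ^+ 2 < inf D + (2^-1 ^+ n.+1) ^+ 2.
  move=> n; have [_ [l _ <-] h] : exists2 t, D t & t < inf D + (2^-1 ^+ n.+1) ^+ 2.
    by apply: inf_lt => //; rewrite ltrDl exprn_gt0// half_gt0.
  by exists l.
pose m n := comb e (l n).
have mf : fast m.
  move=> n; have h0 := @half_gt0 R n; have h1 := @half_gt0 R n.+1.
  rewrite -ler_sqr ?nnegrE ?rnorm_ge0 ?(ltW h0)//.
  have := PL (x - m n) (x - m n.+1).
  have -> : x - m n - (x - m n.+1) = m n.+1 - m n.
    by rewrite opprB addrC addrA subrK.
  have -> : x - m n + (x - m n.+1) =
      2 *: (x - comb e ([seq (2^-1 * p.1, p.2) | p <- l n] ++
        [seq (2^-1 * p.1, p.2) | p <- l n.+1] ++ [::])).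
    rewrite !comb_lin [comb e [::]]big_nil addr0 -scalerDr scalerBr scalerA.
    by rewrite divff ?pnatr_eq0// scale1r scaler_nat mulr2n addrACA opprD.
  rewrite rnormZ (rnorm_nat 2) exprMn.
  set c := comb e (_ ++ _); have := Dle _ : inf D <= rnorm (x - c) ^+ 2.
  have := lP n; have := lP n.+1; rewrite -/(m n) -/(m n.+1).
  have e1 := @halfS R n; have e2 := @halfS R n.+1; have h2 := @half_gt0 R n.+2.
  have -> : (2^-1 ^+ n) ^+ 2 = 4 * (2^-1 ^+ n.+1) ^+ 2 :> R by rewrite e1 exprMn -natrX.
  have -> : (2^-1 ^+ n.+1) ^+ 2 = 4 * (2^-1 ^+ n.+2) ^+ 2 :> R by rewrite e2 exprMn -natrX.
  have -> : 2 ^+ 2 = 4 :> R by rewrite -natrX.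
  have := sqr_ge0 (2^-1 ^+ n.+2 : R); lra.
have [p pP] := Hb m mf; exists p.
have pA : adherent (range (comb e)) p.
  move=> t t0; have [n nP] := half_small 2 t0; exists (m n); first by exists (l n).
  by rewrite rnormBC; apply: le_lt_trans (pP n) nP.
have adh y : adherent (range (comb e)) y -> d <= rnorm (x - y).
  move=> yA; apply/ler_addgt0Pl => t t0; have [_ [l' _ <-] h] := yA t t0.
  apply: le_trans (dle l') _; apply: le_trans (rnorm_triangle y _ _) _; lra.
have xp : rnorm (x - p) <= d.
  apply/ler_addgt0Pl => t t0; have [n nP] := half_small 3 t0.
  apply: le_trans (rnorm_triangle (m n) _ _) _.
  have := pP n; have h0 := @half_gt0 R n.+1; have := @halfS R n.
  suff : rnorm (x - m n) <= d + 2^-1 ^+ n.+1 by lra.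
  rewrite -ler_sqr ?nnegrE ?rnorm_ge0 ?addr_ge0 ?(ltW d0) ?(ltW h0)//.
  have := lP n; rewrite -dd -/(m n); have := mulr_gt0 d0 h0.
  by rewrite sqrrD; lra.
split=> //; first exact: lt_le_trans d0 (adh _ pA).
by move=> y /adh; apply: le_trans.
Qed.

(** A maximal orthonormal set works: if [x] were outside its closed span, the difference [y] of [x]
    and its nearest point would be orthogonal to the set, which the normalised [y] would then
    extend. *)
Lemma hbasis_exists : banach H -> parallelogram H ->
  exists (B : Type) (e : B -> H), hbasis e.
Proof.
move=> Hb PL.
pose P (S : set H) := (forall x, S x -> ip x x = 1) /\
  (forall x y, S x -> S y -> x <> y -> ip x y = 0).
have [F FP Ftot|S [[S1 S0] Smax]] := @Zorn_bigcup _ P.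
  split=> [x [X FX Xx]|x y [X FX Xx] [Y FY Yy]]; first exact: (FP X FX).1.
  have [XY|YX] := Ftot _ _ FX FY; first by apply: (FP Y FY).2 => //; exact: XY.
  by apply: (FP X FX).2 => //; exact: YX.
pose e (b : {x | S x}) := sval b.
have eo : orthonormal e.
  apply: orthonormal_ip => b b'; case: asboolP => [->|bb'].
    by rewrite S1//; exact: svalP.
  apply: S0; [exact: svalP|exact: svalP|move=> h; apply: bb'].
  by apply: eq_sig_hprop h => ?; exact: Prop_irrelevance.
exists {x | S x}, e; split=> // x; apply: contrapT => /(nearest_point Hb PL).
move=> [m [mA xm0 mP]].
have [y yE] : exists y, y = x - m by exists (x - m).
rewrite -yE in xm0 mP.
have orth s : S s -> ip y s = 0.
  (* Moving [m] by [c *: s] lowers the squared distance to [x] by [|c| ^ 2], so minimality forces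
     [c = 0]. *)
  move=> Ss; pose c := ip y s.
  have cA : adherent (range (comb e)) (c *: s + m).
    apply: comb_closure_lin => //; apply: adherent_self.
    by exists [:: (1, exist _ s Ss)] => //; rewrite /comb big_seq1 scale1r.
  have := mP _ cA; rewrite -ler_sqr ?nnegrE ?rnorm_ge0// -(@ofR_le _ k).
  have -> : x - (c *: s + m) = y + (- c) *: s.
    by rewrite yE scaleNr opprD [- _ - m]addrC addrA.
  rewrite !expr2 !ofRM !rnormE -!expr2 -!ipxx.
  rewrite ipD !ipDr !ipZ !ipZr (S1 _ Ss) (ipC y s) -/c !mulr1.
  have cN : conjK (- c) = - conjK c.
    by apply/eqP; rewrite -addr_eq0 -conjKD addNr conjK0.
  rewrite cN mulrNN mulNr [conjK c * c]mulrC mulNr addNr addr0 mul_conjK.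
  rewrite -subr_ge0 addrC addKr oppr_ge0 => c2.
  apply/normr0_eq0/eqP; rewrite -sqrf_eq0; apply/eqP/le_anti.
  by rewrite c2 exprn_ge0.
pose z := ofR (rnorm y)^-1 *: y.
have zz : ip z z = 1.
  rewrite ipxx /z normrZ ofR_norm -rnormE -ofRM ger0_norm ?invr_ge0 ?rnorm_ge0//.
  by rewrite mulVf ?gt_eqF// ofR1 expr1n.
have zs s : S s -> ip z s = 0 by move=> /orth h; rewrite ipZ h mulr0.
have sz s : S s -> ip s z = 0 by move=> /zs h; rewrite ipC h conjK0.
have zS : ~ S z by move=> /zs; rewrite zz => /eqP; rewrite oner_eq0.
apply: (Smax (S `|` [set z])).
  by split=> [s|]; [left|move=> /(_ z (or_intror erefl))].
split=> [s [/S1//|->//]|s t [Ss|->] [St|->] st //]; [exact: S0|exact: sz|exact: zs].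
Qed.

End BasisExistence.

(** * Rational combinations and the size of dense sets *)

Section Counting.
Context {R : realType} {k : scalar_kind}.
Local Notation K := (scalar_field R k).

Lemma hilbert_hbasis (H : normedModType K) : hilbert H ->
  exists (B : Type) (e : B -> H), hbasis e.
Proof.
move=> Hh; have /hilbertP[Hb PL] := Hh.
by have [_ [ip [ip1 ip2 ip3]]] := Hh; exact: hbasis_exists ip1 ip2 ip3 Hb PL.
Qed.

(** A dense sequence of scalars, indexed by [nat] so that a rational combination over [B] is a list
    over [nat * B] for either scalar field. *)
Definition qscalar (n : nat) : K :=
  if unpickle n is Some (a, b) then ofR (ratr (a : rat)) + iK * ofR (ratr (b : rat)) else 0.

Lemma qscalar_dense (z : K) (r : R) : 0 < r -> exists n, rnorm (z - qscalar n) < r.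
Proof.
move=> r0; have near (x : R) : exists a : rat, `|x - ratr a| < r / 2.
  have [|a ax] := @rat_in_itvoo R (x - r / 2) (x + r / 2); first by lra.
  by exists a; move: ax; rewrite in_itv /= => /andP[? ?]; rewrite ltr_norml; lra.
have [[a aP] [b bP]] := (near (re z), near (imK z)).
exists (pickle (a, b)); rewrite /qscalar pickleK.
have -> : z - (ofR (ratr a) + iK * ofR (ratr b)) =
    ofR (re z - ratr a) + iK * ofR (imK z - ratr b).
  by rewrite {1}(re_imK z) !ofRD !ofRN; ring.
apply: le_lt_trans (rnormD _ _) _; rewrite rnormM !rnorm_ofR.
have : rnorm (iK : K) * `|imK z - ratr b| <= `|imK z - ratr b|.
  by rewrite ler_piMl//; exact: rnorm_iK_le1.
move: aP bP => /=; lra.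
Qed.

Definition qcomb (B : Type) (X : lmodType K) (e : B -> X) (l : seq (nat * B)) : X :=
  comb e [seq (qscalar p.1, p.2) | p <- l].

Lemma qcomb_approx (B : Type) (X : normedModType K) (e : B -> X) l (r : R) :
  0 < r -> exists l', rnorm (comb e l - qcomb e l') < r.
Proof.
elim: l r => [|[a b] l IH] r r0.
  by exists [::]; rewrite /qcomb /= subrr rnorm0.
have r2 : 0 < r / 2 by rewrite divr_gt0.
have b1 : 0 < rnorm (e b) + 1 by rewrite ltr_wpDl// rnorm_ge0.
have [l' l'P] := IH _ r2; have [n nP] := qscalar_dense a (divr_gt0 r2 b1).
exists ((n, b) :: l'); rewrite /qcomb /comb /= !big_cons /= opprD addrACA -scalerBl.
apply: le_lt_trans (rnormD _ _) _; rewrite rnormZ.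
move: nP; rewrite ltr_pdivlMr// => nP.
have : rnorm (a - qscalar n) * rnorm (e b) <= rnorm (a - qscalar n) * (rnorm (e b) + 1).
  by rewrite ler_wpM2l ?rnorm_ge0// lerDl.
move: l'P; rewrite /qcomb /comb; lra.
Qed.

Lemma adherent_qcomb (B : Type) (X : normedModType K) (e : B -> X) x :
  adherent (range (comb e)) x -> adherent (range (qcomb e)) x.
Proof.
move=> h r r0; have r2 : 0 < r / 2 by rewrite divr_gt0.
have [_ [l _ <-] xl] := h _ r2; have [l' ll'] := qcomb_approx e l r2.
exists (qcomb e l'); first by exists l'.
apply: le_lt_trans (rnorm_triangle (comb e l) _ _) _; lra.
Qed.

Lemma injects_dense (P C : Type) (X : normedModType K) (z : P -> X) (c : C -> X) (d : R) :
  0 < d -> (forall p q, p <> q -> d <= rnorm (z p - z q)) ->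
  (forall x, adherent (range c) x) -> injects P C.
Proof.
move=> d0 zd cd; have d2 : 0 < d / 2 by rewrite divr_gt0.
have /choice[f fP] : forall p, exists i, rnorm (z p - c i) < d / 2.
  by move=> p; have [_ [i _ <-] h] := cd (z p) _ d2; exists i.
exists f => p q e; apply: contrapT => /zd.
have := rnorm_triangle (c (f p)) (z p) (z q); have := fP p; have := fP q.
by rewrite -e [rnorm (c _ - z q)]rnormBC; lra.
Qed.

Lemma separableP (X : normedModType K) :
  separable X <-> exists d : nat -> X, forall x, adherent (range d) x.
Proof.
split=> [[D [Dc /denseP Dd]]|[d dd]].
  have [f fi] := card_le_injects Dc.
  have /choice[d dP] : forall n, exists x : X, forall y : D, val (f y) = n -> x = val y.
    move=> n; have [[y yn]|h] := pselect (exists y : D, val (f y) = n).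
      by exists (val y) => y' y'n; congr val; apply/fi/val_inj; rewrite yn.
    by exists 0 => y yn; case: h; exists y.
  exists d => x r r0; have [y yD xy] := Dd x r r0; exists y => //.
  by exists (val (f (exist _ y (mem_set yD)))) => //; rewrite (dP _ _ erefl).
exists (range d); split; last exact/denseP.
exact: (@card_le_trans _ _ _ setT _ _ (card_image_le _ _)).
Qed.

Lemma finite_dim_separable (X : normedModType K) : finite_dim X -> separable X.
Proof.
move=> [n [e eP]]; apply/separableP.
exists (fun m => if unpickle m is Some l then qcomb e l else 0) => x.
have : adherent (range (comb e)) x.
  apply: adherent_self; have [c ->] := eP x.
  by exists [seq (c i, i) | i <- enum 'I_n] => //; rewrite /comb big_map big_enum.
move=> /adherent_qcomb h r /h[_ [l _ <-] xl]; exists (qcomb e l) => //.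
by exists (pickle l) => //; rewrite pickleK.
Qed.

Definition sum_code (V : lmodType K) (E : modular V) (H : normedModType K) (B : Type)
    (d : nat -> modspace E) (e : B -> H) (c : nat * seq (nat * B)) :
  modspace (msum E (sqnorm H)) := (d c.1, qcomb e c.2).

Lemma sum_code_dense (V : lmodType K) (E : modular V) (H : normedModType K) (B : Type)
    (d : nat -> modspace E) (e : B -> H) :
  (forall x, adherent (range d) x) -> (forall y, adherent (range (comb e)) y) ->
  forall z, adherent (range (sum_code d e)) z.
Proof.
move=> dd ed [x y] r r0; have r2 : 0 < r / 2 by rewrite divr_gt0.
have [_ [n _ <-] xn] := dd x _ r2.
have [_ [l _ <-] yl] := adherent_qcomb (ed y) r2.
exists (sum_code d e (n, l)); first by exists (n, l).
apply: le_lt_trans (msum_norm_le _) _; rewrite /= luxemburg_sqnorm.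
by rewrite modspace_rnormE in xn; lra.
Qed.

(** As [E] is separable, [sum_code] indexes a dense set by finite data over a basis of [H]; points
    at mutual distance [r] cannot share an approximant within [r / 2]. *)
Lemma injects_basis_code (V : lmodType K) (E : modular V) (H : normedModType K)
    (B P : Type) (e : B -> H) (z : P -> modspace (msum E (sqnorm H))) (r : R) :
  separable (modspace E) -> hbasis e -> 0 < r ->
  (forall p q, p <> q -> r <= rnorm (z p - z q)) -> injects P (nat * seq (nat * B)).
Proof.
move=> /separableP[d dd] [_ ed] r0 zr.
exact: injects_dense r0 zr (sum_code_dense dd ed).
Qed.

End Counting.

(** * Ultrapowers of maximal Hilbert dimension *)

Inductive tree (A : Type) : Type := Node of A & seq (tree A).

Section LargeUltrafilter.
Variable T : Type.

Fixpoint inlist (x : T) (s : seq T) : Prop :=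
  if s is y :: s' then x = y \/ inlist x s' else False.

Lemma inlist_cat x s t : inlist x (s ++ t) <-> inlist x s \/ inlist x t.
Proof.
elim: s => [|y s IH] /=; first by split; [right|case].
by rewrite IH; tauto.
Qed.

(** Lists act as finite subsets ordered by inclusion. The cones above the lists generate a proper
    filter, so finitely many elements can be required at once. *)
Lemma fine_ultrafilter : exists U : ultrafilter (seq T),
  forall x, \forall s \near ultra_sets U, inlist x s.
Proof.
pose F : set_system (seq T) := [set X | exists s0, forall s,
  (forall x, inlist x s0 -> inlist x s) -> X s].
have FF : ProperFilter F.
  apply: Build_ProperFilter_ex => [X [s0 h]|]; first by exists s0; exact: h.
  split=> [|X Y [s hs] [t ht]|X Y XY [s hs]].
  - by exists [::].
  - exists (s ++ t) => u hu; split.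
      by apply: hs => x xs; apply: hu; apply/inlist_cat; left.
    by apply: ht => x xt; apply: hu; apply/inlist_cat; right.
  - by exists s => u /hs /XY.
have [G [Gu FG]] := ultraFilterLemma FF.
by exists (Ultrafilter Gu) => x; apply: FG; exists [:: x] => s; apply; left.
Qed.

End LargeUltrafilter.

(* With [S := tree (A + bool)] and [I := seq S], the type [S] contains a copy of
   [A * I], hence [I -> A] injects into [P := S -> bool]; and two elements of [P]
   that differ at [s] have distinct restrictions to every list containing [s]. *)
Lemma large_ultrafilter (A : Type) :
  exists (I P : Type) (U : ultrafilter I) (c : P -> I -> nat),
    [/\ injects (I -> A) P, injects (nat -> bool) P &
        forall p q, p <> q -> \forall i \near ultra_sets U, c p i <> c q i].
Proof.
pose S := tree (A + bool); have [U UP] := fine_ultrafilter S.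
have inj : injects (seq S -> A + bool) (S -> bool).
  exists (fun x s => let: Node a i := s in `[< x i = a >]) => x y xy.
  apply/funext => i; have := congr1 (fun h => h (Node (x i) i)) xy.
  by rewrite /= asboolT// => /esym/asboolP.
exists (seq S), (S -> bool), U, (fun p i => pickle (map p i)); split.
- apply: injects_trans inj; exists (fun x i => inl (x i)) => x y xy; apply/funext => i.
  by have [] := congr1 (fun h => h i) xy.
- apply: injects_trans inj; exists (fun x i => inr (x (size i))) => x y xy.
  apply/funext => n; have [] := congr1 (fun h => h (nseq n (Node (inr true) [::]))) xy.
  by rewrite size_nseq.
- move=> p q pq; have [s ps] : exists s, p s <> q s.
    by apply: contrapT => h; apply: pq; apply/funext => s; apply: contrapT => ps; apply: h; exists s.
  apply: filterS (UP s) => i si /(pcan_inj pickleK) e; apply: ps.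
  by elim: i si e => //= t i IH [->|/IH h] [] // _ /h.
Qed.

Section Saturation.
Context {R : realType} {k : scalar_kind}.
Local Notation K := (scalar_field R k).

(** For [p <> q] the index functions [c p] and [c q] differ almost everywhere, so composing a
    separated sequence with them gives classes at distance at least one half. *)
Lemma separated_ultrapower (X : normedModType K) (I P : Type) (U : ultrafilter I)
    (c : P -> I -> nat) :
  (forall p q, p <> q -> \forall i \near ultra_sets U, c p i <> c q i) ->
  separated_sequence X ->
  exists z : P -> ultrapower X U, forall p q, p <> q -> 2^-1 <= rnorm (z p - z q).
Proof.
move=> cP [x [x1 xs]].
have xb p : exists M : R, forall i, rnorm (x (c p i)) <= M by exists 1.
exists (fun p => ultra_class U (mklinf (xb p))) => p q /cP pq.
rewrite -ultra_classB ultra_class_rnormE; apply: ultra_norm_ge.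
apply: filterS pq => i pqi; rewrite (_ : _ i = x (c p i) - x (c q i))//.
have [lt|lt|//] := ltngtP (c p i) (c q i); last exact: xs.
by rewrite rnormBC; exact: xs.
Qed.

Lemma injects_basis (P B : Type) : injects (nat -> bool) P ->
  injects P (nat * seq (nat * B)) -> injects P B.
Proof.
move=> unc PB; have [natB|Bnat] := injects_nat_or B.
  exact: injects_trans PB (injects_code natB).
case: cantor_nat; apply: injects_trans unc (injects_trans PB _).
exact: injects_code_nat.
Qed.

Lemma injects_ultrapower (X : normedModType K) (I : Type) (U : ultrafilter I) :
  injects (ultrapower X U) (I -> X).
Proof.
exists (fun z => linf_fun (ultra_repr z)) => z w zw.
rewrite -[z]ultra_reprK -[w]ultra_reprK; congr ultra_class.
exact: val_inj.
Qed.

Lemma injects_fun (I A B : Type) : injects A B -> injects (I -> A) (I -> B).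
Proof.
move=> [f fi]; exists (fun x i => f (x i)) => x y xy; apply/funext => i; apply: fi.
exact: (congr1 (fun h => h i) xy).
Qed.

Lemma lin_isometry_inj (X Y : normedModType K) (f : X -> Y) : lin_isometry f -> injective f.
Proof. by move=> fi; exact: dist_inj (lin_isometry_dist fi). Qed.

Lemma isometric_injects (X Y : normedModType K) : isometric X Y -> injects Y X.
Proof. by move=> /isometric_inv[f [g [_ gi _ _]]]; exists g; exact: lin_isometry_inj. Qed.

Lemma hbasis_inj (B : Type) (H : normedModType K) (e : B -> H) : hbasis e -> injective e.
Proof.
move=> [eo _] b b' ebb'; apply: contrapT => /(orthonormal_dist eo).
by rewrite ebb' subrr rnorm0; lra.
Qed.

Lemma inr_isometry (V : lmodType K) (E : modular V) (H : normedModType K) :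
  lin_isometry (fun h : H => (0, h) : modspace (msum E (sqnorm H))).
Proof.
split=> [a x y|x]; last by rewrite msum_norm_inr luxemburg_sqnorm.
by rewrite [RHS]surjective_pairing /= scaler0 addr0.
Qed.

Lemma inl_isometry (V1 V2 : lmodType K) (Th1 : modular V1) (Th2 : modular V2) :
  lin_isometry (fun x : modspace Th1 => (x, 0) : modspace (msum Th1 Th2)).
Proof.
split=> [a x y|x]; last by rewrite msum_norm_inl modspace_rnormE.
by rewrite [RHS]surjective_pairing /= scaler0 addr0.
Qed.

(** Upper bound: [B] embeds in the ultrapower, hence in [I -> X] and in [P]. Lower bound: a
    separated family indexed by [P] injects into the codes over [B], and these reduce to [B] because
    [P] is uncountable. *)
Lemma basis_ultrapower_card (A I P B : Type) (U : ultrafilter I) (c : P -> I -> nat)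
    (X : normedModType K) (V : lmodType K) (E : modular V) (H : normedModType K) (e : B -> H) :
  injects (I -> A) P -> injects (nat -> bool) P ->
  (forall p q, p <> q -> \forall i \near ultra_sets U, c p i <> c q i) ->
  separated_sequence X -> injects X A -> separable (modspace E) -> hbasis e ->
  isometric (ultrapower X U) (modspace (msum E (sqnorm H))) ->
  exists f : P -> B, bijective f.
Proof.
move=> IAP unc cP Xs XA Es eb iso; apply: injects_antisym.
  apply: (injects_basis unc); have [z zP] := separated_ultrapower cP Xs.
  have /isometric_inv[f [g [fi _ _ _]]] := iso.
  have h0 : 0 < 2^-1 :> R by rewrite invr_gt0.
  apply: (injects_basis_code (z := f \o z) Es eb h0) => p q pq /=.
  by rewrite (lin_isometry_dist fi); exact: zP.
apply: injects_trans (IAP); apply: (injects_trans _ (injects_fun I XA)).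
apply: (injects_trans _ (@injects_ultrapower X I U)).
apply: (injects_trans _ (isometric_injects iso)).
exists (fun b => (0, e b) : modspace (msum E (sqnorm H))).
move=> b b' /(lin_isometry_inj (@inr_isometry V E H)); exact: hbasis_inj.
Qed.

Lemma msum_isometric (V : lmodType K) (E : modular V) (H1 H2 : normedModType K) :
  isometric H1 H2 -> isometric (modspace (msum E (sqnorm H1))) (modspace (msum E (sqnorm H2))).
Proof.
move=> /isometricP[f [[fl fn] fs]]; apply/isomodular_isometric/isomodularP.
exists (fun z => (z.1, f z.2)); split.
- by move=> a [x y] [x' y']; rewrite [RHS]surjective_pairing /= fl.
- by move=> [x y] /=; rewrite fn.
- by move=> [x y]; have [y' <-] := fs y; exists (x, y').
Qed.

Lemma ultrapowers_isometric (X1 X2 : normedModType K) (V : lmodType K) (E : modular V) :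
  separable (modspace E) -> separated_sequence X1 -> separated_sequence X2 ->
  (forall (I : Type) (U : ultrafilter I), exists2 H : normedModType K, hilbert H &
    isometric (ultrapower X1 U) (modspace (msum E (sqnorm H)))) ->
  (forall (I : Type) (U : ultrafilter I), exists2 H : normedModType K, hilbert H &
    isometric (ultrapower X2 U) (modspace (msum E (sqnorm H)))) ->
  elementarily_equivalent X1 X2.
Proof.
move=> Es s1 s2 h1 h2.
(* The sum type dominates both spaces, so one ultrafilter and one cardinal [P] serve for the two
   ultrapowers. *)
have [I [P [U [c [IAP unc cP]]]]] := large_ultrafilter (X1 + X2)%type.
exists I, I, U, U; have [H1 hH1 iso1] := h1 I U; have [H2 hH2 iso2] := h2 I U.
have [B1 [e1 b1]] := hilbert_hbasis hH1; have [B2 [e2 b2]] := hilbert_hbasis hH2.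
have i1 : injects X1 (X1 + X2)%type by exists inl => x y [].
have i2 : injects X2 (X1 + X2)%type by exists inr => x y [].
have [f fb] := basis_ultrapower_card IAP unc cP s1 i1 Es b1 iso1.
have [g gb] := basis_ultrapower_card IAP unc cP s2 i2 Es b2 iso2.
have H12 : isometric H1 H2.
  exact: hbasis_isometric hH1 hH2 (hbasis_bij fb b1) (hbasis_bij gb b2).
apply: isometric_trans iso1 _; apply: isometric_trans (msum_isometric E H12) _.
exact: isometric_sym.
Qed.

(** Over a large index set, the ultrapower of an infinite dimensional Hilbert space has a basis into
    which [kappa] injects; the closed span of the corresponding vectors is the required space. *)
Lemma hilbert_of_dim (kappa : Type) (H : normedModType K) : hilbert H ->
  separated_sequence H ->
  exists2 H' : normedModType K, hilbert H' & exists e : kappa -> H', hbasis e.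
Proof.
move=> hH sH; have [I [P [U [c [IAP unc cP]]]]] := large_ultrafilter kappa.
have hU := hilbert_ultrapower U hH; have [B [e [eo ed]]] := hilbert_hbasis hU.
have [z zP] := separated_ultrapower cP sH.
have PB : injects P B.
  apply: (injects_basis unc).
  have h0 : 0 < 2^-1 :> R by rewrite invr_gt0.
  apply: (injects_dense (c := fun l : nat * seq (nat * B) => qcomb e l.2) h0 zP).
  move=> x r r0; have [_ [l _ <-] xl] := adherent_qcomb (ed x) r0.
  by exists (qcomb e l) => //; exists (0%N, l).
have [f fi] : injects kappa B.
  apply: injects_trans PB; apply: injects_trans IAP.
  have [i0 _] := @filter_ex _ (ultra_sets U) _ _ filterT.
  by exists (fun a _ => a) => a b /(congr1 (fun h => h i0)).
exact: orthonormal_closure hU (orthonormal_inj fi eo).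
Qed.

End Saturation.

(** * The space l_2 *)

Section Ell2Hilbert.
Context {R : realType} {k : scalar_kind}.
Local Notation K := (scalar_field R k).
Local Notation q := (ell2_modular R k).
Local Notation L := (modspace (ell2_modular R k)).
Implicit Types x y : ell2 R k.

Let sq (x : nat -> K^o) : R^nat := fun n => rnorm (x n : K) ^+ 2.

Let sq_cvg x : cvgn (series (sq x)).
Proof. exact/asboolP/(valP x). Qed.

Lemma sqsummable_bounded (x : nat -> K^o) (C : R) :
  (forall n, series (sq x) n <= C) -> x \in sqsummable /\ limn (series (sq x)) <= C.
Proof.
move=> xC; have c : cvgn (series (sq x)).
  apply: nondecreasing_is_cvgn; last by exists C => _ [n _ <-].
  by apply: nondecreasing_series => i _ _; exact: sqr_ge0.
split; first exact/asboolP.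
by apply: limr_le c _; apply: nearW.
Qed.

Lemma ell2_partial_le x n : series (sq x) n <= q x.
Proof.
apply: nondecreasing_cvgn_le (@sq_cvg x) n.
by apply: nondecreasing_series => i _ _; exact: sqr_ge0.
Qed.

Lemma ell2_quadratic (a : R) x : q (ofR a *: x) = a ^+ 2 * q x.
Proof.
rewrite -[RHS](lim_seriesZ (a ^+ 2) (@sq_cvg x)); congr (limn (series _)).
apply/funext => n.
have h : rnorm (ofR a * (x n : K)) ^+ 2 = a ^+ 2 * rnorm (x n : K) ^+ 2.
  by rewrite rnormM rnorm_ofR exprMn real_normK// num_real.
exact: h.
Qed.

Lemma ell2_rnorm (x : L) : rnorm x ^+ 2 = q x.
Proof. by rewrite modspace_rnormE luxemburg_quadratic//; exact: ell2_quadratic. Qed.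

Lemma parallelogram_scalar (a b : K) :
  rnorm (a + b) ^+ 2 + rnorm (a - b) ^+ 2 = 2 * (rnorm a ^+ 2 + rnorm b ^+ 2).
Proof.
rewrite !rnorm_re_im re_additive.
have imD : imK (a + b) = imK a + imK b.
  by have := (re_imB a (- b)).2; have := (re_imB 0 b).2; have := (re_imB 0 (0 : K)).2; rewrite !subrr sub0r opprK => -> ->; lra.
by have [-> ->] := re_imB a b; rewrite imD; ring.
Qed.

Lemma ell2_parallelogram : parallelogram L.
Proof.
apply: parallelogram_modspace => [|x y]; first exact: ell2_quadratic.
rewrite -[LHS](lim_seriesD (@sq_cvg (x + y)) (@sq_cvg (x - y))).
have xy := is_cvg_seriesD (@sq_cvg x) (@sq_cvg y).
rewrite -[q x + q y](lim_seriesD (@sq_cvg x) (@sq_cvg y)).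
rewrite -[RHS](lim_seriesZ 2 xy); congr (limn (series _)).
by apply/funext => n; exact: parallelogram_scalar.
Qed.

Lemma ell2_coord_le (x : L) n : rnorm (x n : K) <= rnorm x.
Proof.
rewrite -ler_sqr ?nnegrE ?rnorm_ge0// ell2_rnorm.
apply: le_trans (ell2_partial_le x n.+1).
by rewrite seriesSr lerDr sumr_ge0// => i _; exact: sqr_ge0.
Qed.

Lemma fast_scalar (u : nat -> K) : (forall n, rnorm (u n.+1 - u n) <= 2^-1 ^+ n) ->
  exists l, forall n, rnorm (u n - l) <= 2 * 2^-1 ^+ n.
Proof.
move=> uf; have [W Wfree] := free_ultrafilter.
have ud m n : (m <= n)%N -> rnorm (u m - u n) <= 2 * 2^-1 ^+ m.
  by move=> mn; rewrite -rnormN opprB; exact: (@fast_dist _ _ K^o u uf).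
have ub n : rnorm (u n) <= rnorm (u 0%N) + 2.
  have := ud 0%N n (leq0n n); rewrite expr0 mulr1 => h.
  by rewrite -[u n](subKr (u 0%N)); apply: le_trans (rnormD _ _) _; rewrite rnormN lerD2l.
have [l lP] := ultralimit_scalar W ub; exists l => n.
apply/ler_addgt0Pl => e e0.
have [m /= [ml nm]] := filter_ex (filterI (lP e e0) (Wfree n)).
rewrite -[u n - l](subrKA (u m)); apply: le_trans (rnormD _ _) _.
by have := ud _ _ nm; lra.
Qed.

Lemma banach_ell2 : banach L.
Proof.
apply/banachP => u uf.
have /choice[l lP] : forall m, exists l : K, forall n, rnorm ((u n m : K) - l) <= 2 * 2^-1 ^+ n.
  move=> m; apply: (fast_scalar (u := fun n => u n m)) => n.
  exact: le_trans (ell2_coord_le (u n.+1 - u n) m) (uf n).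
have bnd n N : series (sq (fun m => (u n m : K) - l m)) N <= (2 * 2^-1 ^+ n) ^+ 2.
  have part n' : (n <= n')%N ->
      series (sq (fun m => (u n m : K) - u n' m)) N <= (2 * 2^-1 ^+ n) ^+ 2.
    move=> nn'; apply: le_trans (ell2_partial_le (u n - u n') N) _.
    rewrite -[q _](ell2_rnorm (u n - u n' : L)) ler_sqr ?nnegrE ?rnorm_ge0//.
      by rewrite rnormBC; exact: fast_dist.
    by rewrite mulr_ge0// ltW// half_gt0.
  have lim m : rnorm ((u n m : K) - u n' m) ^+ 2 @[n' --> \oo] -->
      rnorm ((u n m : K) - l m) ^+ 2.
    have c : rnorm ((u n m : K) - u n' m) @[n' --> \oo] --> rnorm ((u n m : K) - l m).
      apply/cvgrPdist_lt => e e0; have [M MP] := half_small 2 e0.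
      exists M => //= n' /= Mn'.
      have := ler_rnorm_dist (X := K^o) ((u n m : K) - l m) ((u n m : K) - u n' m).
      move=> /le_lt_trans; apply.
      rewrite (_ : _ - _ = (u n' m : K) - l m); last by rewrite opprB addrC addrA subrK.
      apply: le_lt_trans (lP m n') (le_lt_trans _ MP).
      by rewrite ler_wpM2l// half_le.
    by rewrite expr2; under eq_fun do rewrite expr2; exact: cvgM.
  have slim : series (sq (fun m => (u n m : K) - u n' m)) N @[n' --> \oo] -->
      series (sq (fun m => (u n m : K) - l m)) N.
    elim: N {part} => [|N IH].
      rewrite /series /= big_geq//; under eq_fun do rewrite big_geq//; exact: cvg_cst.
    rewrite seriesSr; under eq_fun do rewrite seriesSr.
    by apply: cvgD => //; exact: lim.
  rewrite -(cvg_lim (@Rhausdorff R) slim); apply: limr_le; first exact: cvgP slim.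
  by exists n => //= n' /=; exact: part.
(* The coordinatewise limit [l] is not yet known to be square summable, but [u 0 - l] is, by the
   bound at [n = 0]; hence [l] is represented as [u 0 - v]. *)
have [vs _] := sqsummable_bounded (bnd 0%N).
pose v : ell2 R k := Ell2 vs.
have lE m : (u 0%N - v) m = l m :> K by exact: subKr.
exists (u 0%N - v : L) => n.
rewrite -ler_sqr ?nnegrE ?rnorm_ge0//; last by rewrite mulr_ge0// ltW// half_gt0.
rewrite ell2_rnorm.
have := (sqsummable_bounded (bnd n)).2; apply: le_trans.
rewrite le_eqVlt; apply/orP; left; apply/eqP; congr (limn (series _)).
by apply/funext => m; rewrite /sq -lE.
Qed.

Lemma hilbert_ell2 : hilbert L.
Proof. by apply/hilbertP; split; [exact: banach_ell2|exact: ell2_parallelogram]. Qed.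

Lemma separated_ell2 : separated_sequence L.
Proof.
pose d (n m : nat) : K^o := (m == n)%:R.
have ds n N : series (sq (d n)) N <= 1.
  have -> : series (sq (d n)) N = (n < N)%:R.
    elim: N => [|N IH]; first by rewrite /series /= big_geq.
    rewrite seriesSr IH /sq /d rnorm_nat [in RHS]ltnS [in RHS]leq_eqVlt [n == N]eq_sym.
    have [->|_] := eqVneq N n; first by rewrite ltnn expr1n add0r.
    by rewrite expr0n addr0.
  by case: (n < N)%N.
pose e n : L := Ell2 (sqsummable_bounded (ds n)).1.
exists e; split=> [n|m n mn].
  rewrite -ler_sqr ?nnegrE ?rnorm_ge0// ell2_rnorm expr1n.
  exact: (sqsummable_bounded (ds n)).2.
have := ell2_coord_le (e n - e m) n.
rewrite (_ : (e n - e m) n = d n n - d m n)// /d eqxx gtn_eqF// subr0 (rnorm_nat 1).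
by apply: le_trans; lra.
Qed.

End Ell2Hilbert.

(** * Ultrapowers of modular sums *)

Section SumUltrapower.
Context {R : realType} {k : scalar_kind}.
Local Notation K := (scalar_field R k).

Lemma modular_isometry (V1 V2 : lmodType K) (Th1 : modular V1) (Th2 : modular V2)
    (f : V1 -> V2) : linear f -> (forall x, Th2 (f x) = Th1 x) ->
  lin_isometry (f : modspace Th1 -> modspace Th2).
Proof.
move=> fl fm; split=> // x; rewrite !modspace_rnormE; apply: luxemburg_morph => // a y.
by rewrite -!(mklinE fl) linearZ.
Qed.

Lemma fst_contraction (V1 V2 : lmodType K) (Th1 : modular V1) (Th2 : modular V2) :
  contraction (fun z : modspace (msum Th1 Th2) => z.1 : modspace Th1).
Proof. by split=> // z; rewrite modspace_rnormE; exact: msum_norm_ge1. Qed.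

Lemma snd_contraction (V : lmodType K) (E : modular V) (H : normedModType K) :
  contraction (fun z : modspace (msum E (sqnorm H)) => z.2 : H).
Proof. by split=> // z; rewrite -luxemburg_sqnorm; exact: msum_norm_ge2. Qed.

(** The ultrapowers [p1] and [p2] of the two projections give the components in [E_U] and [H_U]; the
    summand [H'] of [E_U] is then regrouped with [H_U] into one Hilbert space. *)
Lemma isomodular_ultra_sum (V : lmodType K) (E : modular V) (H H' : normedModType K)
    (I : Type) (U : ultrafilter I) : Delta2 E ->
  isomodular (ultra_modular E U) (msum E (sqnorm H')) ->
  isomodular (ultra_modular (msum E (sqnorm H)) U)
    (msum E (sqnorm (hsum H' (ultrapower H U)))).
Proof.
move=> D2 /isomodularP[T [Tl Tm Ts]].
have D2' : Delta2 (msum E (sqnorm H)) := Delta2_msum D2 (Delta2_sqnorm H).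
pose p1 := ultra_map (fst_contraction E (sqnorm H)) (U := U).
pose p2 := ultra_map (snd_contraction E H) (U := U).
apply/isomodularP; exists (fun z => ((T (p1 z)).1, ((T (p1 z)).2, p2 z))); split.
- move=> a z w; rewrite /p1 /p2 !ultra_map_linear Tl.
  by rewrite [RHS]surjective_pairing /= [X in (_, X) = _]surjective_pairing.
- move=> z; have [x ->] := ultra_classP z; rewrite /=.
  have TmE := Tm (p1 (ultra_class U x)); rewrite /= in TmE.
  rewrite hsum_norm /= addrA TmE.
  rewrite /p1 /p2 !ultra_mapE ultra_class_rnormE.
  set x1 := mklinf _; set x2 := mklinf _.
  have c : E (x1 i) + rnorm (x2 i) ^+ 2 @[i --> ultra_sets U] -->
      ultra_modular E U (ultra_class U x1) + ultra_norm U x2 ^+ 2.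
    apply: cvgD; first exact: ultra_modular_lim.
    by rewrite expr2; under eq_fun do rewrite expr2; apply: cvgM; exact: ultra_norm_cvg.
  have c' : msum E (sqnorm H) (x i) @[i --> ultra_sets U] -->
      ultra_modular E U (ultra_class U x1) + ultra_norm U x2 ^+ 2 by exact: c.
  by rewrite -(cvg_unique (@Rhausdorff R) c' (ultra_modular_lim D2')).
- move=> [e [h' g]]; have [w wE] := Ts (e, h').
  have [[y yE] [u uE]] := (ultra_classP w, ultra_classP g).
  have xb : exists M : R, forall i, rnorm ((y i, u i) : modspace (msum E (sqnorm H))) <= M.
    have [[M1 h1] [M2 h2]] := (linf_bounded y, linf_bounded u); exists (M1 + M2) => i.
    apply: le_trans (msum_norm_le _) _; rewrite luxemburg_sqnorm -modspace_rnormE.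
    exact: lerD (h1 i) (h2 i).
  exists (ultra_class U (mklinf xb)).
  rewrite /p1 /p2 (@ultra_map_class _ _ _ _ _ _ _ U (mklinf xb) y)//
    (@ultra_map_class _ _ _ _ _ _ _ U (mklinf xb) u)//.
  by rewrite -yE -uE wE.
Qed.

Lemma zero_hilbert : exists2 H : normedModType K, hilbert H & forall h : H, h = 0.
Proof.
pose L := modspace (ell2_modular R k).
have A0 a (x y : L) : x = 0 -> y = 0 -> a *: x + y = 0.
  by move=> -> ->; rewrite scaler0 addr0.
pose A := @Subspace R k L (fun x => x = 0) erefl A0.
exists (subspace_type A); last by move=> h; apply/val_inj; exact: (subspace_valP h).
apply: hilbert_subspace; first exact: hilbert_ell2.
move=> x h; apply/rnorm0_eq0/le_anti; rewrite rnorm_ge0 andbT.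
by apply/ler_addgt0Pl => e e0; have [_ -> /ltW] := h e e0; rewrite subr0 addr0.
Qed.

(** A finite dimensional space coincides with its ultrapowers, so the Hilbert summand is the zero
    space, and the description of ultrapowers of sums serves in both halves of the theorem. *)
Lemma finite_dim_isomodular (V : lmodType K) (E : modular V) (I : Type) (U : ultrafilter I) :
  Delta2 E -> finite_dim V -> exists2 H : normedModType K, hilbert H &
    isomodular (ultra_modular E U) (msum E (sqnorm H)).
Proof.
move=> D2 Vf; have [H hH H0] := zero_hilbert; exists H => //; apply/isomodularP.
have di := diag_isometry (modspace E) U.
have /choice[f fP] := @finite_dim_diag R k (modspace E) I U Vf.
have fK x : f (diag U x) = x by apply: (lin_isometry_inj di); rewrite -fP.
exists (fun z => (f z, 0)); split.
- move=> a z w; rewrite [RHS]surjective_pairing /= scaler0 addr0; congr pair.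
  by rewrite [z in LHS]fP [w in LHS]fP -di.1 fK.
- move=> z /=; rewrite rnorm0 expr0n addr0 [in RHS](fP z).
  have c : E (f z) @[i --> ultra_sets U] --> E (f z) by exact: cvg_cst.
  have := @ultra_modular_lim _ _ _ _ _ U (mklinf (@const_bounded R k (modspace E) I (f z))) D2.
  exact: (cvg_unique (@Rhausdorff R) c).
- by move=> [e h]; exists (diag U (e : modspace E)); rewrite fK (H0 h).
Qed.

Lemma isomodular_ell2_sum (V : lmodType K) (E : modular V) :
  isomodular (msum E (ell2_modular R k))
    (msum E (sqnorm (modspace (ell2_modular R k)))).
Proof.
apply/isomodularP; exists id; split=> // [x|y]; last by exists y.
by rewrite /= ell2_rnorm.
Qed.

End SumUltrapower.

(** * Splitting off the rigid summand *)

Section Core.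
Context {R : realType} {k : scalar_kind}.
Local Notation K := (scalar_field R k).
Variables (V : lmodType K) (E : modular V).
Local Notation sumE H := (modspace (msum E (sqnorm H))).

(* The ultrapower of [diag : Y -> Y_U] and [diag : Y_U -> (Y_U)_U] give two
   embeddings of [G] into [(Y_U)_U], which is a space [sumE H']. By rigidity they
   have the same image on [G0], so [g (e, 0)] is a limit of elements of [Y]. *)
Lemma summand_in_range (G : normedModType K) (G0 : G -> Prop) (Y H H' : normedModType K)
    (I : Type) (U : ultrafilter I) (S : G -> sumE H)
    (f : ultrapower Y U -> sumE H) (g : sumE H -> ultrapower Y U)
    (h : ultrapower (sumE H) U -> sumE H') :
  banach Y -> lin_isometry S -> lin_isometry f -> lin_isometry g -> cancel g f ->
  lin_isometry h ->
  (forall T : G -> sumE H, lin_isometry T ->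
    forall z, (exists2 x, G0 x & T x = z) <-> z.2 = 0) ->
  (forall T : G -> sumE H', lin_isometry T ->
    forall z, (exists2 x, G0 x & T x = z) <-> z.2 = 0) ->
  forall e, exists y, f (diag U y) = (e, 0).
Proof.
move=> Yb Si fi gi gK hi GH GH' e.
have di := diag_isometry Y U.
pose fU := ultra_map (lin_isometry_contraction fi) (U := U).
pose dU := ultra_map (lin_isometry_contraction di) (U := U).
have fUi : lin_isometry fU by exact: ultra_map_isometry fi.2.
have dUi : lin_isometry dU by exact: ultra_map_isometry di.2.
have ddi := diag_isometry (ultrapower Y U) U.
have hfi := lin_isometry_comp hi fUi; have gSi := lin_isometry_comp gi Si.
have A1 := lin_isometry_comp hfi (lin_isometry_comp dUi gSi).
have A2 := lin_isometry_comp hfi (lin_isometry_comp ddi gSi).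
(* [G0] is all of [E] in one application and the summand [E] of [E + l_2] in the other. By rigidity
   both composites send it onto the first summand, so the diagonal image of [g (S x0)] is also the
   [dU]-image of some [g (S x1)], that is, the class of a family of diagonal elements. *)
have [x0 x0G x0E] : exists2 x, G0 x & S x = (e, 0) by apply/(GH _ Si).
have /(GH' _ A2) A20 : exists2 x, G0 x &
    ((h \o fU) \o (diag U \o (g \o S))) x = h (fU (diag U (g (S x0)))) by exists x0.
have /(GH' _ A1)[x1 x1G /= /(lin_isometry_inj hi)/(lin_isometry_inj fUi)] := A20.
rewrite x0E; have [y ->] := ultra_classP (g (S x1)).
have db : exists M : R, forall i, rnorm (diag U (y i)) <= M.
  by have [M MP] := linf_bounded y; exists M => i; rewrite di.2.
rewrite /dU (@ultra_map_class _ _ _ _ _ _ _ U y (mklinf db))// => yE.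
have [w _ wE] : range (diag U) (g (e, 0)).
  apply: (adherent_range Yb (lin_isometry_dist di)) => r r0.
  have : rnorm (ultra_class U (mklinf db) - diag U (g (e, 0))) < r.
    by rewrite yE subrr rnorm0.
  move=> /diag_dist/filter_ex[i /= ir]; exists (diag U (y i)); first by exists (y i).
  by rewrite rnormBC.
by exists w; rewrite wE gK.
Qed.

(** Since the range of [j] contains [E + 0], first coordinates can be subtracted within it, so it is
    the sum of [E] and of its intersection with [H]. That intersection is closed because [Y] is
    complete. *)
Lemma split_summand (Y H : normedModType K) (j : Y -> sumE H) :
  banach Y -> hilbert H -> lin_isometry j -> (forall e, exists y, j y = (e, 0)) ->
  exists2 H' : normedModType K, hilbert H' & isometric Y (sumE H').
Proof.
move=> Yb hH ji jE.
have j0 : j 0 = 0 by rewrite -(mklinE ji.1) linear0.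
have jD x y : j (x + y) = j x + j y by rewrite -!(mklinE ji.1) linearD.
have jB x y : j (x - y) = j x - j y by rewrite -!(mklinE ji.1) linearB.
have A0 : exists y, j y = (0, 0) by exists 0.
have AP a h h' : (exists y, j y = (0, h)) -> (exists y, j y = (0, h')) ->
    exists y, j y = (0, a *: h + h').
  move=> [y yE] [y' y'E]; exists (a *: y + y'); rewrite ji.1 yE y'E.
  by rewrite [LHS]surjective_pairing /= scaler0 addr0.
pose A := @Subspace R k H (fun h => exists y, j y = (0, h)) A0 AP.
have hA : hilbert (subspace_type A).
  apply: hilbert_subspace => // h hadh.
  have [y _ yE] : range j ((0, h) : sumE H).
    apply: (adherent_range Yb (lin_isometry_dist ji)) => r r0.
    have [h' [y yE] hh'] := hadh r r0; exists (j y); first by exists y.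
    rewrite yE (_ : _ - _ = (0, h - h') :> sumE H).
      by rewrite msum_norm_inr luxemburg_sqnorm.
    by rewrite [LHS]surjective_pairing /= subrr.
  by exists y.
exists (subspace_type A) => //.
pose J (z : sumE (subspace_type A)) : sumE H := (z.1, subspace_val z.2).
have Ji : lin_isometry J by apply: modular_isometry.
have /choice[F FP] : forall y, exists z, J z = j y.
  move=> y; have [y' y'E] := jE (j y).1.
  have hy : A (j y).2.
    exists (y - y'); rewrite jB y'E [LHS]surjective_pairing /= subrr subr0 //.
  by exists ((j y).1, in_sub hy); rewrite /J /= -surjective_pairing.
apply/isometricP; exists F; split; first split=> [a x y|x].
- by apply: (lin_isometry_inj Ji); rewrite Ji.1 !FP ji.1.
- by rewrite -Ji.2 FP ji.2.
move=> [e h]; have [[y1 y1E] [y2 y2E]] := (jE e, subspace_valP h).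
exists (y1 + y2); apply: (lin_isometry_inj Ji); rewrite FP jD y1E y2E.
by rewrite [LHS]surjective_pairing /= addr0 add0r.
Qed.

End Core.

(** * Separability of rigid spaces *)

Section Separability.
Context {R : realType} {k : scalar_kind}.
Local Notation K := (scalar_field R k).
Variable X : normedModType K.

Definition separated_family (A : Type) (d : R) (e : A -> X) : Prop :=
  forall a b, a <> b -> d <= rnorm (e a - e b).

Lemma maximal_separated (d : R) : exists2 S : set X,
  separated_family d (fun x : {x | S x} => sval x) &
  0 < d -> forall x, exists2 s, S s & rnorm (x - s) < d.
Proof.
pose P (S : set X) := forall x y, S x -> S y -> x <> y -> d <= rnorm (x - y).
have [F FP Ftot|S [SP Smax]] := @Zorn_bigcup _ P.
  move=> x y [Y FY Yx] [Z FZ Zy].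
  have [YZ|ZY] := Ftot _ _ FY FZ; first by apply: (FP Z) => //; exact: YZ.
  by apply: (FP Y) => //; exact: ZY.
exists S => [a b ab|d0 x].
  apply: SP; [exact: svalP|exact: svalP|move=> h; apply: ab].
  by apply: eq_sig_hprop h => ?; exact: Prop_irrelevance.
apply: contrapT => h; have far s : S s -> d <= rnorm (x - s).
  by move=> Ss; rewrite leNgt; apply/negP => lt; apply: h; exists s.
apply: (Smax (S `|` [set x])).
  split=> [s|/(_ x (or_intror erefl)) Sx]; first by left.
  by have := far x Sx; rewrite subrr rnorm0 leNgt d0.
move=> s t [Ss|->] [St|->] st //; [exact: SP|rewrite rnormBC; exact: far|exact: far].
Qed.

(** If all separated families were countable, maximal [2^-1 ^+ n]-separated sets, taken over all
    [n], would together form a countable dense set. *)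
Lemma nonseparable_family : ~ separable X ->
  exists (A : Type) (e : A -> X) (d : R), [/\ 0 < d, separated_family d e & ~ injects A nat].
Proof.
move=> nsep; apply: contrapT => h; apply: nsep; apply/separableP.
have /choice[S SP] : forall n, exists S : set X,
    injects {x | S x} nat /\ forall x, exists2 s, S s & rnorm (x - s) < 2^-1 ^+ n.
  move=> n; have [S S1 S2] := maximal_separated (2^-1 ^+ n).
  exists S; split; last exact: S2 (half_gt0 n).
  by apply: contrapT => Snat; apply: h; exists {x | S x}, (fun x => sval x), (2^-1 ^+ n);
    split=> //; exact: half_gt0.
pose f n := sval (cid (SP n).1); have fi n : injective (f n) := svalP (cid (SP n).1).
have /choice[d dP] : forall c : nat, exists x : X, forall n (s : {x | S n x}),
    c = pickle (n, f n s) -> x = sval s.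
  move=> c; have [[n [s cE]]|hn] := pselect (exists n, exists s : {x | S n x}, c = pickle (n, f n s)).
    exists (sval s) => n' s'; rewrite cE => /(pcan_inj pickleK)[nn'].
    by move: s' {cE}; rewrite -nn' => s' /(fi n) ->.
  by exists 0 => n s cE; case: hn; exists n, s.
exists d => x r r0; have [n nP] := half_small 1 r0; rewrite mul1r in nP.
have [s Ss xs] := (SP n).2 x; exists s; last exact: lt_trans xs nP.
by exists (pickle (n, f n (exist _ s Ss))) => //; apply: (dP _ _ (exist _ s Ss)).
Qed.

(** The left summand lists norms to be preserved with a given precision. The right one forbids a
    value, which prevents the images of [e a] from settling on one vector. *)
Definition requirement : Type := (seq (nat * X) * nat + X)%type.

(* [t] carries finitely many vectors to vectors with almost the same rational
   linear relations, so that [t] is almost an isometry of their span. *)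
Definition meets (t : X -> X) (x : X) (r : requirement) : Prop :=
  match r with
  | inl (l, m) => `|rnorm (qcomb t l) - rnorm (qcomb id l)| <= 2^-1 ^+ m
  | inr y => x <> y
  end.

Definition vectors (s : seq requirement) : seq X :=
  flatten [seq if r is inl (l, _) then map snd l else [::] | r <- s].

(** Vectors are replaced by their positions in [vs] and norms by integer parts at scale [2 ^+ m],
    which leaves countably many codes. *)
Definition requirement_code (vs : seq X) (r : requirement) :
    option (seq (nat * nat) * nat * nat) :=
  if r is inl (l, m) then
    Some ([seq (p.1, index p.2 vs) | p <- l], m, Num.truncn (rnorm (qcomb id l) * 2 ^+ m))
  else None.

Lemma inlist_vectors (s : seq requirement) (l : seq (nat * X)) (m : nat) p :
  inlist (inl (l, m)) s -> p \in l -> p.2 \in vectors s.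
Proof.
elim: s => //= r s IH [<-|h] pl; rewrite /vectors /= mem_cat.
  by rewrite map_f.
by rewrite [X in _ || X]IH// orbT.
Qed.

Lemma inlist_map (S T1 T2 : Type) (F : T1 -> S) (G : T2 -> S) s t x :
  map F s = map G t -> inlist x s -> exists2 y, inlist y t & F x = G y.
Proof.
elim: s t => //= a s IH [|b t] //= [ab st] [->|/(IH _ st)[y yt xy]].
  by exists b => //; left.
by exists y => //; right.
Qed.

Lemma truncn_near (x y : R) (m : nat) : 0 <= x -> 0 <= y ->
  Num.truncn (x * 2 ^+ m) = Num.truncn (y * 2 ^+ m) -> `|x - y| <= 2^-1 ^+ m.
Proof.
move=> x0 y0 e; have p0 : 0 < 2 ^+ m :> R by rewrite exprn_gt0.
have := @truncn_itv _ _ (mulr_ge0 x0 (ltW p0)); have := @truncn_itv _ _ (mulr_ge0 y0 (ltW p0)).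
rewrite e -natr1 => /andP[h1 h2] /andP[h3 h4].
rewrite exprVn -[leRHS]mul1r ler_pdivlMr// -{1}(ger0_norm (ltW p0)) -normrM.
by rewrite mulrBl ler_norml; apply/andP; split; lra.
Qed.

(* Otherwise each [a] has a list [s a] of requirements that [e b] can only satisfy
   when it belongs to the finite set [avoid a]. The relations listed in [s a],
   with rounded norms, form a countable [code a]; if [code a = code b], matching
   the two lists of vectors shows that [e b] satisfies the relations of [s a].
   So the fibres of [code] are finite, and [A] is countable. *)
Lemma pigeonhole (A : Type) (e : A -> X) : injective e -> ~ injects A nat ->
  exists a, forall s : seq requirement, exists (t : X -> X) (b : A),
    t (e a) = e b /\ forall r, inlist r s -> meets t (e b) r.
Proof.
move=> ei unc; apply: contrapT => h; apply: unc.
have /choice[s sP] : forall a, exists s : seq requirement, forall (t : X -> X) (b : A),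
    t (e a) = e b -> ~ (forall r, inlist r s -> meets t (e b) r).
  move=> a; apply: contrapT => ha; apply: h; exists a => s; apply: contrapT => hs.
  by apply: ha; exists s => t b tab hr; apply: hs; exists t, b.
pose vs a := e a :: vectors (s a).
pose code a := map (requirement_code (vs a)) (s a).
pose avoid a := pmap (fun r : requirement => if r is inr y then Some y else None) (s a).
have mem_avoid a y : inlist (inr y) (s a) -> y \in avoid a.
  rewrite /avoid; elim: (s a) => //= r u IH [<-|/IH]; first by rewrite mem_head.
  by case: r => //= z; rewrite in_cons => ->; rewrite orbT.
have same a b : code a = code b -> e b \in avoid a.
  (* [t] matches the two lists of vectors by position; [e a] was put at the head of [vs a] so that
     it goes to [e b]. *)
  move=> ab; pose t x := nth 0 (vs b) (index x (vs a)).
  have ta : t (e a) = e b by rewrite /t /= eqxx.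
  apply: contrapT => nb; apply: (sP a t b ta) => -[[l m]|y] rin /=; last first.
    by move=> bE; apply: nb; rewrite bE; exact: mem_avoid.
  have [[[l' m']|z] rin' rE] := inlist_map ab rin; last by [].
  case: rE => lE mE nE.
  have -> : qcomb t l = qcomb id l'.
    rewrite /qcomb /comb !big_map.
    have sub' p : p \in l' -> p.2 \in vs b.
      by move=> pl; rewrite in_cons (inlist_vectors rin' pl) orbT.
    elim: l l' lE sub' {rin rin' nE} => [|p l IH] [|p' l'] //=; first by rewrite !big_nil.
    move=> [p1 p2 ll'] sub'; rewrite !big_cons /= (IH l')//; last by move=> q ql; apply: sub'; rewrite in_cons ql orbT.
    congr (_ *: _ + _); first by rewrite p1.
    rewrite -[RHS](nth_index 0 (s := vs b)) ?sub' ?mem_head//.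
    by congr (nth _ _ _); exact: p2.
  rewrite distrC; apply: truncn_near; [exact: rnorm_ge0|exact: rnorm_ge0|].
  by rewrite [in RHS]mE; exact: nE.
pose C := seq (option (seq (nat * nat) * nat * nat)).
have /choice[rep repP] : forall c : C, exists u : seq X, forall b, code b = c -> e b \in u.
  move=> c; have [[a aE]|nc] := pselect (exists a, code a = c).
    by exists (avoid a) => b bE; apply: same; rewrite aE bE.
  by exists [::] => b bE; case: nc; exists b.
(* The code of [a], and a position in a finite list containing all vectors with that code, determine
   [a]. *)
exists (fun a => pickle (code a, index (e a) (rep (code a)))).
move=> a b /(pcan_inj pickleK)[ab iab]; apply: ei.
rewrite -[LHS](nth_index 0 (repP _ a erefl)) iab -ab nth_index//.
exact: repP.
Qed.

(** The maps [t i] need not be linear; linearity of the limit comes from the combination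
    [-(a x + y) + q x + y] with [q] a rational scalar close to [a], whose norm is small and stays
    small under [t i]. *)
Lemma rational_isometry (I : Type) (U : ultrafilter I) (t : I -> X -> X) :
  (forall l m, \forall i \near ultra_sets U,
    `|rnorm (qcomb (t i) l) - rnorm (qcomb id l)| <= 2^-1 ^+ m) ->
  exists2 T : X -> ultrapower X U, lin_isometry T &
    forall x y d, T x = diag U y -> 0 < d -> \forall i \near ultra_sets U, rnorm (t i x - y) < d.
Proof.
move=> tP.
have [one oneE] : exists n, qscalar n = 1 :> K.
  exists (pickle (1 : rat, 0 : rat)).
  by rewrite /qscalar pickleK rmorph1 rmorph0 ofR1 ofR0 mulr0 addr0.
have [mone moneE] : exists n, qscalar n = -1 :> K.
  exists (pickle (-1 : rat, 0 : rat)).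
  by rewrite /qscalar pickleK rmorphN1 rmorph0 ofRN ofR1 ofR0 mulr0 addr0.
have tn x m : \forall i \near ultra_sets U, `|rnorm (t i x) - rnorm x| <= 2^-1 ^+ m.
  have := tP [:: (one, x)] m; apply: filterS => i.
  by rewrite /qcomb /comb /= !big_seq1 /= oneE !scale1r.
(* A family must be bounded at every index, so large values are replaced by [0]; the case [m = 0] of
   [tn] shows that this happens on a negligible set only. *)
pose f x i := if rnorm (t i x) <= rnorm x + 1 then t i x else 0.
have fb x : exists M : R, forall i, rnorm (f x i) <= M.
  exists (rnorm x + 1) => i; rewrite /f; case: ifP => [h|_]; first exact: h.
  by rewrite rnorm0; exact: addr_ge0 (rnorm_ge0 _) ler01.
have fE x : \forall i \near ultra_sets U, f x i = t i x /\ rnorm (t i x) <= rnorm x + 1.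
  have := tn x 0%N; apply: filterS => i; rewrite expr0 ler_norml => /andP[_ h].
  have h' : rnorm (t i x) <= rnorm x + 1 by move: h; clear; lra.
  by rewrite /f h'; split.
exists (fun x => ultra_class U (mklinf (fb x))); last first.
  move=> x y d Txy d0.
  have h : rnorm (ultra_class U (mklinf (fb x)) - diag U y) < d by rewrite Txy subrr rnorm0.
  by apply: filterS2 (diag_dist h) (fE x) => i /= h1 [<-].
split=> [a x y|x].
  rewrite ultra_classZE -ultra_classD; apply/ultra_class_eqP/le_anti.
  rewrite ultra_norm_ge0 andbT; apply/ler_addgt0Pl => d d0; rewrite addr0.
  apply: ultra_norm_le.
  (* The error [|a - q|] is paid once on [x] and once on [t i x], whose norm is at most that of [x]
     plus [1]. *)
  have c0 : 0 < 2 * rnorm x + 1 by clear; have := rnorm_ge0 x; lra.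
  have d2 : 0 < d / 2 by clear -d0; rewrite divr_gt0.
  have [n nP] := qscalar_dense a (divr_gt0 d2 c0).
  have [m mP] := half_small 1 d2; rewrite mul1r in mP.
  have FU : Filter (ultra_sets U) by exact: filter_filter.
  have andU := @filterI _ _ FU.
  have h1 := andU _ _ (fE (a *: x + y)) (andU _ _ (fE x) (fE y)).
  have h2 := tP [:: (mone, a *: x + y); (n, x); (one, y)] m.
  apply: filterS (andU _ _ h1 h2) => i [[[e1 _] [[e2 b2] [e3 _]]]]; clear tP tn fE h1 h2.
  rewrite /qcomb /comb /= !(big_cons, big_nil) /= !addr0 oneE moneE !scale1r !scaleN1r.
  rewrite (_ : - (a *: x + y) + (qscalar n *: x + y) = (qscalar n - a) *: x); last first.
    by rewrite scalerBl addrC opprD addrACA subrr addr0.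
  rewrite rnormZ -[rnorm (qscalar n - a)]rnormN opprB ler_norml => /andP[_ h].
  suff g : rnorm (f (a *: x + y) i - (a *: f x i + f y i)) <= d by exact: g.
  rewrite e1 e2 e3.
  have -> : t i (a *: x + y) - (a *: t i x + t i y) =
      - (- t i (a *: x + y) + (qscalar n *: t i x + t i y)) - (a - qscalar n) *: t i x.
    rewrite scalerBl !opprD !opprK -!addrA; congr (_ + _).
    rewrite addrCA addrA addrC addrA.
    by rewrite [RHS]addrAC addrK.
  apply: le_trans (rnormD _ _) _; rewrite !rnormN rnormZ.
  have q0 := rnorm_ge0 (a - qscalar n).
  have h3 := ler_wpM2l q0 b2.
  move: nP; rewrite ltr_pdivlMr// mulrDr mulr1 mulrDr mulr1 in h3 * => nP.
  by lra.
rewrite ultra_class_rnormE; apply/le_anti/andP; split.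
  apply/ler_addgt0Pl => d d0; have [m mP] := half_small 1 d0; rewrite mul1r in mP.
  apply: ultra_norm_le; apply: filterS2 (tn x m) (fE x) => i + [/= -> _].
  by clear -mP; rewrite ler_norml => /andP[_]; lra.
apply/ler_addgt0Pl => d d0; have [m mP] := half_small 1 d0; rewrite mul1r in mP.
rewrite -lerBlDl; apply: ultra_norm_ge; apply: filterS2 (tn x m) (fE x) => i + [/= -> _].
by clear -mP; rewrite ler_norml => /andP[+ _]; lra.
Qed.

Lemma separable_of_rigid :
  (forall (I : Type) (U : ultrafilter I) (T : X -> ultrapower X U), lin_isometry T ->
    forall x, exists y, T x = diag U y) -> separable X.
Proof.
move=> rigid; apply: contrapT => /nonseparable_family[A [e [d [d0 ed unc]]]].
have ei : injective e.
  by move=> a b ab; apply: contrapT => /ed; rewrite ab subrr rnorm0 leNgt d0.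
have [a aP] := pigeonhole ei unc.
have /choice[t /choice[b tb]] := aP.
have [U UP] := fine_ultrafilter requirement.
have tP l m : \forall s \near ultra_sets U,
    `|rnorm (qcomb (t s) l) - rnorm (qcomb id l)| <= 2^-1 ^+ m.
  by apply: filterS (UP (inl (l, m))) => s /(tb s).2.
have [T Ti Tdiag] := rational_isometry tP.
have [y Ty] := rigid _ _ T Ti (e a).
(* Rigidity places [e (b s)] within [d / 2] of a single [y] for almost all [s]. Forbidding the value
   [e (b s0)] yields a second such vector, at distance at least [d] from the first: a
   contradiction. *)
have near := Tdiag _ _ _ Ty (divr_gt0 d0 (ltr0n R 2)).
have [s0 h0] := filter_ex near; rewrite /= (tb s0).1 in h0.
have [s [/= hs /(tb s).2/= ns]] := filter_ex (filterI near (UP (inr (e (b s0))))).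
rewrite (tb s).1 in hs.
have : d <= rnorm (e (b s) - e (b s0)) by apply: ed => bb; apply: ns; rewrite bb.
by have := rnorm_triangle y (e (b s)) (e (b s0)); rewrite [rnorm (y - _)]rnormBC; lra.
Qed.

End Separability.

(** * Density characters and the main theorem *)

Section Density.
Context {R : realType} {k : scalar_kind}.
Local Notation K := (scalar_field R k).

Lemma has_density_injects (X : topologicalType) (k1 k2 : Type) :
  has_density_character X k1 -> has_density_character X k2 -> injects k1 k2.
Proof.
move=> [_ min1] [[D [Dd Dk2]] _]; apply/injects_card_leT.
by rewrite -(card_le_eqr Dk2); exact: min1.
Qed.

Lemma isometric_density (X Y : normedModType K) (kappa : Type) :
  isometric X Y -> has_density_character X kappa -> has_density_character Y kappa.
Proof.
move=> /isometric_inv[f [g [fi gi fK gK]]].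
have push (S T : normedModType K) (p : S -> T) (q : T -> S) (D : set S) :
    lin_isometry p -> cancel p q -> cancel q p -> dense D ->
    dense (p @` D) /\ (p @` D #= D)%card.
  move=> pi pK qK /denseP Dd; split.
    apply/denseP => y r r0; have [x xD qx] := Dd (q y) r r0; exists (p x); first by exists x.
    by rewrite -{1}(qK y) (lin_isometry_dist pi).
  by apply: inj_card_eq => x y _ _; exact: lin_isometry_inj.
move=> [[D [Dd Dk]] min]; split.
  have [fDd fDk] := push _ _ f g D fi fK gK Dd.
  by exists (f @` D); split=> //; exact: card_eq_trans fDk Dk.
move=> D' /(push _ _ g f D' gi gK fK)[gDd gDk].
by rewrite -(card_le_eqr gDk); exact: min.
Qed.

Section SumDensity.
Variables (V : lmodType K) (E : modular V).
Local Notation sumE H := (modspace (msum E (sqnorm H))).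
Hypothesis Es : separable (modspace E).

(** Orthonormal vectors are at mutual distance at least [1], which bounds dense sets from below; the
    codes over an infinite basis are no more numerous than the basis itself. *)
Lemma sum_density (H : normedModType K) (kappa : Type) (e : kappa -> H) :
  hbasis e -> injects nat kappa -> has_density_character (sumE H) kappa.
Proof.
move=> eb natk.
have inr_dist b b' : b <> b' -> 1 <= rnorm (((0, e b) : sumE H) - (0, e b')).
  move=> bb'; have := lin_isometry_dist (@inr_isometry R k V E H) (e b) (e b').
  by move=> ->; exact: orthonormal_dist eb.1 bb'.
have min (D : set (sumE H)) : dense D -> ([set: kappa] #<= D)%card.
  move=> /denseP Dd; have h0 : 0 < 2^-1 :> R by rewrite invr_gt0.
  have /choice[f fP] : forall b, exists x, D x /\ rnorm (((0, e b) : sumE H) - x) < 2^-1.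
    by move=> b; have [x xD h] := Dd (0, e b) _ h0; exists x.
  apply: (injects_card_le (f := f)) => [b _|b b' _ _ fb]; first exact: (fP b).1.
  apply: contrapT => /inr_dist; have := (fP b).2; have := (fP b').2; rewrite -fb.
  have := rnorm_triangle (f b) ((0, e b) : sumE H) (0, e b').
  rewrite [rnorm (f b - _)]rnormBC; lra.
split=> //; have /separableP[d dd] := Es.
exists (range (sum_code d e)); have dD : dense (range (sum_code d e)).
  by apply/denseP; exact: sum_code_dense dd eb.2.
split=> //; apply: Cantor_Bernstein; last exact: min.
apply: card_le_trans (card_image_le _ _) _; apply/injects_card_leT.
exact: injects_code.
Qed.

Lemma sum_density_countable (H : normedModType K) (B kappa : Type) (e : B -> H) :
  hbasis e -> injects B nat -> has_density_character (sumE H) kappa -> injects kappa nat.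
Proof.
move=> eb Bnat [_ min]; have /separableP[d dd] := Es.
have dD : dense (range (sum_code d e)) by apply/denseP; exact: sum_code_dense dd eb.2.
apply/injects_card_leT; apply: card_le_trans (min _ dD) _.
apply: card_le_trans (card_image_le _ _) _; apply/injects_card_leT.
exact: injects_code_nat.
Qed.

(** Serves both halves of the theorem: [Q] is trivial in one and infinite dimension in the other. An
    infinite basis of [H] has the density of the sum for its cardinal, so density [kappa] determines
    [H]. *)
Lemma categorical_sum (X : normedModType K) (Q : normedModType K -> Prop) (kappa : Type) :
  (forall Y, elementary_class X Y <->
    exists H : normedModType K, [/\ hilbert H, Q H & isometric Y (sumE H)]) ->
  injects nat kappa ->
  (forall (H : normedModType K) (e : kappa -> H), hilbert H -> hbasis e -> Q H) ->
  (forall (H : normedModType K) (B : Type) (e : B -> H), hilbert H -> Q H ->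
    has_density_character (sumE H) kappa -> hbasis e -> injects nat B) ->
  categorical kappa X.
Proof.
move=> cls natk Qk Qinf.
have [H hH [e eb]] := hilbert_of_dim kappa (@hilbert_ell2 R k) (@separated_ell2 R k).
have dH := sum_density eb natk.
exists (sumE H); split=> // [|Z /cls[H' [hH' QH' ZH']] Zd].
  by apply/cls; exists H; split=> //; [exact: Qk eb|exact: isometric_refl].
have dH' := isometric_density ZH' Zd.
have [B [e' eb']] := hilbert_hbasis hH'.
have dB := sum_density eb' (Qinf _ _ _ hH' QH' dH' eb').
have [f fb] := injects_antisym (has_density_injects dB dH') (has_density_injects dH' dB).
apply: isometric_trans ZH' _; apply: msum_isometric.
exact: hbasis_isometric hH' hH eb' (hbasis_bij fb eb).
Qed.

End SumDensity.

Lemma hbasis_infinite (B : Type) (H : normedModType K) (e : B -> H) :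
  hbasis e -> ~ finite_dim H -> injects nat B.
Proof.
move=> [eo ed] Hinf; apply/injects_card_leT; apply/infiniteP => Bfin.
have [s sP] : exists s : seq H, forall b, e b \in s.
  have /finite_seqP[s sE] : finite_set (range e) by exact: finite_image Bfin.
  by exists s => b; have : range e (e b) by [exists b]; rewrite sE.
apply: Hinf; apply/finite_dim_spanned; exists (size s), (nth 0 s) => x.
apply: spanned_closed => r r0; have [_ [l _ <-] xl] := ed x r r0; exists (comb e l) => //.
rewrite /comb; elim: l {xl} => [|p l IH]; first by rewrite big_nil; exact: spanned0.
rewrite big_cons; apply: spannedD IH; rewrite -(nth_index 0 (sP p.2)).
by apply: spanned_gen; rewrite index_mem.
Qed.

Lemma hbasis_separated (B : Type) (H : normedModType K) (e : B -> H) :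
  hbasis e -> injects nat B -> separated_sequence H.
Proof.
move=> [eo _] [f fi]; exists (e \o f); split=> [n|m n mn] /=.
  by rewrite (orthonormal_norm _ eo).
have : 1 <= rnorm (e (f n) - e (f m)); last lra.
by apply: (orthonormal_dist eo) => /fi nm; rewrite nm ltnn in mn.
Qed.

Lemma finite_dim_prod (V1 V2 : lmodType K) :
  finite_dim V1 -> finite_dim V2 -> finite_dim (V1 * V2)%type.
Proof.
move=> [n1 [e1 h1]] [n2 [e2 h2]].
exists (n1 + n2)%N, (fun i => match fintype.split i with inl j => (e1 j, 0) | inr j => (0, e2 j) end).
move=> [x y]; have [[c1 ->] [c2 ->]] := (h1 x, h2 y).
exists (fun i => match fintype.split i with inl j => c1 j | inr j => c2 j end).
rewrite big_split_ord /=.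
under [X in _ = X + _]eq_bigr => i _ do rewrite -[lshift _ _]/(unsplit (inl i)) unsplitK.
under [X in _ = _ + X]eq_bigr => i _ do rewrite -[rshift _ _]/(unsplit (inr i)) unsplitK.
have l n (c : 'I_n -> K) (e : 'I_n -> V1) :
    \sum_(i < n) c i *: ((e i, 0) : V1 * V2) = (\sum_(i < n) c i *: e i, 0).
  elim/big_rec2: _ => [//|i y1 y2 _ ->].
  by rewrite [LHS]surjective_pairing /= scaler0 addr0.
have r n (c : 'I_n -> K) (e : 'I_n -> V2) :
    \sum_(i < n) c i *: ((0, e i) : V1 * V2) = (0, \sum_(i < n) c i *: e i).
  elim/big_rec2: _ => [//|i y1 y2 _ ->].
  by rewrite [LHS]surjective_pairing /= scaler0 addr0.
by rewrite l r [RHS]surjective_pairing /= addr0 add0r.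
Qed.

End Density.

(** * Infinite dimensional rigid spaces: separability, elementary class, categoricity *)

Section RigidSpace.
Context {R : realType} {k : scalar_kind}.
Local Notation K := (scalar_field R k).
Variables (V : lmodType K) (E : modular V).
Local Notation sumE H := (modspace (msum E (sqnorm H))).
Hypothesis Eb : banach (modspace E).
Hypothesis Einf : ~ finite_dim V.
Hypothesis D2 : Delta2 E.
Hypothesis Eultra : forall (I : Type) (U : ultrafilter I),
  exists2 H : normedModType K, hilbert H &
    isomodular (ultra_modular E U) (msum E (sqnorm H)).
Hypothesis Erigid : forall H : normedModType K, hilbert H ->
  forall T : {linear modspace E -> sumE H},
    is_isometry T -> range T = summand1 E (sqnorm H).

(** The predicate [True] gives the hypothesis the shape that [summand_in_range] expects of a subset
    [G0]. *)
Let rigid (H : normedModType K) : hilbert H ->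
  forall T : modspace E -> sumE H, lin_isometry T ->
    forall z, (exists2 x, True & T x = z) <-> z.2 = 0.
Proof.
move=> hH T [Tl Tn] z; have iT : is_isometry (mklin Tl) by apply/isometryP.
by rewrite -[z.2 = 0]/(summand1 E (sqnorm H) z) -(Erigid hH iT).
Qed.

Let ultra_sum (H : normedModType K) : hilbert H ->
  forall (I : Type) (U : ultrafilter I), exists2 H' : normedModType K, hilbert H' &
    isometric (ultrapower (sumE H) U) (sumE H').
Proof.
move=> hH I U; have [H1 hH1 iso] := Eultra U.
exists (hsum H1 (ultrapower H U)); first by apply: hilbert_sum => //; exact: hilbert_ultrapower.
apply: isomodular_ultra_isometric; first exact: Delta2_msum (Delta2_sqnorm H).
exact: isomodular_ultra_sum.
Qed.

Let ultraE (I : Type) (U : ultrafilter I) : exists2 H : normedModType K, hilbert H &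
  isometric (ultrapower (modspace E) U) (sumE H).
Proof. by have [H hH iso] := Eultra U; exists H => //; exact: isomodular_ultra_isometric. Qed.

Lemma rigid_separable : separable (modspace E).
Proof.
apply: separable_of_rigid => I U T Ti x; have [H hH] := ultraE U.
move=> /isometric_inv[f [g [fi gi fK gK]]].
have fT := lin_isometry_comp fi Ti.
have fd := lin_isometry_comp fi (diag_isometry (modspace E) U).
have /(rigid hH fT) : exists2 x', True & (f \o T) x' = f (T x) by exists x.
by move=> /(rigid hH fd)[y _ /= /(can_inj fK) yE]; exists y.
Qed.

Lemma rigid_class (Y : normedModType K) : elementary_class (modspace E) Y <->
  exists2 H : normedModType K, hilbert H & isometric Y (sumE H).
Proof.
split=> [[Yb [I [J [U [W EY]]]]]|[H hH YH]].
  have [H hH EH] := ultraE U.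
  have YH : isometric (ultrapower Y W) (sumE H).
    exact: isometric_trans (isometric_sym EY) EH.
  have /isometric_inv[f [g [fi gi fK gK]]] := YH.
  have [H' hH' /isometric_inv[h [_ [hi _ _ _]]]] := ultra_sum hH W.
  apply: (split_summand Yb hH (lin_isometry_comp fi (diag_isometry Y W))) => e.
  exact: (summand_in_range (G0 := fun=> True) Yb (inl_isometry E (sqnorm H))
    fi gi gK hi (rigid hH) (rigid hH')).
have Esep : separated_sequence (modspace E).
  by apply: contrapT => /finite_dimP.
split; first exact: isometric_banach YH (banach_sum_hilbert Eb hH.1).
apply: (ultrapowers_isometric (E := E) rigid_separable Esep).
- exact: separated_isometric YH (separated_embed (inl_isometry E (sqnorm H)) Esep).
- exact: ultraE.
- move=> I U; have [H' hH' iso] := ultra_sum hH U; exists H' => //.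
  exact: isometric_trans (isometric_ultrapower U YH) iso.
Qed.

Lemma rigid_uncountably_categorical : uncountably_categorical (modspace E).
Proof.
exists (nat -> bool); split; first by move=> /injects_card_leT; exact: cantor_nat.
apply: (categorical_sum (E := E) (Q := fun=> True) rigid_separable) => //.
- move=> Y; apply: (iff_trans (rigid_class Y)).
  by split=> [[H hH YH]|[H [hH _ YH]]]; exists H.
- exists (fun n m => m == n) => n m /(congr1 (fun h => h n)).
  by rewrite eqxx => /esym/eqP.
(* Were the basis countable, the sum would be separable, against its density being that of
   [nat -> bool]. *)
- move=> H B e hH _ dens eb; have [//|Bnat] := injects_nat_or B.
  by case: (cantor_nat (sum_density_countable rigid_separable eb Bnat dens)).
Qed.

End RigidSpace.

(** * Finite dimensional spaces summed with infinite dimensional Hilbert spaces *)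

Section FiniteDimSum.
Context {R : realType} {k : scalar_kind}.
Local Notation K := (scalar_field R k).
Variables (V : lmodType K) (E : modular V).
Local Notation sumE H := (modspace (msum E (sqnorm H))).
Local Notation L := (modspace (ell2_modular R k)).
Local Notation EL := (modspace (msum E (ell2_modular R k))).
Hypothesis Eb : banach (modspace E).
Hypothesis Efin : finite_dim V.
Hypothesis D2 : Delta2 E.
Hypothesis Erigid : forall H : normedModType K, hilbert H -> ~ finite_dim H ->
  forall T : {linear EL -> sumE H}, is_isometry T ->
    T @` summand1 E (ell2_modular R k) = summand1 E (sqnorm H).

Let rigid (H : normedModType K) : hilbert H -> ~ finite_dim H ->
  forall T : EL -> sumE H, lin_isometry T ->
    forall z, (exists2 x, summand1 E (ell2_modular R k) x & T x = z) <-> z.2 = 0.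
Proof.
move=> hH Hinf T [Tl Tn] z; have iT : is_isometry (mklin Tl) by apply/isometryP.
by rewrite -[z.2 = 0]/(summand1 E (sqnorm H) z) -(Erigid hH Hinf iT).
Qed.

Let Linf : ~ finite_dim L.
Proof. by move=> /finite_dimP; apply; exact: separated_ell2. Qed.

Let EL_iso : isometric EL (sumE L).
Proof. exact: isomodular_isometric (isomodular_ell2_sum E). Qed.

(** The embedding of [H] into [H'] is recorded because rigidity is assumed here for infinite
    dimensional Hilbert spaces, and infinite dimension has to be carried along to [H']. *)
Let ultra_sum (H : normedModType K) : hilbert H ->
  forall (I : Type) (U : ultrafilter I), exists H' : normedModType K,
    [/\ hilbert H', isometric (ultrapower (sumE H) U) (sumE H') &
        exists f : H -> H', lin_isometry f].
Proof.
move=> hH I U; have [H1 hH1 iso] := finite_dim_isomodular U D2 Efin.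
exists (hsum H1 (ultrapower H U)); split.
- by apply: hilbert_sum => //; exact: hilbert_ultrapower.
- apply: isomodular_ultra_isometric; first exact: Delta2_msum (Delta2_sqnorm H).
  exact: isomodular_ultra_sum.
- eexists; apply: lin_isometry_comp (diag_isometry H U).
  exact: (@inr_isometry R k H1 (sqnorm H1)).
Qed.

Let infinite_embed (H H' : normedModType K) (f : H -> H') :
  lin_isometry f -> ~ finite_dim H -> ~ finite_dim H'.
Proof. by move=> fi Hinf Hfin; apply: Hinf; exact: finite_dim_embed fi Hfin. Qed.

Lemma finite_dim_sum_class (Y : normedModType K) : elementary_class EL Y <->
  exists H : normedModType K, [/\ hilbert H, ~ finite_dim H & isometric Y (sumE H)].
Proof.
split=> [[Yb [I [J [U [W EY]]]]]|[H [hH Hinf YH]]].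
  have [H [hH LH [i ii]]] := ultra_sum (@hilbert_ell2 R k) U.
  have Hinf : ~ finite_dim H := infinite_embed ii Linf.
  have YH : isometric (ultrapower Y W) (sumE H).
    apply: isometric_trans (isometric_sym EY) _.
    exact: isometric_trans (isometric_ultrapower U EL_iso) LH.
  have /isometric_inv[f [g [fi gi fK gK]]] := YH.
  have [H' [hH' /isometric_inv[h [_ [hi _ _ _]]] [i' ii']]] := ultra_sum hH W.
  (* Rigidity concerns maps defined on [E + l_2], so [l_2] is carried into [H] by [i] while [E] is
     fixed. *)
  pose S (z : EL) : sumE H := (z.1, i z.2).
  have Si : lin_isometry S.
    apply: modular_isometry => [a z w|z]; last by rewrite /= ii.2 ell2_rnorm.
    by rewrite [RHS]surjective_pairing /S /= ii.1.
  have [H2 hH2 YH2] : exists2 H2 : normedModType K, hilbert H2 & isometric Y (sumE H2).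
    apply: (split_summand Yb hH (lin_isometry_comp fi (diag_isometry Y W))) => e.
    exact: (summand_in_range Yb Si fi gi gK hi (rigid hH Hinf)
      (rigid hH' (infinite_embed ii' Hinf))).
  (* If [H2] were finite dimensional, so would be [Y]; then [Y] would be isometric to its
     ultrapower, which contains the infinite dimensional [H]. *)
  exists H2; split=> // H2fin.
  have Yfin : finite_dim Y.
    have /isometric_inv[p [_ [pi _ _ _]]] := YH2.
    apply: finite_dim_embed pi _; exact: finite_dim_prod Efin H2fin.
  have YW : isometric (ultrapower Y W) Y.
    apply: isometric_sym; apply/isometricP; exists (diag W).
    split=> [|z]; first exact: diag_isometry.
    by have [x ->] := @finite_dim_diag R k Y J W Yfin z; exists x.
  have /isometric_inv[p [_ [pi _ _ _]]] := isometric_trans (isometric_sym YH) YW.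
  apply: Hinf; apply: finite_dim_embed (@inr_isometry R k V E H) _.
  exact: finite_dim_embed pi Yfin.
have Es : separable (modspace E) := @finite_dim_separable R k (modspace E) Efin.
have inr_sep (H' : normedModType K) : ~ finite_dim H' -> separated_sequence (sumE H').
  move=> H'inf; apply: separated_embed (@inr_isometry R k V E H') _.
  by apply: contrapT => /finite_dimP.
split; first exact: isometric_banach YH (banach_sum_hilbert Eb hH.1).
apply: (ultrapowers_isometric (E := E) Es).
- exact: separated_isometric EL_iso (inr_sep _ Linf).
- exact: separated_isometric YH (inr_sep _ Hinf).
- move=> I U; have [H' [hH' iso _]] := ultra_sum (@hilbert_ell2 R k) U.
  exists H'; first exact: hH'.
  exact: isometric_trans (isometric_ultrapower U EL_iso) iso.
- move=> I U; have [H' [hH' iso _]] := ultra_sum hH U; exists H'; first exact: hH'.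
  exact: isometric_trans (isometric_ultrapower U YH) iso.
Qed.

Lemma finite_dim_sum_categorical (kappa : Type) : infinite_set [set: kappa] -> categorical kappa EL.
Proof.
move=> /infiniteP/injects_card_leT natk.
have Es : separable (modspace E) := @finite_dim_separable R k (modspace E) Efin.
apply: (categorical_sum (Q := fun H => ~ finite_dim H) Es finite_dim_sum_class natk).
- move=> H e hH eb /finite_dimP; apply; exact: hbasis_separated eb natk.
- by move=> H B e hH Hinf _ eb; exact: hbasis_infinite eb Hinf.
Qed.

End FiniteDimSum.

Theorem theorem2p1 (R : realType) (k : scalar_kind) :
  (forall (V : lmodType (scalar_field R k)) (E : modular V),
    banach (modspace E) -> ~ finite_dim V -> Delta2 E ->
    (forall (I : Type) (U : ultrafilter I),
      exists2 H : normedModType (scalar_field R k), hilbert H &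
        isomodular (ultra_modular E U) (msum E (sqnorm H))) ->
    (forall H : normedModType (scalar_field R k), hilbert H ->
      forall T : {linear modspace E -> modspace (msum E (sqnorm H))},
        is_isometry T -> range T = summand1 E (sqnorm H)) ->
    [/\ forall Y : normedModType (scalar_field R k),
          elementary_class (modspace E) Y <->
          exists2 H : normedModType (scalar_field R k), hilbert H &
            isometric Y (modspace (msum E (sqnorm H))),
        uncountably_categorical (modspace E) &
        separable (modspace E)])
  /\
  (forall (V0 : lmodType (scalar_field R k)) (E0 : modular V0),
    banach (modspace E0) -> finite_dim V0 -> Delta2 E0 ->
    (forall H : normedModType (scalar_field R k),
      hilbert H -> ~ finite_dim H ->
      forall T : {linear modspace (msum E0 (ell2_modular R k)) ->
                  modspace (msum E0 (sqnorm H))},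
        is_isometry T ->
        T @` summand1 E0 (ell2_modular R k) = summand1 E0 (sqnorm H)) ->
    (forall Y : normedModType (scalar_field R k),
      elementary_class (modspace (msum E0 (ell2_modular R k))) Y <->
      exists H : normedModType (scalar_field R k),
        [/\ hilbert H, ~ finite_dim H &
            isometric Y (modspace (msum E0 (sqnorm H)))])
    /\
    (forall kappa : Type, infinite_set [set: kappa] ->
      categorical kappa (modspace (msum E0 (ell2_modular R k))))).
Proof.
split=> [V E Eb Einf D2 Eu Er|V E Eb Efin D2 Er].
  split; [exact: rigid_class|exact: rigid_uncountably_categorical|exact: rigid_separable].
by split; [exact: finite_dim_sum_class|exact: finite_dim_sum_categorical].
Qed.
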